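(* For all $\alpha>0$ and $x_0>0$ there exists $\theta_0(x_0)>0$ such that for all $0<\theta<\theta_0(x_0)$ the following holds. A nonzero solution $u$ of $u''+c^{-2}(x)u=0$, with $c^{-2}(x)=1+\theta x_+^\alpha$, is outgoing to $+\infty$ if and only if \[ \frac{u'(x_0)}{u(x_0)}=\frac{(v^>)'(x_0)+R_{x_0}(v^<)'(x_0)}{v^>(x_0)+R_{x_0}v^<(x_0)}, \qquad\text{where}\qquad R_{x_0}=\frac{1}{2i}\int_{x_0}^{+\infty}M(x')S^{>}(x')\,dx'. \]
   Context: Notation: $x_+=\max(x,0)$, $c(x)=(1+\theta x_+^\alpha)^{-1/2}$, $\phi(x)=\int_0^x\frac{dy}{c(y)}$, $b(x)=c(x)^{1/2}$, $v^>(x)=b(x)e^{-i\phi(x)}$, $v^<(x)=b(x)e^{i\phi(x)}$, and $M(x)=c^{1/2}(x)\,(c^{1/2})''(x)$ for $x>0$. Put $M_{x_0}=\int_{x_0}^{\infty}|M(x)|\,dx$. (All these depend on $\theta$ and $\alpha$.) $S^>$ denotes the bounded continuous solution on $[x_0,\infty)$ of the Volterra equation \[ S^>(x)=e^{-2i\phi(x)}+\frac{1}{2i}\left[\int_{x_0}^xM(y)S^>(y)e^{-2i(\phi(x)-\phi(y))}dy+\int_x^{+\infty}M(y)S^>(y)\,dy\right], \] which exists and is unique as soon as $M_{x_0}<2$; this is the case for $\theta$ small enough. A nonzero solution $u$ of $u''+c^{-2}(x)u=0$ on $\mathbb{R}$ is outgoing to $+\infty$ if there is a sequence of solutions $u(\cdot;\sigma)$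 of $u''+(1+i\sigma)^2c^{-2}(x)u=0$, with real $\sigma<0$ tending to $0$, such that $u(x;\sigma)\to u(x)$ as $\sigma\to0^-$ uniformly on compact sets of $x$, and $\lim_{x\to+\infty}u(x;\sigma)=0$ for each such $\sigma$. *)

(* Defs.v *)
From Stdlib Require Import Reals Lra.
From Coquelicot Require Import Coquelicot.
Open Scope R_scope.

(* The case split is needed because [Rpower 0 alpha] is 1, not 0. *)
Definition pos_pow (x alpha : R) : R :=
  if Rlt_dec 0 x then Rpower x alpha else 0.

Definition c (theta alpha x : R) : R := / sqrt (1 + theta * pos_pow x alpha).

Definition phi (theta alpha x : R) : R :=
  RInt (fun y => / c theta alpha y) 0 x.

Definition b (theta alpha x : R) : R := sqrt (c theta alpha x).

(* Only meaningful for [0 < x]: [b] need not be twice differentiable at 0. *)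
Definition M (theta alpha x : R) : R :=
  b theta alpha x * Derive_n (b theta alpha) 2 x.

(* exp (i t) *)
Definition cis (t : R) : C := (cos t, sin t).

Definition v_gt (theta alpha x : R) : C :=
  (RtoC (b theta alpha x) * cis (- phi theta alpha x))%C.

Definition v_lt (theta alpha x : R) : C :=
  (RtoC (b theta alpha x) * cis (phi theta alpha x))%C.

(* Derivative of a complex-valued function of a real variable; Coquelicot's
   [C_derive] is for functions of a complex variable. *)
Definition CDerive (f : R -> C) (x : R) : C :=
  (Derive (fun t => Re (f t)) x, Derive (fun t => Im (f t)) x).

Definition CInt (f : R -> C) (p q : R) : C :=
  RInt (V := C_R_CompleteNormedModule) f p q.

Definition CInt_infty (f : R -> C) (p : R) : C :=
  RInt_gen (V := C_R_CompleteNormedModule) f (at_point p) (Rbar_locally p_infty).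

Definition is_S_gt (theta alpha x0 : R) (S : R -> C) : Prop :=
  (exists B : R, forall x, x0 <= x -> Cmod (S x) <= B) /\
  continuous_on (fun x => x0 <= x) S /\
  (forall x, x0 <= x ->
    S x = (cis (- 2 * phi theta alpha x)
           + / (2 * Ci) *
             (CInt (fun y => RtoC (M theta alpha y) * S y
                             * cis (- 2 * (phi theta alpha x - phi theta alpha y)))
                   x0 x
              + CInt_infty (fun y => RtoC (M theta alpha y) * S y) x))%C).

Definition reflection (theta alpha x0 : R) (S : R -> C) : C :=
  (/ (2 * Ci) * CInt_infty (fun y => RtoC (M theta alpha y) * S y) x0)%C.

(* u'' + k^2 c^{-2} u = 0 on the whole real line *)
Definition solution (theta alpha : R) (k : C) (u : R -> C) : Prop :=
  forall x : R,
    ex_derive (V := C_R_NormedModule) u x /\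
    ex_derive (V := C_R_NormedModule) (CDerive u) x /\
    (CDerive (CDerive u) x + k * k * RtoC (/ (c theta alpha x) ^ 2) * u x
     = RtoC 0)%C.

Definition outgoing (theta alpha : R) (u : R -> C) : Prop :=
  exists (sigma : nat -> R) (w : nat -> R -> C),
    (forall n, sigma n < 0) /\
    is_lim_seq sigma 0 /\
    (forall n, solution theta alpha (1 + Ci * RtoC (sigma n))%C (w n)) /\
    (forall K : R -> Prop, compact K -> forall eps : R, 0 < eps ->
       exists N : nat, forall n x, (N <= n)%nat -> K x ->
         Cmod (w n x - u x)%C < eps) /\
    (forall n, filterlim (w n) (Rbar_locally p_infty) (locally (RtoC 0))).

(* Main.v *)
Require Import Defs.
From Stdlib Require Import Reals Lra Lia IndefiniteDescription.
From Coquelicot Require Import Coquelicot.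
Open Scope R_scope.

(* Write k = 1 + i sigma with sigma <= 0.  The WKB functions v = b exp(-/+ i k phi) satisfy
   v'' + k^2 c^{-2} v = (b''/b) v, so variation of constants looks for a solution
   U = b exp(-i k phi) T where T solves a Volterra equation with kernel bounded by |M|/2.
   Since |M(x)| <= const theta^delta x^{-1-delta} with delta = 1/(1+alpha), the kernel is a
   contraction for theta small, uniformly in sigma; T is bounded, close to 1, and depends
   continuously on sigma up to sigma = 0, where S = T exp(-2 i phi) and U(x0), U'(x0) are the
   denominator and numerator of the theorem.

   For sigma < 0 the wave U decays and U' is bounded, hence any solution w tending to 0 has zero
   Wronskian with U and is proportional to it on [x0, +oo); letting sigma -> 0 shows that an
   outgoing u is proportional to U at sigma = 0.  Conversely the global solutions with the
   Cauchy data of a multiple of U at x0 decay at +oo and, by Gronwall, converge locally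
   uniformly to u. *)

(** * Complex-valued functions of a real variable *)

(** The forward integral is anchored at x0 and the backward one at +oo, so that for sigma <= 0 both
    kernels, 1 and exp(-2ik(phi(y) - phi(x))) with y >= x, have modulus at most 1: one smallness
    condition on theta thus serves every sigma. The anchoring also makes the forward part vanish at
    x0, so that U(x0) = v^> + R v^< with R given by the backward integral alone.

    All estimates go through one integrable majorant h of |M| with explicit tail integral H. Since
    H(x0) <= 1/2 and the Green factor 1/(2ik) has modulus at most 1/2, the Volterra operator
    contracts by 1/4; this keeps T within 1/2 of 1, so U has no zero on [x0, +oo).

    Two obstacles shape the rest. An approximating solution w is only known to tend to 0, with
    nothing said about w', so its Wronskian with U cannot simply be sent to 0 at infinity; an
    identity for (w U)' is integrated over a far unit interval instead. And outgoing solutions live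
    on the whole line, while U is controlled only on [x0, +oo), which calls for a global existence
    theorem for the equation. *)

Notation cderiv f x l := (is_derive (K := R_AbsRing) (V := C_R_NormedModule) f x l).
Notation ccont f x := (continuous (T := R_UniformSpace) (U := C_UniformSpace) f x).

Lemma C_ext (z w : C) : fst z = fst w -> snd z = snd w -> z = w.
Proof. destruct z, w; simpl; intros; subst; reflexivity. Qed.

Lemma norm_Cmod (z : C) : norm (V := C_R_NormedModule) z = Cmod z.
Proof. symmetry; apply Cmod_norm. Qed.

(** Bridge between the two notions of derivative in [solution]: differentiability in the normed
    module and the componentwise [CDerive]. For the converse, f is written as Re f times 1 plus Im f
    times i, two real functions times fixed vectors. *)
Lemma cderiv_pair (f : R -> C) x l :
  cderiv f x l <->
  is_derive (fun t => fst (f t)) x (fst l) /\ is_derive (fun t => snd (f t)) x (snd l).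
Proof.
  split.
  - intros H; split.
    + apply (filterdiff_ext_lin (V := R_NormedModule) (fun t => fst (f t)) (fun y : R => fst (scal y l : C_R_NormedModule))).
      * apply (filterdiff_comp (V := C_R_NormedModule) (W := R_NormedModule) f fst (fun y : R => scal y l) fst).
        -- exact H.
        -- apply filterdiff_linear, is_linear_fst.
      * reflexivity.
    + apply (filterdiff_ext_lin (V := R_NormedModule) (fun t => snd (f t)) (fun y : R => snd (scal y l : C_R_NormedModule))).
      * apply (filterdiff_comp (V := C_R_NormedModule) (W := R_NormedModule) f snd (fun y : R => scal y l) snd).
        -- exact H.
        -- apply filterdiff_linear, is_linear_snd.
      * reflexivity.
  - intros [H1 H2].
    assert (H : cderiv (fun t => plus (scal (fst (f t)) (RtoC 1)) (scal (snd (f t)) Ci) : C_R_NormedModule) x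
       (plus (scal (fst l) (RtoC 1)) (scal (snd l) Ci))).
    { apply (is_derive_plus (V := C_R_NormedModule)).
      - exact (is_derive_scal_l (V := C_R_NormedModule) _ x _ (RtoC 1) H1).
      - exact (is_derive_scal_l (V := C_R_NormedModule) _ x _ Ci H2). }
    replace l with (plus (scal (fst l) (RtoC 1)) (scal (snd l) Ci) : C_R_NormedModule).
    + eapply (is_derive_ext (V := C_R_NormedModule)); [| exact H].
      intros t; apply C_ext; unfold plus, scal; simpl; unfold prod_plus, prod_scal, plus, scal, mult; simpl;
        unfold mult; simpl; ring.
    + apply C_ext; unfold plus, scal; simpl; unfold prod_plus, prod_scal, plus, scal, mult; simpl;
        unfold mult; simpl; ring.
Qed.

Lemma CDerive_unique (f : R -> C) x l : cderiv f x l -> CDerive f x = l.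
Proof.
  intros H; apply cderiv_pair in H as [H1 H2].
  apply C_ext; simpl; apply is_derive_unique; assumption.
Qed.

Lemma cderiv_CDerive (f : R -> C) x :
  ex_derive (V := C_R_NormedModule) f x -> cderiv f x (CDerive f x).
Proof. intros [l H]; rewrite (CDerive_unique f x l H); exact H. Qed.

Lemma cderiv_ext (f g : R -> C) x l :
  (forall t, f t = g t) -> cderiv f x l -> cderiv g x l.
Proof. intros; eapply (is_derive_ext (V := C_R_NormedModule)); eauto. Qed.

Lemma cderiv_val (f : R -> C) x (l l' : C) : l = l' -> cderiv f x l -> cderiv f x l'.
Proof. intros ->; auto. Qed.

Lemma cderiv_const (a : C) x : cderiv (fun _ => a) x (RtoC 0).
Proof. apply (is_derive_const (V := C_R_NormedModule)). Qed.

Lemma cderiv_plus (f g : R -> C) x lf lg :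
  cderiv f x lf -> cderiv g x lg -> cderiv (fun t => (f t + g t)%C) x (lf + lg)%C.
Proof. intros; apply (is_derive_plus (V := C_R_NormedModule)); assumption. Qed.

Lemma cderiv_minus (f g : R -> C) x lf lg :
  cderiv f x lf -> cderiv g x lg -> cderiv (fun t => (f t - g t)%C) x (lf - lg)%C.
Proof. intros; apply (is_derive_minus (V := C_R_NormedModule)); assumption. Qed.

Lemma is_derive_Rmult (f g : R -> R) (x lf lg : R) :
  is_derive f x lf -> is_derive g x lg ->
  is_derive (fun t => f t * g t) x (lf * g x + f x * lg).
Proof. intros; apply (is_derive_mult f g); auto; intros; apply Rmult_comm. Qed.

Lemma cderiv_mult (f g : R -> C) x lf lg :
  cderiv f x lf -> cderiv g x lg ->
  cderiv (fun t => (f t * g t)%C) x (lf * g x + f x * lg)%C.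
Proof.
  intros Hf Hg; apply cderiv_pair in Hf as [Hf1 Hf2]; apply cderiv_pair in Hg as [Hg1 Hg2].
  apply cderiv_pair; split; simpl.
  - replace (_ + _) with ((fst lf * fst (g x) + fst (f x) * fst lg)
                          - (snd lf * snd (g x) + snd (f x) * snd lg)) by ring.
    apply (is_derive_minus (V := R_NormedModule)); apply is_derive_Rmult; assumption.
  - replace (_ + _) with ((fst lf * snd (g x) + fst (f x) * snd lg)
                          + (snd lf * fst (g x) + snd (f x) * fst lg)) by ring.
    apply (is_derive_plus (V := R_NormedModule)); apply is_derive_Rmult; assumption.
Qed.

Lemma cderiv_RtoC (f : R -> R) (x l : R) :
  is_derive f x l -> cderiv (fun t => RtoC (f t)) x (RtoC l).
Proof. intros H; apply cderiv_pair; split; simpl; [exact H | apply (is_derive_const (V:=R_NormedModule))]. Qed.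

Lemma cderiv_comp (f : R -> C) (g : R -> R) x dg l :
  is_derive g x dg -> cderiv f (g x) l -> cderiv (fun t => f (g t)) x (RtoC dg * l)%C.
Proof.
  intros Hg Hf. eapply cderiv_val; [| apply (is_derive_comp (V := C_R_NormedModule) f g x l dg Hf Hg)].
  apply scal_R_Cmult.
Qed.

Lemma cderiv_ccont (f : R -> C) x l : cderiv f x l -> ccont f x.
Proof.
  intros H. apply (ex_derive_continuous (V := C_R_NormedModule) f x). exists l; exact H.
Qed.

Lemma ccont_pair (f : R -> C) x :
  ccont f x <-> continuous (fun t => fst (f t)) x /\ continuous (fun t => snd (f t)) x.
Proof.
  split.
  - intros H; split.
    + apply (continuous_comp f fst); [exact H|]. destruct (f x); apply continuous_fst.
    + apply (continuous_comp f snd); [exact H|]. destruct (f x); apply continuous_snd.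
  - intros [H1 H2].
    apply (filterlim_ext (fun t => (fst (f t), snd (f t)))); [intros; destruct (f x0); reflexivity|].
    unfold continuous in *.
    intros P HP. destruct HP as [e He].
    specialize (H1 (ball (fst (f x)) e) (locally_ball _ e)).
    specialize (H2 (ball (snd (f x)) e) (locally_ball _ e)).
    unfold filtermap in *.
    generalize (filter_and _ _ H1 H2). apply filter_imp. intros t [A B].
    apply He; split; assumption.
Qed.

Lemma ccont_const (a : C) x : ccont (fun _ => a) x.
Proof. apply continuous_const. Qed.

Lemma ccont_plus (f g : R -> C) x : ccont f x -> ccont g x -> ccont (fun t => (f t + g t)%C) x.
Proof.
  intros Hf Hg; apply ccont_pair in Hf as [Hf1 Hf2]; apply ccont_pair in Hg as [Hg1 Hg2].
  apply ccont_pair; split; simpl; apply (continuous_plus (V := R_NormedModule)); assumption.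
Qed.

Lemma ccont_mult (f g : R -> C) x : ccont f x -> ccont g x -> ccont (fun t => (f t * g t)%C) x.
Proof.
  intros Hf Hg; apply ccont_pair in Hf as [Hf1 Hf2]; apply ccont_pair in Hg as [Hg1 Hg2].
  apply ccont_pair; split; simpl.
  - apply (continuous_minus (V := R_NormedModule)); apply (continuous_mult (K := R_AbsRing)); assumption.
  - apply (continuous_plus (V := R_NormedModule)); apply (continuous_mult (K := R_AbsRing)); assumption.
Qed.

Lemma ccont_RtoC (f : R -> R) x : continuous f x -> ccont (fun t => RtoC (f t)) x.
Proof. intros H; apply ccont_pair; split; simpl; [exact H | apply continuous_const]. Qed.

Lemma ccont_comp (f : R -> C) (g : R -> R) x :
  continuous g x -> ccont f (g x) -> ccont (fun t => f (g t)) x.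
Proof. intros Hg Hf; apply (continuous_comp g f); assumption. Qed.

Lemma ccont_ext (f g : R -> C) x : (forall t, f t = g t) -> ccont f x -> ccont g x.
Proof. intros; eapply continuous_ext; eauto. Qed.

Lemma Cmod_fst (z : C) : Rabs (fst z) <= Cmod z.
Proof. eapply Rle_trans; [apply Rmax_l | apply Rmax_Cmod]. Qed.

Lemma Cmod_snd (z : C) : Rabs (snd z) <= Cmod z.
Proof. eapply Rle_trans; [apply Rmax_r | apply Rmax_Cmod]. Qed.

Lemma Cmod_le_sum (z : C) : Cmod z <= Rabs (fst z) + Rabs (snd z).
Proof.
  unfold Cmod. rewrite <- (sqrt_Rsqr (Rabs (fst z) + Rabs (snd z))).
  - apply sqrt_le_1_alt. unfold Rsqr.
    rewrite <- (pow2_abs (fst z)), <- (pow2_abs (snd z)).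
    pose proof (Rabs_pos (fst z)); pose proof (Rabs_pos (snd z)); nra.
  - pose proof (Rabs_pos (fst z)); pose proof (Rabs_pos (snd z)); lra.
Qed.

Lemma Cmod_minus_sym (z w : C) : Cmod (z - w) = Cmod (w - z).
Proof. rewrite <- Cmod_opp; f_equal; ring. Qed.

Lemma Cmod_minus_triangle (z w v : C) : Cmod (z - v) <= Cmod (z - w) + Cmod (w - v).
Proof. replace (z - v)%C with ((z - w) + (w - v))%C by ring. apply Cmod_triangle. Qed.

(** The uniform structure on C is that of a product, with square balls; comparing them with discs
    costs the factor 2 in one direction. *)
Lemma Cfilterlim_Cmod {T} (F : (T -> Prop) -> Prop) {FF : Filter F} (f : T -> C) (l : C) :
  filterlim f F (locally (T := C_UniformSpace) l) <->
  forall eps : R, 0 < eps -> F (fun t => Cmod (f t - l) < eps).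
Proof.
  split.
  - intros H eps He.
    assert (He2 : 0 < eps / 2) by lra.
    apply filterlim_locally with (eps := mkposreal _ He2) in H.
    revert H; apply filter_imp. intros t [A B].
    eapply Rle_lt_trans; [apply Cmod_le_sum|].
    change (Rabs (fst (f t) - fst l) < eps / 2) in A.
    change (Rabs (snd (f t) - snd l) < eps / 2) in B. simpl.
    change (fst (f t) + - fst l) with (fst (f t) - fst l).
    change (snd (f t) + - snd l) with (snd (f t) - snd l). lra.
  - intros H; apply filterlim_locally. intros eps.
    generalize (H eps (cond_pos eps)); apply filter_imp. intros t Ht. split.
    + change (Rabs (fst (f t - l)%C) < eps). eapply Rle_lt_trans; [apply Cmod_fst | exact Ht].
    + change (Rabs (snd (f t - l)%C) < eps). eapply Rle_lt_trans; [apply Cmod_snd | exact Ht].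
Qed.

Lemma ccont_Cmod (f : R -> C) x :
  ccont f x <-> forall eps, 0 < eps -> locally x (fun t => Cmod (f t - f x) < eps).
Proof. apply Cfilterlim_Cmod. apply locally_filter. Qed.

Lemma Clim_infty (f : R -> C) (l : C) :
  filterlim f (Rbar_locally p_infty) (locally (T := C_UniformSpace) l) <->
  forall eps : R, 0 < eps -> exists Y, forall x, Y < x -> Cmod (f x - l) < eps.
Proof. apply (Cfilterlim_Cmod (Rbar_locally p_infty)). Qed.

(** * Integrals of complex functions over bounded intervals *)

Lemma CInt_correct (f : R -> C) a b :
  (forall x, ccont f x) -> is_RInt (V := C_R_NormedModule) f a b (CInt f a b).
Proof.
  intros H. apply (RInt_correct (V := C_R_CompleteNormedModule)).
  apply (ex_RInt_continuous (V := C_R_CompleteNormedModule)). intros; apply H.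
Qed.

Lemma CInt_unique (f : R -> C) a b l :
  is_RInt (V := C_R_NormedModule) f a b l -> CInt f a b = l.
Proof. apply (is_RInt_unique (V := C_R_CompleteNormedModule)). Qed.

Lemma CInt_point (f : R -> C) a : CInt f a a = RtoC 0.
Proof. apply (RInt_point (V := C_R_CompleteNormedModule)). Qed.

Lemma CInt_ext (f g : R -> C) a b :
  (forall x, Rmin a b < x < Rmax a b -> f x = g x) -> CInt f a b = CInt g a b.
Proof. apply (RInt_ext (V := C_R_CompleteNormedModule)). Qed.

Lemma CInt_Chasles (f : R -> C) a b d :
  (forall x, ccont f x) -> (CInt f a b + CInt f b d)%C = CInt f a d.
Proof.
  intros H; symmetry; apply CInt_unique.
  apply (is_RInt_Chasles (V := C_R_NormedModule) f a b d); apply CInt_correct; assumption.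
Qed.

Lemma cderiv_CInt (f : R -> C) a x :
  (forall x, ccont f x) -> cderiv (fun t => CInt f a t) x (f x).
Proof.
  intros H. apply (is_derive_RInt (V := C_R_NormedModule) f (fun t => CInt f a t) a x).
  - apply filter_forall; intros; apply CInt_correct; assumption.
  - apply H.
Qed.

Lemma CInt_bound (f : R -> C) (g : R -> R) a b l :
  (forall x, ccont f x) -> a <= b ->
  (forall x, a <= x <= b -> Cmod (f x) <= g x) -> is_RInt g a b l -> Cmod (CInt f a b) <= l.
Proof.
  intros Hc Hab Hfg Hg. rewrite <- norm_Cmod.
  apply (norm_RInt_le (V := C_R_NormedModule) f g a b); auto.
  - intros; rewrite norm_Cmod; auto.
  - apply CInt_correct, Hc.
Qed.

Lemma CInt_scal (f : R -> C) (z : C) a b :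
  (forall x, ccont f x) -> CInt (fun t => z * f t)%C a b = (z * CInt f a b)%C.
Proof.
  intros H. pose proof (CInt_correct f a b H) as HI.
  apply CInt_unique.
  pose proof (is_RInt_fct_extend_fst (U := R_NormedModule) (V := R_NormedModule) f a b _ HI) as H1.
  pose proof (is_RInt_fct_extend_snd (U := R_NormedModule) (V := R_NormedModule) f a b _ HI) as H2.
  apply (is_RInt_fct_extend_pair (U := R_NormedModule) (V := R_NormedModule)); simpl.
  - apply (is_RInt_minus (V := R_NormedModule)); apply (is_RInt_scal (V := R_NormedModule)); assumption.
  - apply (is_RInt_plus (V := R_NormedModule)); apply (is_RInt_scal (V := R_NormedModule)); assumption.
Qed.

Lemma CInt_minus (f g : R -> C) a b :
  (forall x, ccont f x) -> (forall x, ccont g x) ->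
  CInt (fun t => f t - g t)%C a b = (CInt f a b - CInt g a b)%C.
Proof.
  intros Hf Hg. apply CInt_unique.
  apply (is_RInt_minus (V := C_R_NormedModule)); apply CInt_correct; assumption.
Qed.

(** * Integrals up to infinity, controlled by a majorant with known tail *)

Lemma Cfilterlim_unique (f : R -> C) (l l' : C) :
  filterlim f (Rbar_locally p_infty) (locally (T := C_UniformSpace) l) ->
  filterlim f (Rbar_locally p_infty) (locally (T := C_UniformSpace) l') -> l = l'.
Proof.
  intros H H'.
  exact (filterlim_locally_unique (K := R_AbsRing) (V := C_R_NormedModule)
    (F := Rbar_locally p_infty) f l l' H H').
Qed.

Lemma CInt_infty_unique (f : R -> C) p l :
  (forall x, p < x -> ex_RInt (V := C_R_NormedModule) f p x) ->
  filterlim (fun X => CInt f p X) (Rbar_locally p_infty) (locally (T := C_UniformSpace) l) ->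
  CInt_infty f p = l.
Proof.
  intros Hf Hl. unfold CInt_infty.
  apply (is_RInt_gen_unique (V := C_R_CompleteNormedModule)).
  intros P HP.
  apply (Filter_prod _ _ _ (fun a => a = p) (fun X => p < X /\ P (CInt f p X))).
  - reflexivity.
  - apply filter_and; [exists p; auto | apply Hl, HP].
  - intros a X -> [HX HP']. exists (CInt f p X); split; [|exact HP'].
    apply (RInt_correct (V := C_R_CompleteNormedModule)), Hf, HX.
Qed.

(* [h] is an integrable majorant on [p, +oo) whose tail integral is [H] *)
Definition tail_of (h H : R -> R) (p : R) : Prop :=
  (forall y, p <= y -> is_derive H y (- h y)) /\
  (forall y, p <= y -> continuous h y) /\
  (forall y, p <= y -> 0 <= h y) /\
  (forall y, p <= y -> 0 <= H y) /\
  is_lim H p_infty 0.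

Lemma tail_of_le h H p q : p <= q -> tail_of h H p -> tail_of h H q.
Proof.
  intros Hpq (A & B & D & E & F). refine (conj _ (conj _ (conj _ (conj _ F)))); intros y Hy;
    [apply A|apply B|apply D|apply E]; lra.
Qed.

Lemma tail_RInt h H p a b c :
  tail_of h H p -> p <= a -> a <= b -> is_RInt (fun y => c * h y) a b (c * (H a - H b)).
Proof.
  intros (A & B & _) Hpa Hab.
  replace (c * (H a - H b)) with (scal c (opp (minus (H b) (H a)))).
  2:{ unfold scal, minus, opp, plus; simpl; unfold mult; simpl; ring. }
  apply (is_RInt_ext (fun y => scal c (opp (- h y)))).
  { intros; unfold scal, opp; simpl; unfold mult; simpl; ring. }
  apply (is_RInt_scal (V := R_NormedModule)), (is_RInt_opp (V := R_NormedModule)).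
  apply (is_RInt_derive (V := R_CompleteNormedModule) H (fun y => - h y)).
  - intros x Hx; apply A. rewrite Rmin_left in Hx by lra; lra.
  - intros x Hx; apply (continuous_opp (V := R_NormedModule)), B. rewrite Rmin_left in Hx by lra; lra.
Qed.

Lemma CInt_tail_bound f h H p a b c :
  (forall x, ccont f x) -> tail_of h H p -> p <= a -> a <= b ->
  (forall y, a <= y <= b -> Cmod (f y) <= c * h y) -> Cmod (CInt f a b) <= c * (H a - H b).
Proof.
  intros Hc T Hpa Hab Hf.
  apply (CInt_bound f (fun y => c * h y)); auto. eapply tail_RInt; eauto.
Qed.

Lemma tail_small h H p : tail_of h H p -> forall eps, 0 < eps ->
  exists Y, p <= Y /\ forall y, Y <= y -> H y < eps.
Proof.
  intros (_ & _ & _ & _ & L) eps He.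
  apply is_lim_spec in L. destruct (L (mkposreal eps He)) as [Y HY]. simpl in HY.
  exists (Rmax p (Y + 1)). split; [apply Rmax_l|].
  intros y Hy. pose proof (Rmax_r p (Y + 1)).
  assert (HH : Y < y) by lra. specialize (HY y HH).
  apply Rabs_def2 in HY. lra.
Qed.

(** [CInt_infty] is total and says nothing about convergence. Here convergence follows from Cauchy's
    criterion: the integral over [u, v] is at most c H(u), which is small far out. *)
Lemma CInt_infty_lim f h H p c :
  (forall x, ccont f x) -> tail_of h H p -> 0 <= c ->
  (forall y, p <= y -> Cmod (f y) <= c * h y) ->
  filterlim (fun X => CInt f p X) (Rbar_locally p_infty)
            (locally (T := C_UniformSpace) (CInt_infty f p)).
Proof.
  intros Hc T Hc0 Hf.
  assert (E : exists l : C, filterlim (fun X => CInt f p X) (Rbar_locally p_infty)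
            (locally (T := C_UniformSpace) l)).
  { apply (filterlim_locally_cauchy (U := C_R_CompleteNormedModule) (F := Rbar_locally p_infty)).
    intros eps.
    (* Dividing by c + 1 rather than c covers c = 0. *)
    assert (He : 0 < eps / (c + 1)).
    { apply Rdiv_lt_0_compat; [apply cond_pos | lra]. }
    destruct (tail_small h H p T _ He) as (Y & HpY & HY).
    exists (fun X => Y < X). split; [exists Y; auto|].
    assert (K : forall u v, Y < u -> u <= v -> Cmod (CInt f p v - CInt f p u) < eps).
    { intros u v Hu Huv.
      rewrite <- (CInt_Chasles f p u v Hc).
      replace (CInt f p u + CInt f u v - CInt f p u)%C with (CInt f u v) by ring.
      eapply Rle_lt_trans; [apply (CInt_tail_bound f h H p u v c); auto; try lra|].
      { intros; apply Hf; lra. }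
      assert (0 <= H v) by (apply T; lra).
      assert (0 <= H u) by (apply T; lra).
      assert (H u < eps / (c + 1)) by (apply HY; lra).
      apply Rle_lt_trans with (c * H u); [apply Rmult_le_compat_l; lra|].
      apply Rle_lt_trans with ((c + 1) * H u); [nra|].
      apply Rlt_le_trans with ((c + 1) * (eps / (c + 1))); [apply Rmult_lt_compat_l; lra|].
      right; field; lra. }
    assert (B : forall z w : C, Cmod (w - z) < eps -> ball (M := C_UniformSpace) z eps w).
    { intros z w Hzw; split.
      - change (Rabs (fst (w - z)%C) < eps). eapply Rle_lt_trans; [apply Cmod_fst | exact Hzw].
      - change (Rabs (snd (w - z)%C) < eps). eapply Rle_lt_trans; [apply Cmod_snd | exact Hzw]. }
    intros u v Hu Hv. apply B. destruct (Rle_dec u v) as [Huv|Huv].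
    - apply K; lra.
    - rewrite Cmod_minus_sym. apply K; lra. }
  destruct E as [l Hl]. rewrite (CInt_infty_unique f p l); auto.
  intros x _. exists (CInt f p x). apply CInt_correct, Hc.
Qed.

Lemma CInt_infty_bound f h H p c :
  (forall x, ccont f x) -> tail_of h H p -> 0 <= c ->
  (forall y, p <= y -> Cmod (f y) <= c * h y) -> Cmod (CInt_infty f p) <= c * H p.
Proof.
  intros Hc T Hc0 Hf. apply le_epsilon. intros eps He.
  pose proof (CInt_infty_lim f h H p c Hc T Hc0 Hf) as L.
  rewrite Clim_infty in L. destruct (L eps He) as [Y HY].
  set (X := Rmax p Y + 1).
  assert (p <= X /\ Y < X) as [HpX HYX].
  { unfold X; pose proof (Rmax_l p Y); pose proof (Rmax_r p Y); lra. }
  specialize (HY X HYX).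
  assert (B : Cmod (CInt f p X) <= c * (H p - H X)).
  { apply (CInt_tail_bound f h H p); auto; [lra|]. intros; apply Hf; lra. }
  assert (0 <= H X) by (apply T; lra).
  replace (CInt_infty f p) with (CInt f p X - (CInt f p X - CInt_infty f p))%C by ring.
  eapply Rle_trans; [apply Cmod_triangle|]. rewrite Cmod_opp. nra.
Qed.

Lemma CInt_infty_Chasles f h H p a b c :
  (forall x, ccont f x) -> tail_of h H p -> 0 <= c ->
  (forall y, p <= y -> Cmod (f y) <= c * h y) -> p <= a -> p <= b ->
  CInt_infty f a = (CInt f a b + CInt_infty f b)%C.
Proof.
  intros Hc T Hc0 Hf Ha Hb.
  assert (La : forall a, p <= a -> filterlim (fun X => CInt f a X) (Rbar_locally p_infty)
            (locally (T := C_UniformSpace) (CInt_infty f a))).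
  { intros a' Ha'. apply (CInt_infty_lim f h H a' c); auto.
    - eapply tail_of_le; eauto.
    - intros; apply Hf; lra. }
  apply (Cfilterlim_unique (fun X => CInt f a X)); [auto|].
  rewrite Clim_infty. intros eps He.
  pose proof (La b Hb) as L. rewrite Clim_infty in L.
  destruct (L eps He) as [Y HY]. exists Y. intros X HX. specialize (HY X HX).
  rewrite <- (CInt_Chasles f a b X Hc).
  replace (CInt f a b + CInt f b X - (CInt f a b + CInt_infty f b))%C
    with (CInt f b X - CInt_infty f b)%C by ring. exact HY.
Qed.

Lemma CInt_infty_minus f g h H p c d :
  (forall x, ccont f x) -> (forall x, ccont g x) -> tail_of h H p -> 0 <= c -> 0 <= d ->
  (forall y, p <= y -> Cmod (f y) <= c * h y) -> (forall y, p <= y -> Cmod (g y) <= d * h y) ->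
  CInt_infty (fun y => f y - g y)%C p = (CInt_infty f p - CInt_infty g p)%C.
Proof.
  intros Cf Cg T Hc Hd Hf Hg.
  pose proof (CInt_infty_lim f h H p c Cf T Hc Hf) as Lf.
  pose proof (CInt_infty_lim g h H p d Cg T Hd Hg) as Lg.
  apply CInt_infty_unique.
  { intros x _. exists (CInt f p x - CInt g p x)%C.
    apply (is_RInt_minus (V := C_R_NormedModule)); apply CInt_correct; assumption. }
  rewrite Clim_infty in Lf, Lg |- *. intros eps He.
  destruct (Lf (eps / 2)) as [Y1 H1]; [lra|]. destruct (Lg (eps / 2)) as [Y2 H2]; [lra|].
  exists (Rmax Y1 Y2). intros x Hx.
  pose proof (Rmax_l Y1 Y2). pose proof (Rmax_r Y1 Y2).
  specialize (H1 x ltac:(lra)). specialize (H2 x ltac:(lra)).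
  rewrite CInt_minus by assumption.
  replace (CInt f p x - CInt g p x - (CInt_infty f p - CInt_infty g p))%C
    with ((CInt f p x - CInt_infty f p) + - (CInt g p x - CInt_infty g p))%C by ring.
  eapply Rle_lt_trans; [apply Cmod_triangle|]. rewrite Cmod_opp. lra.
Qed.

Lemma CInt_infty_scal f (z : C) h H p c :
  (forall x, ccont f x) -> tail_of h H p -> 0 <= c ->
  (forall y, p <= y -> Cmod (f y) <= c * h y) ->
  CInt_infty (fun y => z * f y)%C p = (z * CInt_infty f p)%C.
Proof.
  intros Cf T Hc Hf.
  pose proof (CInt_infty_lim f h H p c Cf T Hc Hf) as Lf.
  apply CInt_infty_unique.
  { intros x _. exists (CInt (fun y => z * f y)%C p x). apply CInt_correct.
    intros t. apply ccont_mult; [apply ccont_const | apply Cf]. }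
  rewrite Clim_infty in Lf |- *. intros eps He.
  pose proof (Cmod_ge_0 z).
  destruct (Lf (eps / (Cmod z + 1))) as [Y HY]; [apply Rdiv_lt_0_compat; lra|].
  exists Y. intros x Hx. specialize (HY x Hx). rewrite CInt_scal by assumption.
  replace (z * CInt f p x - z * CInt_infty f p)%C with (z * (CInt f p x - CInt_infty f p))%C by ring.
  rewrite Cmod_mult. pose proof (Cmod_ge_0 (CInt f p x - CInt_infty f p)).
  apply Rle_lt_trans with ((Cmod z + 1) * Cmod (CInt f p x - CInt_infty f p)); [nra|].
  apply Rlt_le_trans with ((Cmod z + 1) * (eps / (Cmod z + 1))); [apply Rmult_lt_compat_l; lra|].
  right; field; lra.
Qed.

(** * Weighted fixed points and linear ODEs *)

Lemma Cseq_geom_lim (u : nat -> C) (K rho : R) :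
  0 <= rho < 1 -> 0 <= K ->
  (forall n p, Cmod (u (n + p)%nat - u n) <= K * rho ^ n) ->
  exists l : C, forall n, Cmod (u n - l) <= K * rho ^ n.
Proof.
  intros Hrho HK Hu.
  assert (L : forall eps, 0 < eps -> exists n, K * rho ^ n < eps).
  { intros eps He.
    assert (L : is_lim_seq (fun n => K * rho ^ n) 0).
    { replace (Finite 0) with (Rbar_mult K 0) by (simpl; f_equal; ring).
      apply is_lim_seq_scal_l, is_lim_seq_geom. rewrite Rabs_pos_eq; lra. }
    apply is_lim_seq_spec in L. destruct (L (mkposreal eps He)) as [N HN].
    exists N. specialize (HN N (Nat.le_refl N)). simpl in HN.
    apply Rabs_def2 in HN. lra. }
  assert (E : exists l : C, filterlim u eventually (locally (T := C_UniformSpace) l)).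
  { apply (filterlim_locally_cauchy (U := C_R_CompleteNormedModule) (F := eventually)).
    intros eps.
    assert (He : 0 < eps / 2) by (pose proof (cond_pos eps); lra).
    destruct (L _ He) as [N HN].
    exists (fun n => (N <= n)%nat). split; [exists N; auto|].
    intros i j Hi Hj.
    assert (B : Cmod (u j - u i) < eps).
    { pose proof (Hu N (i - N)%nat) as A1. pose proof (Hu N (j - N)%nat) as A2.
      replace (N + (i - N))%nat with i in A1 by lia.
      replace (N + (j - N))%nat with j in A2 by lia.
      rewrite Cmod_minus_sym in A1.
      eapply Rle_lt_trans; [apply (Cmod_minus_triangle _ (u N))|]. lra. }
    split.
    - change (Rabs (fst (u j - u i)%C) < eps). eapply Rle_lt_trans; [apply Cmod_fst | exact B].
    - change (Rabs (snd (u j - u i)%C) < eps). eapply Rle_lt_trans; [apply Cmod_snd | exact B]. }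
  destruct E as [l Hl]. exists l. intros n. apply le_epsilon. intros eps He.
  rewrite (Cfilterlim_Cmod eventually) in Hl. destruct (Hl eps He) as [N HN].
  specialize (HN (n + N)%nat ltac:(lia)).
  eapply Rle_trans; [apply (Cmod_minus_triangle _ (u (n + N)%nat))|].
  rewrite Cmod_minus_sym. specialize (Hu n N). lra.
Qed.

Definition weighted (m : R -> R) (f : R -> C) : Prop :=
  (forall x, ccont f x) /\ exists B, forall x, Cmod (f x) <= B * m x.

(** Banach's fixed point theorem for the norm sup |f|/m, by Picard iteration from 0. The weight lets
    it serve twice: with m = 1 for the Volterra equation, and with a fast growing m for a linear
    equation on the whole line. *)
Lemma weighted_fixed_point (m : R -> R) (F : (R -> C) -> R -> C) (rho B0 : R) :
  (forall x, continuous m x) -> (forall x, 0 < m x) -> 0 <= rho < 1 ->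
  (forall f, weighted m f -> forall x, ccont (F f) x) ->
  (forall x, Cmod (F (fun _ => RtoC 0) x) <= B0 * m x) ->
  (forall f g d, weighted m f -> weighted m g -> 0 <= d ->
     (forall x, Cmod (f x - g x) <= d * m x) ->
     forall x, Cmod (F f x - F g x) <= rho * d * m x) ->
  exists f, weighted m f /\ forall x, F f x = f x.
Proof.
  intros Hm Hpos Hrho Hcont H0 Hcontr.
  assert (HB0 : 0 <= B0).
  { specialize (H0 0). pose proof (Cmod_ge_0 (F (fun _ => RtoC 0) 0)). specialize (Hpos 0). nra. }
  assert (Hz : weighted m (fun _ => RtoC 0)).
  { split; [intros; apply ccont_const | exists 0; intros; rewrite Cmod_0; lra]. }
  set (T := fun n => Nat.iter n F (fun _ => RtoC 0)).
  assert (HT : forall n, weighted m (T n)).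
  { induction n; [exact Hz|]. split; [apply Hcont, IHn|].
    destruct IHn as [Cn [B HB]].
    assert (0 <= B).
    { specialize (HB 0). pose proof (Cmod_ge_0 (T n 0)). specialize (Hpos 0). nra. }
    exists (rho * B + B0). intros x.
    assert (D : Cmod (F (T n) x - F (fun _ => RtoC 0) x) <= rho * B * m x).
    { apply Hcontr; auto; [split; eauto|].
      intros t. replace (T n t - RtoC 0)%C with (T n t) by ring. apply HB. }
    change (T (S n) x) with (F (T n) x).
    replace (F (T n) x) with ((F (T n) x - F (fun _ => RtoC 0) x) + F (fun _ => RtoC 0) x)%C by ring.
    eapply Rle_trans; [apply Cmod_triangle|]. specialize (H0 x). lra. }
  assert (HS : forall n x, Cmod (T (S n) x - T n x) <= B0 * rho ^ n * m x).
  { induction n; intros x.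
    - change (T 1%nat x) with (F (fun _ => RtoC 0) x). change (T 0%nat x) with (RtoC 0).
      replace (F (fun _ => RtoC 0) x - RtoC 0)%C with (F (fun _ => RtoC 0) x) by ring.
      simpl. rewrite Rmult_1_r. apply H0.
    - replace (B0 * rho ^ S n) with (rho * (B0 * rho ^ n)) by (simpl; ring).
      apply (Hcontr (T (S n)) (T n)); auto.
      apply Rmult_le_pos; [lra | apply pow_le; lra]. }
  assert (HP : forall x n p, Cmod (T (n + p)%nat x - T n x) <= (B0 / (1 - rho) * m x) * rho ^ n).
  { intros x n p.
    (* The partial geometric sum is kept exactly; the weaker bound by rho^n would not pass through
       the induction on p. *)
    apply Rle_trans with ((B0 / (1 - rho) * m x) * (rho ^ n - rho ^ (n + p))).
    - induction p.
      + rewrite Nat.add_0_r. replace (T n x - T n x)%C with (RtoC 0) by ring. rewrite Cmod_0. lra.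
      + rewrite Nat.add_succ_r.
        eapply Rle_trans; [apply (Cmod_minus_triangle _ (T (n + p)%nat x))|].
        specialize (HS (n + p)%nat x). simpl (rho ^ S (n + p)).
        replace ((B0 / (1 - rho) * m x) * (rho ^ n - rho * rho ^ (n + p)))
          with (B0 * rho ^ (n + p) * m x + (B0 / (1 - rho) * m x) * (rho ^ n - rho ^ (n + p)))
          by (field; lra).
        lra.
    - apply Rmult_le_compat_l.
      + apply Rmult_le_pos; [|specialize (Hpos x); lra]. apply Rdiv_le_0_compat; lra.
      + assert (0 <= rho ^ (n + p)) by (apply pow_le; lra). lra. }
  assert (HK : 0 <= B0 / (1 - rho)) by (apply Rdiv_le_0_compat; lra).
  destruct (functional_choice
    (fun x l => forall n, Cmod (T n x - l) <= (B0 / (1 - rho) * m x) * rho ^ n)) as [f Hf].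
  { intros x. apply Cseq_geom_lim; auto. specialize (Hpos x). apply Rmult_le_pos; lra. }
  assert (L : forall c eps, 0 <= c -> 0 < eps -> exists n, c * rho ^ n < eps).
  { intros c eps Hc He.
    assert (Hr : Rabs rho < 1) by (rewrite Rabs_pos_eq; lra).
    assert (He' : 0 < eps / (c + 1)) by (apply Rdiv_lt_0_compat; lra).
    destruct (pow_lt_1_zero rho Hr _ He') as [N HN].
    exists N. specialize (HN N (Nat.le_refl N)). rewrite Rabs_pos_eq in HN by (apply pow_le; lra).
    assert (0 <= rho ^ N) by (apply pow_le; lra).
    apply Rle_lt_trans with ((c + 1) * rho ^ N); [nra|].
    apply Rlt_le_trans with ((c + 1) * (eps / (c + 1))); [apply Rmult_lt_compat_l; lra|].
    right; field; lra. }
  assert (Hw : weighted m f).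
  { split.
    - intros x. apply ccont_Cmod. intros eps He.
      (* Convergence is uniform only relative to m, but m <= m x + 1 near x, so it is locally
         uniform there and the usual three-epsilon argument applies. *)
      destruct (L (B0 / (1 - rho) * (m x + 1)) (eps / 3)) as [n Hn].
      { specialize (Hpos x). apply Rmult_le_pos; lra. }
      { lra. }
      destruct (HT n) as [Cn _]. specialize (Cn x). rewrite ccont_Cmod in Cn.
      specialize (Cn (eps / 3) ltac:(lra)).
      assert (Mx : locally x (fun t => ball (m x) (mkposreal 1 Rlt_0_1) (m t))).
      { apply (proj1 (filterlim_locally (F := locally x) m (m x)) (Hm x)). }
      generalize (filter_and _ _ Cn Mx). apply filter_imp. intros t [A B].
      change (Rabs (m t - m x) < 1) in B. apply Rabs_def2 in B.
      assert (0 <= rho ^ n) by (apply pow_le; lra).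
      assert (D : forall s, m s <= m x + 1 -> Cmod (T n s - f s) < eps / 3).
      { intros s Hs. eapply Rle_lt_trans; [apply Hf|]. eapply Rle_lt_trans; [|exact Hn].
        apply Rmult_le_compat_r; [assumption|]. apply Rmult_le_compat_l; lra. }
      eapply Rle_lt_trans; [apply (Cmod_minus_triangle _ (T n t))|].
      rewrite Cmod_minus_sym. pose proof (D t ltac:(lra)).
      pose proof (Cmod_minus_triangle (T n t) (T n x) (f x)).
      pose proof (D x ltac:(lra)). lra.
    - exists (B0 / (1 - rho)). intros x. specialize (Hf x 0%nat).
      change (T 0%nat x) with (RtoC 0) in Hf.
      rewrite Cmod_minus_sym in Hf. replace (f x - RtoC 0)%C with (f x) in Hf by ring.
      simpl in Hf. lra. }
  exists f. split; [exact Hw|].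
  intros x. apply Ceq_minus, Cmod_eq_0. apply Rle_antisym; [|apply Cmod_ge_0].
  apply le_epsilon. intros eps He.
  destruct (L (2 * (B0 / (1 - rho) * m x)) eps) as [n Hn]; [|lra|].
  { specialize (Hpos x). assert (0 <= B0 / (1 - rho) * m x) by (apply Rmult_le_pos; lra). lra. }
  assert (Hrn : 0 <= rho ^ n) by (apply pow_le; lra).
  assert (D : Cmod (F f x - F (T n) x) <= rho * (B0 / (1 - rho) * rho ^ n) * m x).
  { apply Hcontr; auto.
    - apply Rmult_le_pos; lra.
    - intros t. rewrite Cmod_minus_sym. specialize (Hf t n). lra. }
  pose proof (Hf x (S n)) as G. change (T (S n) x) with (F (T n) x) in G. simpl in G.
  eapply Rle_trans; [apply (Cmod_minus_triangle _ (F (T n) x))|].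
  assert (0 <= B0 / (1 - rho) * m x * rho ^ n).
  { apply Rmult_le_pos; auto. apply Rmult_le_pos; auto. left; apply Hpos. }
  assert (rho * (B0 / (1 - rho) * m x * rho ^ n) <= 1 * (B0 / (1 - rho) * m x * rho ^ n)).
  { apply Rmult_le_compat_r; lra. }
  lra.
Qed.

(** * Second order linear equations: global existence and Gronwall estimates *)

Lemma is_derive_Rext (f g : R -> R) (x l : R) :
  (forall t, f t = g t) -> is_derive f x l -> is_derive g x l.
Proof. apply (is_derive_ext (V := R_NormedModule)). Qed.

Lemma is_derive_val (f : R -> R) (x l l' : R) : l = l' -> is_derive f x l -> is_derive f x l'.
Proof. intros ->; auto. Qed.

Lemma is_derive_RInt_cont (f : R -> R) a x :
  (forall x, continuous f x) -> is_derive (fun t => RInt f a t) x (f x).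
Proof.
  intros H. apply (is_derive_RInt (V := R_NormedModule) f (fun t => RInt f a t) a x); [|apply H].
  apply filter_forall. intros t. apply (RInt_correct (V := R_CompleteNormedModule)).
  apply (ex_RInt_continuous (V := R_CompleteNormedModule)). intros; apply H.
Qed.

Lemma is_derive_continuous (f : R -> R) x l : is_derive f x l -> continuous f x.
Proof. intros H. apply (ex_derive_continuous (V := R_NormedModule) f x). exists l; exact H. Qed.

Lemma is_derive_continuity_pt (f : R -> R) x l : is_derive f x l -> continuity_pt f x.
Proof. intros H. apply continuity_pt_filterlim. exact (is_derive_continuous f x l H). Qed.

Lemma is_RInt_is_derive (f f' : R -> R) a b :
  a <= b -> (forall x, a <= x <= b -> is_derive f x (f' x)) ->
  (forall x, a <= x <= b -> continuous f' x) -> is_RInt f' a b (f b - f a).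
Proof.
  intros Hab H1 H2. apply (is_RInt_derive (V := R_CompleteNormedModule) f f');
    intros x; rewrite Rmin_left, Rmax_right by lra; auto.
Qed.

Lemma CInt_swap (f : R -> C) a b : (forall x, ccont f x) -> CInt f a b = (- CInt f b a)%C.
Proof.
  intros H. pose proof (CInt_Chasles f a b a H) as E. rewrite CInt_point in E.
  replace (CInt f a b) with (CInt f a b + CInt f b a - CInt f b a)%C by ring. rewrite E. ring.
Qed.

Lemma ccont_CInt (f : R -> C) a x : (forall x, ccont f x) -> ccont (fun t => CInt f a t) x.
Proof. intros H. eapply cderiv_ccont, cderiv_CInt, H. Qed.

(** Integrating |g| <= P'' twice from x0, where P' vanishes. To the left of x0 both integrals change
    orientation and the two signs cancel, so the same bound holds on both sides. *)
Lemma double_CInt_bound (g : R -> C) (P P1 P2 : R -> R) x0 x :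
  (forall x, ccont g x) -> (forall x, is_derive P x (P1 x)) ->
  (forall x, is_derive P1 x (P2 x)) -> (forall x, continuous P2 x) -> P1 x0 = 0 ->
  (forall y, Cmod (g y) <= P2 y) ->
  Cmod (CInt (fun s => CInt g x0 s) x0 x) <= P x - P x0.
Proof.
  intros Hg HP HP1 HP2 H0 Hb.
  assert (HG : forall s, ccont (fun s => CInt g x0 s) s) by (intros; apply ccont_CInt, Hg).
  assert (CP1 : forall s, continuous P1 s) by (intros; eapply is_derive_continuous; apply HP1).
  destruct (Rle_dec x0 x) as [Hx|Hx].
  - apply (CInt_bound _ P1); auto.
    + intros s Hs. apply (CInt_bound g P2); auto; try lra.
      replace (P1 s) with (P1 s - P1 x0) by lra.
      apply is_RInt_is_derive; auto; lra.
    + apply is_RInt_is_derive; auto.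
  - rewrite CInt_swap by auto. rewrite Cmod_opp.
    apply (CInt_bound _ (fun s => - P1 s)); auto; try lra.
    + intros s Hs. rewrite CInt_swap by auto. rewrite Cmod_opp.
      apply (CInt_bound g P2); auto; try lra.
      replace (- P1 s) with (P1 x0 - P1 s) by lra.
      apply is_RInt_is_derive; auto; lra.
    + replace (P x - P x0) with (- P x0 - - P x) by ring.
      apply (is_RInt_is_derive (fun s => - P s)); auto; try lra.
      * intros; apply (is_derive_opp (V := R_NormedModule)), HP.
      * intros; apply (continuous_opp (V := R_NormedModule)), CP1.
Qed.

(* The weight exp L with L'' >= 4 |kap| q turns the double integral of [kap q w] into a
   contraction on the whole line. *)
Lemma linear_ode_exists (q : R -> R) (kap : C) (x0 : R) (A B : C) :
  (forall x, continuous q x) -> (forall x, 0 <= q x) ->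
  exists w w1 : R -> C,
    (forall x, cderiv w x (w1 x)) /\
    (forall x, cderiv w1 x (- (kap * RtoC (q x) * w x))%C) /\
    w x0 = A /\ w1 x0 = B.
Proof.
  intros Hq Hq0.
  set (k := Cmod kap). assert (Hk : 0 <= k) by apply Cmod_ge_0.
  set (l1 := fun x => RInt (fun y => 4 * k * q y) x0 x).
  set (l0 := fun x => RInt l1 x0 x).
  assert (Cq : forall x, continuous (fun y => 4 * k * q y) x).
  { intros x. apply (continuous_scal_r (V := R_NormedModule)), Hq. }
  assert (D1 : forall x, is_derive l1 x (4 * k * q x)).
  { intros x. apply (is_derive_RInt_cont (fun y => 4 * k * q y)), Cq. }
  assert (D0 : forall x, is_derive l0 x (l1 x)).
  { intros x. apply is_derive_RInt_cont. intros y. eapply is_derive_continuous, D1. }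
  assert (E1 : l1 x0 = 0) by apply (RInt_point (V := R_CompleteNormedModule)).
  assert (E0 : l0 x0 = 0) by apply (RInt_point (V := R_CompleteNormedModule)).
  (* Obtained by applying the double integral bound to the zero function. *)
  assert (P0 : forall x, 0 <= l0 x).
  { intros x. replace (l0 x) with (l0 x - l0 x0) by lra.
    eapply Rle_trans; [apply Cmod_ge_0|].
    apply (double_CInt_bound (fun _ => RtoC 0) l0 l1 (fun y => 4 * k * q y) x0 x); auto.
    - intros; apply ccont_const.
    - intros y. rewrite Cmod_0. specialize (Hq0 y). apply Rmult_le_pos; lra. }
  (* The quadratic term gives m >= 1 + (x - x0)^2, enough to dominate the affine function A + B (x -
     x0) from which the iteration starts. *)
  set (m := fun x => exp (l0 x + (x - x0) ^ 2)).
  set (m1 := fun x => (l1 x + 2 * (x - x0)) * m x).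
  set (m2 := fun x => (4 * k * q x + 2) * m x + (l1 x + 2 * (x - x0)) * m1 x).
  assert (Dm : forall x, is_derive m x (m1 x)).
  { intros x. unfold m, m1.
    assert (D : is_derive (fun x => l0 x + (x - x0) ^ 2) x (l1 x + 2 * (x - x0))).
    { apply (is_derive_plus (V := R_NormedModule) l0 (fun x => (x - x0) ^ 2)); [apply D0|]. auto_derive; auto; ring. }
    apply (is_derive_comp exp (fun x => l0 x + (x - x0) ^ 2) x _ _ (is_derive_exp _) D). }
  assert (Dm1 : forall x, is_derive m1 x (m2 x)).
  { intros x. unfold m1 at 1, m2. apply (is_derive_Rmult (fun x => l1 x + 2 * (x - x0)) m); [|apply Dm].
    apply (is_derive_plus (V := R_NormedModule) l1 (fun x => 2 * (x - x0))); [apply D1|]. auto_derive; auto; ring. }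
  assert (Cm : forall x, continuous m x) by (intros; eapply is_derive_continuous, Dm).
  assert (Cm2 : forall x, continuous m2 x).
  { intros x. unfold m2. apply (continuous_plus (V := R_NormedModule)).
    - apply (continuous_mult (K := R_AbsRing)); [|apply Cm].
      apply (continuous_plus (V := R_NormedModule)); [apply Cq|apply continuous_const].
    - apply (continuous_mult (K := R_AbsRing)).
      + apply (continuous_plus (V := R_NormedModule)); [eapply is_derive_continuous, D1|].
        apply (is_derive_continuous _ x 2). auto_derive; auto; ring.
      + eapply is_derive_continuous, Dm1. }
  assert (Pm : forall x, 0 < m x) by (intros; apply exp_pos).
  assert (Sm : forall x, 1 + (x - x0) ^ 2 <= m x).
  { intros x. unfold m. eapply Rle_trans; [|apply exp_ineq1_le]. specialize (P0 x). lra. }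
  (* For m = exp L one has m'' = (L'' + L'^2) m >= L'' m, and L'' = 4 k q + 2. *)
  assert (Bm : forall x, k * q x * m x <= 1 / 4 * m2 x).
  { intros x. unfold m2, m1. specialize (Pm x). pose proof (pow2_ge_0 (l1 x + 2 * (x - x0))).
    assert (0 <= (l1 x + 2 * (x - x0)) ^ 2 * m x) by (apply Rmult_le_pos; lra). nra. }
  assert (Cg : forall w : R -> C, (forall x, ccont w x) -> forall x, ccont (fun y => kap * RtoC (q y) * w y)%C x).
  { intros w Hw x. apply ccont_mult; [|apply Hw]. apply ccont_mult; [apply ccont_const|].
    apply ccont_RtoC, Hq. }
  set (F := fun (w : R -> C) x => (A + B * RtoC (x - x0)
      - CInt (fun s => CInt (fun y => kap * RtoC (q y) * w y) x0 s) x0 x)%C).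
  assert (DF : forall w : R -> C, (forall x, ccont w x) -> forall x,
             cderiv (F w) x (B - CInt (fun y => kap * RtoC (q y) * w y) x0 x)%C).
  { intros w Hw x. unfold F.
    apply (cderiv_minus (fun x => A + B * RtoC (x - x0))%C).
    - eapply cderiv_val; [|apply cderiv_plus; [apply cderiv_const |
        apply cderiv_mult; [apply cderiv_const | apply (cderiv_RtoC (fun x => x - x0) x 1)]]].
      + cbv beta. ring.
      + auto_derive; auto; ring.
    - apply (cderiv_CInt (fun s => CInt (fun y => kap * RtoC (q y) * w y)%C x0 s)).
      intros; apply ccont_CInt, Cg, Hw. }
  destruct (weighted_fixed_point m F (1 / 4) (Cmod A + Cmod B)) as [w [[Cw _] Hw]]; auto; try lra.
  - intros f [Hf _] x. eapply cderiv_ccont, DF, Hf.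
  - intros x. unfold F.
    assert (Z : CInt (fun s => CInt (fun y => kap * RtoC (q y) * RtoC 0)%C x0 s) x0 x = RtoC 0).
    { rewrite (CInt_ext _ (fun s => RtoC 0 * RtoC 0)%C).
      - rewrite CInt_scal by (intros; apply ccont_const). ring.
      - intros s _. rewrite (CInt_ext _ (fun y => RtoC 0 * RtoC 0)%C) by (intros; ring).
        rewrite CInt_scal by (intros; apply ccont_const). ring. }
    rewrite Z. replace (A + B * RtoC (x - x0) - RtoC 0)%C with (A + B * RtoC (x - x0))%C by ring.
    eapply Rle_trans; [apply Cmod_triangle|]. rewrite Cmod_mult, Cmod_R.
    specialize (Sm x). assert (Rabs (x - x0) <= m x).
    { apply Rle_trans with (1 + (x - x0) ^ 2); auto.
      rewrite <- pow2_abs. pose proof (Rabs_pos (x - x0)). nra. }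
    assert (1 <= m x) by (pose proof (pow2_ge_0 (x - x0)); lra).
    pose proof (Cmod_ge_0 A). pose proof (Cmod_ge_0 B). nra.
  - intros f g d [Hf _] [Hg _] Hd Hfg x. unfold F.
    replace (A + B * RtoC (x - x0) - CInt (fun s => CInt (fun y => kap * RtoC (q y) * f y) x0 s) x0 x
      - (A + B * RtoC (x - x0) - CInt (fun s => CInt (fun y => kap * RtoC (q y) * g y) x0 s) x0 x))%C
      with (CInt (fun s => CInt (fun y => kap * RtoC (q y) * (g y - f y)) x0 s) x0 x)%C.
    + apply Rle_trans with (1 / 4 * d * m x - 1 / 4 * d * m x0);
        [|specialize (Pm x0); assert (0 <= d * m x0) by (apply Rmult_le_pos; lra); lra].
      apply (double_CInt_bound _ (fun x => 1 / 4 * d * m x) (fun x => 1 / 4 * d * m1 x)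
               (fun x => 1 / 4 * d * m2 x)).
      * apply (Cg (fun y => g y - f y)%C). intros y. apply ccont_plus; [apply Hg|].
        apply (ccont_ext (fun y => RtoC (-1) * f y)%C); [intros; ring|].
        apply ccont_mult; [apply ccont_const|apply Hf].
      * intros; apply is_derive_scal, Dm.
      * intros; apply is_derive_scal, Dm1.
      * intros; apply (continuous_scal_r (V := R_NormedModule)), Cm2.
      * unfold m1. rewrite E1. ring.
      * intros y. rewrite !Cmod_mult, Cmod_R, Rabs_pos_eq by auto. fold k.
        rewrite Cmod_minus_sym. specialize (Hfg y). specialize (Bm y). specialize (Hq0 y).
        apply Rle_trans with (k * q y * (d * m y)); [apply Rmult_le_compat_l; auto; apply Rmult_le_pos; lra|].
        nra.
    + rewrite (CInt_ext _ (fun s => CInt (fun y => kap * RtoC (q y) * g y)%C x0 s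
                                 - CInt (fun y => kap * RtoC (q y) * f y)%C x0 s)%C).
      * rewrite CInt_minus by (intros; apply ccont_CInt, Cg; auto). 
        transitivity (CInt (fun s => CInt (fun y => kap * RtoC (q y) * g y) x0 s) x0 x
          - CInt (fun s => CInt (fun y => kap * RtoC (q y) * f y) x0 s) x0 x)%C; [reflexivity | ring].
      * intros s _. rewrite <- CInt_minus by (apply Cg; auto).
        apply CInt_ext. intros; ring.
  - exists w, (fun x => B - CInt (fun y => kap * RtoC (q y) * w y) x0 x)%C.
    split; [|split; [|split]].
    + intros x. apply (cderiv_ext (F w)); [exact Hw|]. apply DF, Cw.
    + intros x. eapply cderiv_val; [|apply cderiv_minus;
        [apply cderiv_const | apply (cderiv_CInt (fun y => kap * RtoC (q y) * w y)%C)]].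
      * cbv beta. ring.
      * apply Cg, Cw.
    + rewrite <- Hw. unfold F. rewrite CInt_point. rewrite Rminus_diag. ring.
    + rewrite CInt_point. ring.
Qed.

Lemma gronwall (G G1 : R -> R) (a b x0 C : R) :
  (forall x, a <= x <= b -> is_derive G x (G1 x)) ->
  (forall x, a <= x <= b -> Rabs (G1 x) <= C * G x) ->
  a <= x0 <= b -> forall x, a <= x <= b -> G x <= G x0 * exp (C * Rabs (x - x0)).
Proof.
  intros HG HC Hx0 x Hx.
  (* Since |G'| <= C G, the function G exp(-C t) is nonincreasing and G exp(C t) is nondecreasing;
     the first serves to the right of x0 and the second to the left. *)
  assert (K : forall c s, (c = - C /\ x0 <= x) \/ (c = C /\ x <= x0) -> s = exp (c * (x0 - x)) ->
     G x <= G x0 * s).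
  { intros c s Hc ->.
    assert (D : forall t, a <= t <= b -> is_derive (fun t => G t * exp (c * t)) t
              (G1 t * exp (c * t) + G t * (c * exp (c * t)))).
    { intros t Ht. apply (is_derive_Rmult G (fun t => exp (c * t))); [apply HG, Ht|].
      auto_derive; auto; ring. }
    destruct (MVT_gen (fun t => G t * exp (c * t)) x0 x
       (fun t => G1 t * exp (c * t) + G t * (c * exp (c * t)))) as [t [Ht E]].
    { intros t Ht. apply D. revert Ht. unfold Rmin, Rmax. destruct (Rle_dec x0 x); lra. }
    { intros t Ht. apply (is_derive_continuity_pt _ _ _ (D t ltac:(revert Ht;
      unfold Rmin, Rmax; destruct (Rle_dec x0 x); lra))). }
    assert (Ht' : a <= t <= b) by (revert Ht; unfold Rmin, Rmax; destruct (Rle_dec x0 x); lra).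
    specialize (HC t Ht'). apply Rabs_le_between in HC.
    assert (L : G x * exp (c * x) <= G x0 * exp (c * x0)).
    { pose proof (exp_pos (c * t)) as He.
      replace (G1 t * exp (c * t) + G t * (c * exp (c * t))) with ((G1 t + c * G t) * exp (c * t)) in E by ring.
      destruct Hc as [[-> Hc]|[-> Hc]].
      - assert (0 <= (C * G t - G1 t) * exp (- C * t) * (x - x0)) by (repeat apply Rmult_le_pos; lra). nra.
      - assert (0 <= (C * G t + G1 t) * exp (C * t) * (x0 - x)) by (repeat apply Rmult_le_pos; lra). nra. }
    apply (Rmult_le_reg_r (exp (c * x))); [apply exp_pos|].
    rewrite Rmult_assoc, <- exp_plus. replace (c * (x0 - x) + c * x) with (c * x0) by ring. exact L. }
  destruct (Rle_dec x0 x).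
  - apply (K (- C)); [lra|]. f_equal. rewrite Rabs_pos_eq by lra. ring.
  - apply (K C); [lra|]. f_equal. rewrite Rabs_left1 by lra. ring.
Qed.

Lemma Cmod_dot (z w : C) : Rabs (fst z * fst w + snd z * snd w) <= Cmod z * Cmod w.
Proof.
  rewrite <- (Cmod_conj z), <- Cmod_mult.
  replace (fst z * fst w + snd z * snd w) with (fst (Cconj z * w)%C) by (simpl; ring).
  apply Cmod_fst.
Qed.

Lemma Cmod_sq (z : C) : Cmod z ^ 2 = fst z ^ 2 + snd z ^ 2.
Proof. apply Cmod2_alt. Qed.

(** Adding the constant bound on |f|^2 to the energy |z|^2 + |z'|^2 absorbs the forcing: 2 |z'| |f|
    <= |z'|^2 + [Fm], so the differential inequality becomes homogeneous with rate 2 + Q. *)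
Lemma ode_gronwall (z z1 f : R -> C) (q : R -> R) (kap : C) (a b x0 Q Fm : R) :
  (forall x, a <= x <= b -> cderiv z x (z1 x)) ->
  (forall x, a <= x <= b -> cderiv z1 x (- (kap * RtoC (q x) * z x) + f x)%C) ->
  (forall x, a <= x <= b -> Cmod (kap * RtoC (q x)) <= Q) ->
  (forall x, a <= x <= b -> Cmod (f x) ^ 2 <= Fm) ->
  a <= x0 <= b -> forall x, a <= x <= b ->
  Cmod (z x) ^ 2 + Cmod (z1 x) ^ 2 + Fm
    <= (Cmod (z x0) ^ 2 + Cmod (z1 x0) ^ 2 + Fm) * exp ((2 + Q) * Rabs (x - x0)).
Proof.
  intros Hz Hz1 HQ HF Hx0 x Hx.
  set (g := fun x => (- (kap * RtoC (q x) * z x) + f x)%C).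
  apply (gronwall (fun x => Cmod (z x) ^ 2 + Cmod (z1 x) ^ 2 + Fm)
     (fun x => 2 * (fst (z x) * fst (z1 x) + snd (z x) * snd (z1 x))
             + 2 * (fst (z1 x) * fst (g x) + snd (z1 x) * snd (g x))) a b); auto.
  - intros t Ht. pose proof (Hz t Ht) as A. pose proof (Hz1 t Ht) as B.
    apply cderiv_pair in A as [A1 A2]. apply cderiv_pair in B as [B1 B2].
    apply (is_derive_Rext (fun x => (fst (z x) * fst (z x) + snd (z x) * snd (z x))
        + (fst (z1 x) * fst (z1 x) + snd (z1 x) * snd (z1 x)) + Fm)).
    { intros s. rewrite !Cmod_sq. ring. }
    fold (g t) in B1, B2.
    apply (is_derive_val _ _ ((fst (z1 t) * fst (z t) + fst (z t) * fst (z1 t)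
       + (snd (z1 t) * snd (z t) + snd (z t) * snd (z1 t)))
       + (fst (g t) * fst (z1 t) + fst (z1 t) * fst (g t)
       + (snd (g t) * snd (z1 t) + snd (z1 t) * snd (g t))) + 0)); [ring|].
    apply (is_derive_plus (V := R_NormedModule)
      (fun x => (fst (z x) * fst (z x) + snd (z x) * snd (z x))
        + (fst (z1 x) * fst (z1 x) + snd (z1 x) * snd (z1 x))) (fun _ => Fm));
      [|apply (is_derive_const (V := R_NormedModule))].
    apply (is_derive_plus (V := R_NormedModule)
      (fun x => fst (z x) * fst (z x) + snd (z x) * snd (z x))
      (fun x => fst (z1 x) * fst (z1 x) + snd (z1 x) * snd (z1 x))).
    + apply (is_derive_plus (V := R_NormedModule)
        (fun x => fst (z x) * fst (z x)) (fun x => snd (z x) * snd (z x)));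
        apply is_derive_Rmult; assumption.
    + apply (is_derive_plus (V := R_NormedModule)
        (fun x => fst (z1 x) * fst (z1 x)) (fun x => snd (z1 x) * snd (z1 x)));
        apply is_derive_Rmult; assumption.
  - intros t Ht.
    pose proof (Cmod_dot (z t) (z1 t)) as A. pose proof (Cmod_dot (z1 t) (g t)) as B.
    assert (Hg : Cmod (g t) <= Q * Cmod (z t) + Cmod (f t)).
    { unfold g. eapply Rle_trans; [apply Cmod_triangle|]. rewrite Cmod_opp, Cmod_mult.
      specialize (HQ t Ht). pose proof (Cmod_ge_0 (z t)). nra. }
    specialize (HQ t Ht). pose proof (Cmod_ge_0 (kap * RtoC (q t))).
    specialize (HF t Ht).
    pose proof (Cmod_ge_0 (z t)). pose proof (Cmod_ge_0 (z1 t)). pose proof (Cmod_ge_0 (f t)).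
    set (za := Cmod (z t)) in *. set (zb := Cmod (z1 t)) in *. set (zf := Cmod (f t)) in *.
    eapply Rle_trans; [apply Rabs_triang|]. rewrite !Rabs_mult, (Rabs_pos_eq 2) by lra.
    assert (zb * Cmod (g t) <= zb * (Q * za + zf)) by (apply Rmult_le_compat_l; lra).
    assert (2 * (za * zb) <= za ^ 2 + zb ^ 2) by (pose proof (pow2_ge_0 (za - zb)); nra).
    assert (2 * (zf * zb) <= Fm + zb ^ 2) by (pose proof (pow2_ge_0 (zf - zb)); nra).
    assert (Q * (2 * (za * zb)) <= Q * (za ^ 2 + zb ^ 2)) by (apply Rmult_le_compat_l; lra).
    assert (0 <= Fm) by (pose proof (pow2_ge_0 zf); lra).
    assert (0 <= Q * Fm) by (apply Rmult_le_pos; lra).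
    pose proof (pow2_ge_0 za). nra.
Qed.

(** * The Volterra equation *)

(** This is exp(-ikt) for the complex wave number k = 1 + is, with modulus and phase separated. *)
Definition osc (s t : R) : C := (RtoC (exp (s * t)) * cis (- t))%C.

Definition wavenum (s : R) : C := (1 + Ci * RtoC s)%C.

Lemma osc_plus s t u : osc s (t + u) = (osc s t * osc s u)%C.
Proof.
  unfold osc, cis. rewrite Rmult_plus_distr_l, exp_plus, Ropp_plus_distr, cos_plus, sin_plus.
  apply C_ext; simpl; ring.
Qed.

Lemma Cmod_cis t : Cmod (cis t) = 1.
Proof.
  unfold Cmod, cis; simpl. transitivity (sqrt 1); [|apply sqrt_1].
  f_equal. pose proof (sin2_cos2 t). unfold Rsqr in *. lra.
Qed.

Lemma Cmod_osc s t : Cmod (osc s t) = exp (s * t).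
Proof.
  unfold osc. rewrite Cmod_mult, Cmod_R, Cmod_cis, Rabs_pos_eq; [ring | left; apply exp_pos].
Qed.

Lemma osc_sigma0 t : osc 0 t = cis (- t).
Proof. unfold osc. rewrite Rmult_0_l, exp_0. ring. Qed.

(** Both exponentials have the same phase, so their distance is 1 - exp(st). The constant bound is
    meant for the far tail, the bound linear in s for bounded t. *)
Lemma osc_dist s t : s <= 0 -> 0 <= t -> Cmod (osc s t - osc 0 t) <= 1 /\ Cmod (osc s t - osc 0 t) <= - s * t.
Proof.
  intros Hs Ht.
  assert (E : Cmod (osc s t - osc 0 t) = 1 - exp (s * t)).
  { replace (osc s t - osc 0 t)%C with (- (RtoC (1 - exp (s * t)) * cis (- t)))%C.
    - rewrite Cmod_opp, Cmod_mult, Cmod_R, Cmod_cis, Rabs_pos_eq; [ring|].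
      assert (exp (s * t) <= exp 0); [|rewrite exp_0 in *; lra].
      destruct (Rle_lt_or_eq_dec (s * t) 0) as [A|A]; [nra|left; apply exp_increasing, A|rewrite A; lra].
    - unfold osc. rewrite Rmult_0_l, exp_0, RtoC_minus. ring. }
  rewrite E. pose proof (exp_pos (s * t)). pose proof (exp_ineq1_le (s * t)). split; lra.
Qed.

Lemma cderiv_osc s t : cderiv (osc s) t (- (Ci * wavenum s * osc s t))%C.
Proof.
  apply cderiv_pair; split; simpl.
  - apply (is_derive_Rext (fun t => exp (s * t) * cos t)).
    { intros u. rewrite cos_neg. ring. }
    auto_derive; auto. rewrite cos_neg, sin_neg. ring.
  - apply (is_derive_Rext (fun t => - (exp (s * t) * sin t))).
    { intros u. rewrite sin_neg. ring. }
    auto_derive; auto. rewrite cos_neg, sin_neg. ring.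
Qed.

Lemma ccont_osc s t : ccont (osc s) t.
Proof. eapply cderiv_ccont, cderiv_osc. Qed.

Lemma wavenum_ge1 s : 1 <= Cmod (wavenum s).
Proof.
  eapply Rle_trans; [|apply Cmod_fst]. unfold wavenum; simpl.
  replace (1 + (0 * s - 1 * 0)) with 1 by ring. rewrite Rabs_R1; lra.
Qed.

Lemma wavenum_neq0 s : wavenum s <> RtoC 0.
Proof. apply Cmod_gt_0. pose proof (wavenum_ge1 s); lra. Qed.

(** The inverse 1/(2ik) of the constant Wronskian of b exp(-ik phi) and b exp(ik phi), as b^2 phi' =
    1. *)
Definition green_coef (s : R) : C := (/ (2 * Ci * wavenum s))%C.

Lemma Ci2 : (Ci * Ci)%C = (- (1))%C.
Proof. apply C_ext; simpl; ring. Qed.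

Lemma two_neq0 : RtoC 2 <> RtoC 0.
Proof. intros H; apply (f_equal fst) in H; simpl in H; lra. Qed.

Lemma two_Ci_neq0 : (2 * Ci)%C <> RtoC 0.
Proof. apply Cmult_neq_0; [apply two_neq0 | apply Ci_nz]. Qed.

Lemma Cmod_two_Ci : Cmod (2 * Ci) = 2.
Proof. rewrite Cmod_mult, Cmod_Ci, Cmod_R, Rabs_pos_eq; lra. Qed.

Lemma green_coef_le s : Cmod (green_coef s) <= / 2.
Proof.
  unfold green_coef.
  rewrite Cmod_inv by (apply Cmult_neq_0; [apply two_Ci_neq0 | apply wavenum_neq0]).
  rewrite Cmod_mult, Cmod_two_Ci. pose proof (wavenum_ge1 s).
  apply Rinv_le_contravar; lra.
Qed.

Lemma green_coef_dist s : Cmod (green_coef s - green_coef 0) <= Rabs s.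
Proof.
  assert (E : green_coef 0 = (wavenum s * green_coef s)%C).
  { unfold green_coef. replace (wavenum 0) with (RtoC 1) by (unfold wavenum; ring).
    pose proof (wavenum_neq0 s). field. repeat split; auto using Ci_nz, two_neq0. }
  rewrite E.
  replace (green_coef s - wavenum s * green_coef s)%C with (- (Ci * RtoC s * green_coef s))%C
    by (unfold wavenum; ring).
  rewrite Cmod_opp, !Cmod_mult, Cmod_Ci, Cmod_R.
  pose proof (green_coef_le s). pose proof (Rabs_pos s). nra.
Qed.

(** The least upper bound m is finite and satisfies m <= c + m/2. This turns mere boundedness of a
    Volterra solution into a bound with a universal constant. *)
Lemma self_improving (a : R -> R) (x0 c : R) :
  (exists B, forall x, x0 <= x -> a x <= B) ->
  (forall B, (forall x, x0 <= x -> a x <= B) -> forall x, x0 <= x -> a x <= c + B / 2) ->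
  forall x, x0 <= x -> a x <= 2 * c.
Proof.
  intros [B HB] Himp x Hx.
  destruct (completeness (fun r => exists x, x0 <= x /\ r = a x)) as [m [Hub Hlub]].
  - exists B. intros r [y [Hy ->]]; auto.
  - exists (a x), x; auto.
  - assert (A : forall y, x0 <= y -> a y <= m) by (intros y Hy; apply Hub; exists y; auto).
    assert (m <= c + m / 2) by (apply Hlub; intros r [y [Hy ->]]; auto).
    specialize (A x Hx). lra.
Qed.

(** What the scattering argument needs of the coefficient q = c^{-2}, kept apart from its explicit
    form. [N] is a function continuous on the whole line that equals M = b b'' on [x0, +oo), so that
    integrals involving it need no side condition. [pr_small] gives the contraction, and [pr_decay]
    the boundedness of U' for sigma < 0. *)
Record profile (x0 : R) (q b b1 b2 phi N h H : R -> R) : Prop := {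
  pr_x0 : 0 < x0;
  pr_q_cont : forall x, continuous q x;
  pr_q_ge1 : forall x, 1 <= q x;
  pr_phi : forall x, is_derive phi x (sqrt (q x));
  pr_b : forall x, 0 < x -> is_derive b x (b1 x);
  pr_b1 : forall x, 0 < x -> is_derive b1 x (b2 x);
  pr_b_pos : forall x, 0 < x -> 0 < b x;
  pr_bq : forall x, 0 < x -> sqrt (q x) = / (b x ^ 2);
  pr_b1_bounded : exists B, forall x, x0 <= x -> Rabs (b1 x) <= B;
  pr_N_cont : forall x, continuous N x;
  pr_N : forall x, x0 <= x -> N x = b x * b2 x;
  pr_N_le : forall x, x0 <= x -> Rabs (N x) <= h x;
  pr_tail : tail_of h H x0;
  pr_small : H x0 <= 1 / 2;
  pr_phi_pos : forall x, x0 <= x -> x <= phi x;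
  pr_decay : forall s, s < 0 -> exists B, forall x, x0 <= x -> / b x * exp (s * phi x) <= B
}.

Lemma profile_b_le1 x0 q b b1 b2 phi N h H :
  profile x0 q b b1 b2 phi N h H -> forall x, 0 < x -> b x <= 1.
Proof.
  intros W x Hx. pose proof (pr_b_pos _ _ _ _ _ _ _ _ _ W x Hx) as Hb.
  pose proof (pr_bq _ _ _ _ _ _ _ _ _ W x Hx) as Hq.
  assert (1 <= sqrt (q x)).
  { rewrite <- sqrt_1. apply sqrt_le_1_alt, W. }
  rewrite Hq in H0. assert (H1 : 0 < b x ^ 2) by (apply pow_lt, Hb).
  apply (Rmult_le_compat_l (b x ^ 2)) in H0; [|lra]. rewrite Rinv_r in H0 by lra. nra.
Qed.

(** * The Volterra operator at fixed sigma: bounds, solvability, closeness to 1 *)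

Section Volterra.

Context {x0 : R} {q b b1 b2 phi N h H : R -> R} (W : profile x0 q b b1 b2 phi N h H).

Let Hphi := pr_phi _ _ _ _ _ _ _ _ _ W.
Let HT := pr_tail _ _ _ _ _ _ _ _ _ W.
Let HN := pr_N_le _ _ _ _ _ _ _ _ _ W.

Lemma ccont_phi x : continuous phi x.
Proof. eapply is_derive_continuous, Hphi. Qed.

Lemma phi_incr x y : x <= y -> phi x <= phi y.
Proof.
  intros Hxy. destruct (MVT_gen phi x y (fun x => sqrt (q x))) as [t [_ E]].
  - intros; apply Hphi.
  - intros; eapply is_derive_continuity_pt, Hphi.
  - pose proof (sqrt_pos (q t)). nra.
Qed.

Definition fwd (f : R -> C) (y : R) : C := (RtoC (N y) * f y)%C.

(** The kernel exp(-2ik(phi(y) - phi(x))) is split so that the integrand is free of x; the factor in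
    x stands outside the integral in [volterra], and the integral can be differentiated directly. *)
Definition bwd (s : R) (f : R -> C) (y : R) : C := (RtoC (N y) * f y * osc s (2 * phi y))%C.

Lemma ccont_fwd f : (forall x, ccont f x) -> forall x, ccont (fwd f) x.
Proof. intros Hf x. apply ccont_mult; [apply ccont_RtoC, W | apply Hf]. Qed.

Lemma ccont_osc_phi s c x : ccont (fun x => osc s (c * phi x)) x.
Proof.
  apply (ccont_comp (osc s) (fun x => c * phi x)); [|apply ccont_osc].
  apply (continuous_scal_r (V := R_NormedModule)), ccont_phi.
Qed.

Lemma ccont_bwd s f : (forall x, ccont f x) -> forall x, ccont (bwd s f) x.
Proof. intros Hf x. apply ccont_mult; [apply ccont_fwd, Hf | apply ccont_osc_phi]. Qed.

Lemma exp_le_mono x y : x <= y -> exp x <= exp y.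
Proof. intros [Hxy| ->]; [left; apply exp_increasing, Hxy | lra]. Qed.

Lemma fwd_le f B : (forall y, x0 <= y -> Cmod (f y) <= B) ->
  forall y, x0 <= y -> Cmod (fwd f y) <= B * h y.
Proof.
  intros Hf y Hy. unfold fwd. rewrite Cmod_mult, Cmod_R.
  rewrite Rmult_comm. apply Rmult_le_compat; auto using Cmod_ge_0, Rabs_pos.
Qed.

(** For s <= 0 the factor exp(2 s phi) decreases, so its value at the left end bounds it on [x,
    +oo); it exactly compensates the growing factor exp(-2 s phi(x)) in [volterra]. *)
Lemma bwd_le s f B x : s <= 0 -> x0 <= x -> (forall y, x0 <= y -> Cmod (f y) <= B) ->
  forall y, x <= y -> Cmod (bwd s f y) <= B * exp (2 * s * phi x) * h y.
Proof.
  intros Hs Hx Hf y Hy. unfold bwd. rewrite Cmod_mult, Cmod_osc.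
  replace (B * exp (2 * s * phi x) * h y) with (B * h y * exp (2 * s * phi x)) by ring.
  apply Rmult_le_compat; [apply Cmod_ge_0 | left; apply exp_pos | apply fwd_le; auto; lra |].
  apply exp_le_mono. pose proof (phi_incr x y Hy). nra.
Qed.

Definition Afun (s : R) (f : R -> C) (x : R) : C := (green_coef s * CInt (fwd f) x0 x)%C.

(** The tail integral from x, written as a constant minus an integral from x0, so that its
    derivative is available at every x; [Bfun_infty] recovers the tail form on [x0, +oo). *)
Definition Bfun (s : R) (f : R -> C) (x : R) : C :=
  (green_coef s * (CInt_infty (bwd s f) x0 - CInt (bwd s f) x0 x))%C.

Definition volterra (s : R) (f : R -> C) (x : R) : C :=
  (1 + (Afun s f x + osc s (-2 * phi x) * Bfun s f x))%C.

Definition bounded_cont (f : R -> C) : Prop :=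
  (forall x, ccont f x) /\ exists B, forall x, Cmod (f x) <= B.

Lemma bounded_cont_pos f : bounded_cont f ->
  (forall x, ccont f x) /\ exists B, 0 <= B /\ forall x, Cmod (f x) <= B.
Proof.
  intros [Hc [B HB]]. split; auto. exists B; split; auto.
  eapply Rle_trans; [apply Cmod_ge_0 | apply (HB 0)].
Qed.

Lemma bwd_le0 s f B : s <= 0 -> 0 <= B -> (forall y, x0 <= y -> Cmod (f y) <= B) ->
  exists c, 0 <= c /\ forall y, x0 <= y -> Cmod (bwd s f y) <= c * h y.
Proof.
  intros Hs HB Hf. exists (B * exp (2 * s * phi x0)). split.
  - apply Rmult_le_pos; auto. left; apply exp_pos.
  - apply bwd_le; auto; lra.
Qed.

Lemma Bfun_infty s f x : s <= 0 -> bounded_cont f -> x0 <= x ->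
  Bfun s f x = (green_coef s * CInt_infty (bwd s f) x)%C.
Proof.
  intros Hs Hf Hx. apply bounded_cont_pos in Hf as (Cf & B & HB & Hf).
  destruct (bwd_le0 s f B Hs HB (fun y _ => Hf y)) as (c & Hc & Hb).
  unfold Bfun. rewrite (CInt_infty_Chasles (bwd s f) h H x0 x0 x c); auto using ccont_bwd; try lra.
  ring.
Qed.

Lemma Afun_le s f B x : (forall x, ccont f x) -> 0 <= B ->
  (forall y, x0 <= y -> Cmod (f y) <= B) -> x0 <= x ->
  Cmod (Afun s f x) <= / 2 * (B * (H x0 - H x)).
Proof.
  intros Cf HB Hf Hx. unfold Afun. rewrite Cmod_mult.
  apply Rmult_le_compat; auto using Cmod_ge_0, green_coef_le.
  apply (CInt_tail_bound _ h H x0); auto using ccont_fwd; try lra.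
  intros y Hy; apply fwd_le; auto; lra.
Qed.

Lemma Bfun_le s f B x : s <= 0 -> bounded_cont f -> 0 <= B ->
  (forall y, x0 <= y -> Cmod (f y) <= B) -> x0 <= x ->
  Cmod (Bfun s f x) <= / 2 * (B * exp (2 * s * phi x) * H x).
Proof.
  intros Hs Bf HB Hf Hx. rewrite Bfun_infty by auto. rewrite Cmod_mult.
  apply Rmult_le_compat; auto using Cmod_ge_0, green_coef_le.
  apply (CInt_infty_bound _ h H x).
  - apply ccont_bwd, Bf.
  - eapply tail_of_le; eauto.
  - apply Rmult_le_pos; auto. left; apply exp_pos.
  - apply bwd_le; auto.
Qed.

Lemma H_nonneg x : x0 <= x -> 0 <= H x.
Proof. apply HT. Qed.

Lemma H_decr x y : x0 <= x -> x <= y -> H y <= H x.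
Proof.
  intros Hx Hxy. pose proof (tail_RInt h H x0 x y 1 HT Hx Hxy) as I.
  assert (0 <= 1 * (H x - H y)); [|lra].
  apply (is_RInt_ge_0 (fun y => 1 * h y) x y); auto.
  intros t Ht. destruct HT as (_ & _ & P & _). specialize (P t ltac:(lra)). lra.
Qed.

(** The forward part is at most B (H(x0) - H(x))/2 and the backward part at most B H(x)/2. Together
    they give B H(x0)/2 <= B/4, uniformly in x and s. *)
Lemma volterra_sub_le s f B x : s <= 0 -> bounded_cont f -> 0 <= B ->
  (forall y, x0 <= y -> Cmod (f y) <= B) -> x0 <= x ->
  Cmod (Afun s f x + osc s (-2 * phi x) * Bfun s f x) <= B / 4.
Proof.
  intros Hs Bf HB Hf Hx.
  pose proof (Afun_le s f B x (proj1 Bf) HB Hf Hx) as A1.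
  pose proof (Bfun_le s f B x Hs Bf HB Hf Hx) as A2.
  eapply Rle_trans; [apply Cmod_triangle|]. rewrite Cmod_mult, Cmod_osc.
  assert (A3 : exp (s * (-2 * phi x)) * Cmod (Bfun s f x) <= / 2 * (B * H x)).
  { apply Rle_trans with (exp (s * (-2 * phi x)) * (/ 2 * (B * exp (2 * s * phi x) * H x))).
    - apply Rmult_le_compat_l; [left; apply exp_pos | exact A2].
    - right. replace (2 * s * phi x) with (- (s * (-2 * phi x))) by ring. rewrite exp_Ropp.
      field. apply Rgt_not_eq, exp_pos. }
  pose proof (pr_small _ _ _ _ _ _ _ _ _ W) as Hs2. nra.
Qed.

Lemma bounded_cont_minus f g : bounded_cont f -> bounded_cont g -> bounded_cont (fun y => f y - g y)%C.
Proof.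
  intros [Cf [B HB]] [Cg [D HD]]. split.
  - intros x. apply (ccont_ext (fun y => f y + RtoC (-1) * g y)%C); [intros; ring|].
    apply ccont_plus; auto. apply ccont_mult; auto using ccont_const.
  - exists (B + D). intros x. eapply Rle_trans; [apply Cmod_triangle|]. rewrite Cmod_opp.
    specialize (HB x). specialize (HD x). lra.
Qed.

Lemma volterra_minus s f g x : s <= 0 -> bounded_cont f -> bounded_cont g ->
  (volterra s f x - volterra s g x
   = Afun s (fun y => f y - g y)%C x + osc s (-2 * phi x) * Bfun s (fun y => f y - g y)%C x)%C.
Proof.
  intros Hs Bf Bg.
  pose proof Bf as Bf'. pose proof Bg as Bg'.
  apply bounded_cont_pos in Bf' as (Cf & B & HB & Hf). apply bounded_cont_pos in Bg' as (Cg & D & HD & Hg).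
  destruct (bwd_le0 s f B Hs HB (fun y _ => Hf y)) as (c & Hc & Hbf).
  destruct (bwd_le0 s g D Hs HD (fun y _ => Hg y)) as (d & Hd & Hbg).
  assert (EA : CInt (fwd (fun y => f y - g y)%C) x0 x = (CInt (fwd f) x0 x - CInt (fwd g) x0 x)%C).
  { rewrite <- CInt_minus by auto using ccont_fwd. apply CInt_ext. intros; unfold fwd; ring. }
  assert (EB : CInt (bwd s (fun y => f y - g y)%C) x0 x = (CInt (bwd s f) x0 x - CInt (bwd s g) x0 x)%C).
  { rewrite <- CInt_minus by auto using ccont_bwd. apply CInt_ext. intros; unfold bwd; ring. }
  assert (EC : CInt_infty (bwd s (fun y => f y - g y)%C) x0
    = (CInt_infty (bwd s f) x0 - CInt_infty (bwd s g) x0)%C).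
  { rewrite <- (CInt_infty_minus _ _ h H x0 c d); auto using ccont_bwd.
    apply CInt_infty_unique.
    { intros t _. exists (CInt (bwd s (fun y => f y - g y)%C) x0 t). apply CInt_correct, ccont_bwd.
      apply (bounded_cont_minus f g Bf Bg). }
    pose proof (CInt_infty_lim (fun y => bwd s f y - bwd s g y)%C h H x0 (c + d)) as L.
    eapply filterlim_ext; [|apply L]; auto; try lra.
    - intros t. apply CInt_ext. intros; unfold bwd; ring.
    - intros t. apply (ccont_ext (bwd s (fun y => f y - g y)%C)); [intros; unfold bwd; ring|].
      apply ccont_bwd, (bounded_cont_minus f g Bf Bg).
    - intros y Hy. eapply Rle_trans; [apply Cmod_triangle|]. rewrite Cmod_opp.
      specialize (Hbf y Hy). specialize (Hbg y Hy). lra. }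
  unfold volterra, Afun, Bfun. rewrite EA, EB, EC. ring.
Qed.

Lemma cderiv_Afun s f x : (forall x, ccont f x) ->
  cderiv (Afun s f) x (green_coef s * fwd f x)%C.
Proof.
  intros Cf. eapply cderiv_val; [|apply cderiv_mult; [apply cderiv_const | apply cderiv_CInt, ccont_fwd, Cf]].
  cbv beta. ring.
Qed.

Lemma cderiv_Bfun s f x : (forall x, ccont f x) ->
  cderiv (Bfun s f) x (- (green_coef s * bwd s f x))%C.
Proof.
  intros Cf. eapply cderiv_val; [|apply cderiv_mult; [apply cderiv_const |
    apply cderiv_minus; [apply cderiv_const | apply cderiv_CInt, ccont_bwd, Cf]]].
  cbv beta. ring.
Qed.

Lemma ccont_volterra s f x : (forall x, ccont f x) -> ccont (volterra s f) x.
Proof.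
  intros Cf. apply ccont_plus; [apply ccont_const|]. apply ccont_plus.
  - eapply cderiv_ccont, cderiv_Afun, Cf.
  - apply ccont_mult; [apply ccont_osc_phi | eapply cderiv_ccont, cderiv_Bfun, Cf].
Qed.

(** The equation is imposed only where [N] is M, but continuity and boundedness hold on the whole
    line, as the integral lemmas require. *)
Definition volterra_sol (s : R) (T : R -> C) : Prop :=
  bounded_cont T /\ forall x, x0 <= x -> T x = volterra s T x.

Lemma continuous_Rmax a x : continuous (fun t => Rmax a t) x.
Proof.
  apply (continuous_ext (fun t => (a + t + Rabs (a - t)) / 2)).
  { intros t. unfold Rmax. destruct (Rle_dec a t); [rewrite Rabs_left1 | rewrite Rabs_pos_eq]; lra. }
  apply (continuous_scal_l (V := R_NormedModule) (fun t => a + t + Rabs (a - t)) (/ 2)).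
  apply (continuous_plus (V := R_NormedModule)).
  - apply (continuous_plus (V := R_NormedModule)); [apply continuous_const|apply continuous_id].
  - apply (continuous_comp (fun t => a - t) Rabs); [|apply continuous_Rabs].
    apply (continuous_minus (V := R_NormedModule)); [apply continuous_const|apply continuous_id].
Qed.

Lemma volterra_sol_exists s : s <= 0 -> exists T, volterra_sol s T.
Proof.
  intros Hs.
  assert (HW : forall f, weighted (fun _ => 1) f -> bounded_cont f).
  { intros f [Cf [B HB]]. split; auto. exists B. intros x. specialize (HB x). lra. }
  (* The estimates hold only to the right of x0; composing with [Rmax x0] freezes the iterates at
     their value at x0 on the left and makes the contraction global. *)
  destruct (weighted_fixed_point (fun _ => 1) (fun f x => volterra s f (Rmax x0 x)) (1 / 4) 1)
    as [T [HwT HT']]; try lra.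
  - intros; apply continuous_const.
  - intros; lra.
  - intros f Hf x. apply (ccont_comp (volterra s f)); [apply continuous_Rmax|].
    apply ccont_volterra, (proj1 Hf).
  - intros x.
    assert (Bz : bounded_cont (fun _ => RtoC 0)).
    { split; [intros; apply ccont_const | exists 0; intros; rewrite Cmod_0; lra]. }
    pose proof (volterra_sub_le s (fun _ => RtoC 0) 0 (Rmax x0 x) Hs Bz (Rle_refl _)
      (fun y _ => Req_le _ _ Cmod_0) (Rmax_l _ _)) as A.
    unfold volterra. eapply Rle_trans; [apply Cmod_triangle|]. rewrite Cmod_1. lra.
  - intros f g d Hf Hg Hd Hfg x. rewrite volterra_minus by auto.
    replace (1 / 4 * d * 1) with (d / 4) by lra.
    apply volterra_sub_le; auto using Rmax_l, bounded_cont_minus.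
    intros y _. specialize (Hfg y). lra.
  - exists T. split; [apply HW, HwT|]. intros x Hx. rewrite <- (HT' x) at 1.
    rewrite Rmax_right by exact Hx. reflexivity.
Qed.

Lemma volterra_sol_le2 s T : s <= 0 -> volterra_sol s T -> forall x, x0 <= x -> Cmod (T x) <= 2.
Proof.
  intros Hs [BT ET]. replace 2 with (2 * 1) by ring.
  apply (self_improving (fun x => Cmod (T x))).
  - destruct BT as [_ [B HB]]. exists B; auto.
  - intros B HB x Hx. rewrite ET by exact Hx.
    assert (HB0 : 0 <= B) by (eapply Rle_trans; [apply Cmod_ge_0 | apply (HB x0); lra]).
    pose proof (volterra_sub_le s T B x Hs BT HB0 HB Hx).
    eapply Rle_trans; [apply Cmod_triangle|]. rewrite Cmod_1. lra.
Qed.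

Lemma volterra_sol_near1 s T : s <= 0 -> volterra_sol s T -> forall x, x0 <= x ->
  Cmod (T x - 1) <= 1 / 2.
Proof.
  intros Hs HTs x Hx. pose proof (volterra_sol_le2 s T Hs HTs) as B2.
  destruct HTs as [BT ET]. rewrite ET by exact Hx. unfold volterra.
  replace (1 + (Afun s T x + osc s (-2 * phi x) * Bfun s T x) - 1)%C
    with (Afun s T x + osc s (-2 * phi x) * Bfun s T x)%C by ring.
  pose proof (volterra_sub_le s T 2 x Hs BT ltac:(lra) B2 Hx). lra.
Qed.

(** A value within 1/2 of 1 cannot vanish; this is the source of the nonzero denominator in the
    theorem. *)
Lemma volterra_sol_neq0 s T : s <= 0 -> volterra_sol s T -> forall x, x0 <= x -> T x <> RtoC 0.
Proof.
  intros Hs HTs x Hx E. pose proof (volterra_sol_near1 s T Hs HTs x Hx) as A.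
  rewrite E in A. replace (0 - 1)%C with (- (1))%C in A by ring.
  rewrite Cmod_opp, Cmod_1 in A. lra.
Qed.

End Volterra.

(** * Continuity of the Volterra solution as sigma tends to 0 *)

Section Limit.

Context {x0 : R} {q b b1 b2 phi N h H : R -> R} (W : profile x0 q b b1 b2 phi N h H).

Let HT := pr_tail _ _ _ _ _ _ _ _ _ W.

Notation volterra_sol := (@volterra_sol x0 phi N).

Lemma h_nonneg x : x0 <= x -> 0 <= h x.
Proof. apply HT. Qed.

(** The difference of the two backward integrands comes from T - T0 and from the change of kernel.
    Of the two bounds, the coarse one does not shrink with s and is for the tail; the fine one is
    linear in s and is for bounded y. *)
Lemma bwd_dist s (T T0 : R -> C) D x y :
  s <= 0 -> x0 <= x <= y ->
  Cmod (T y) <= 2 -> Cmod (T y - T0 y) <= D ->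
  let z := (osc s (-2 * phi x) * bwd (phi:=phi) (N:=N) s T y
            - osc 0 (-2 * phi x) * bwd (phi:=phi) (N:=N) 0 T0 y)%C in
  Cmod z <= (D + 2) * h y /\ Cmod z <= (D + - s * (4 * (phi y - phi x))) * h y.
Proof.
  intros Hs Hxy HTy HD z.
  set (t := 2 * (phi y - phi x)).
  assert (Ht : 0 <= t) by (unfold t; pose proof (phi_incr W x y); lra).
  assert (Ez : z = (RtoC (N y) * ((T y - T0 y) * osc 0 t + T y * (osc s t - osc 0 t)))%C).
  { unfold z, bwd, t. replace (2 * (phi y - phi x)) with (-2 * phi x + 2 * phi y) by ring.
    rewrite !osc_plus. ring. }
  destruct (osc_dist s t Hs Ht) as [O1 O2].
  assert (M1 : forall r, Cmod (osc s t - osc 0 t) <= r -> Cmod z <= (D + 2 * r) * h y).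
  { intros r Hr. rewrite Ez, Cmod_mult, Cmod_R, Rmult_comm.
    apply Rmult_le_compat; auto using Cmod_ge_0, Rabs_pos; [|apply W; lra].
    eapply Rle_trans; [apply Cmod_triangle|]. rewrite !Cmod_mult.
    rewrite (Cmod_osc 0). rewrite Rmult_0_l, exp_0.
    pose proof (Cmod_ge_0 (T y)). pose proof (Cmod_ge_0 (osc s t - osc 0 t)). nra. }
  split; [apply Rle_trans with ((D + 2 * 1) * h y); [apply M1, O1 | lra]|].
  replace (- s * (4 * (phi y - phi x))) with (2 * (- s * t)) by (unfold t; ring).
  apply M1, O2.
Qed.

(** A quantitative dominated convergence: the cut Y separates a bounded range, where the kernels
    differ by O(|s|), from a tail of size H(Y). The old distance D returns with factor 1/4, ready
    for [self_improving]. *)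
Lemma volterra_sol_dist s T T0 D Y x :
  s <= 0 -> volterra_sol s T -> volterra_sol 0 T0 -> 0 <= D -> x0 <= Y ->
  (forall y, x0 <= y -> Cmod (T y - T0 y) <= D) -> x0 <= x ->
  Cmod (T x - T0 x) <= D / 4 + (- s * (1 + phi Y) + H Y).
Proof.
  intros Hs HTs HT0 HD HY HDT Hx.
  pose proof (volterra_sol_le2 W s T Hs HTs) as B2.
  pose proof (volterra_sol_le2 W 0 T0 (Rle_refl 0) HT0) as B20.
  assert (B4 : forall y, x0 <= y -> Cmod (T y - T0 y) <= D) by auto.
  destruct HTs as [BT ET]. destruct HT0 as [BT0 ET0].
  set (F := bwd (phi:=phi) (N:=N)).
  set (X := (CInt (fwd (N:=N) T) x0 x + osc s (-2 * phi x) * CInt_infty (F s T) x)%C).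
  set (d := fun y => (osc s (-2 * phi x) * F s T y - osc 0 (-2 * phi x) * F 0 T0 y)%C).
  assert (CF : forall s T, bounded_cont T -> forall y, ccont (F s T) y).
  { intros s' T' [C' _] y. apply (ccont_bwd W); auto. }
  assert (Cd : forall y, ccont d y).
  { intros y. apply (ccont_ext (fun y => osc s (-2 * phi x) * F s T y
       + (- osc 0 (-2 * phi x)) * F 0 T0 y)%C); [intros; unfold d; ring|].
    apply ccont_plus; apply ccont_mult; auto using ccont_const. }
  assert (Ed : (CInt_infty d x = osc s (-2 * phi x) * CInt_infty (F s T) x
                - osc 0 (-2 * phi x) * CInt_infty (F 0 T0) x)%C).
  { pose proof (tail_of_le _ _ _ _ Hx HT) as HTx.
    assert (E1 : forall s T, s <= 0 -> bounded_cont T -> (forall y, x0 <= y -> Cmod (T y) <= 2) ->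
        CInt_infty (fun y => osc s (-2 * phi x) * F s T y)%C x
         = (osc s (-2 * phi x) * CInt_infty (F s T) x)%C
        /\ (forall y, x <= y -> Cmod (osc s (-2 * phi x) * F s T y) <= 2 * h y)).
    { intros s' T' Hs' BT' B2'.
      assert (Bb : forall y, x <= y -> Cmod (F s' T' y) <= 2 * exp (2 * s' * phi x) * h y).
      { apply (bwd_le W); auto. }
      split.
      - apply (CInt_infty_scal _ _ h H x (2 * exp (2 * s' * phi x))); auto.
        pose proof (exp_pos (2 * s' * phi x)); lra.
      - intros y Hy. rewrite Cmod_mult, Cmod_osc.
        apply Rle_trans with (exp (s' * (-2 * phi x)) * (2 * exp (2 * s' * phi x) * h y)).
        + apply Rmult_le_compat_l; [left; apply exp_pos | auto].
        + right. replace (s' * (-2 * phi x)) with (- (2 * s' * phi x)) by ring.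
          rewrite exp_Ropp. field. apply Rgt_not_eq, exp_pos. }
    destruct (E1 s T Hs BT B2) as [Ea La]. destruct (E1 0 T0 (Rle_refl 0) BT0 B20) as [Eb Lb].
    rewrite <- Ea, <- Eb. unfold d.
    apply (CInt_infty_minus _ _ h H x 2 2); auto; try lra.
    - intros y. apply ccont_mult; auto using ccont_const.
    - intros y. apply ccont_mult; auto using ccont_const. }
  assert (Ef : (CInt (fwd (N:=N) (fun y => T y - T0 y)) x0 x
                = CInt (fwd (N:=N) T) x0 x - CInt (fwd (N:=N) T0) x0 x)%C).
  { rewrite <- CInt_minus by (apply (ccont_fwd W); first [apply BT | apply BT0]).
    apply CInt_ext. intros; unfold fwd; ring. }
  (* Change of the Green factor, plus change of the integrals at the fixed factor 1/(2i). *)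
  assert (E : (T x - T0 x = (green_coef s - green_coef 0) * X
      + green_coef 0 * (CInt (fwd (N:=N) (fun y => T y - T0 y)) x0 x + CInt_infty d x))%C).
  { rewrite ET, ET0 by exact Hx. unfold volterra.
    rewrite !(Bfun_infty W) by (auto; lra). unfold Afun, X. rewrite Ed, Ef. unfold F. ring. }
  assert (BX : Cmod X <= 1).
  { unfold X. pose proof (pr_small _ _ _ _ _ _ _ _ _ W).
    assert (A1 : Cmod (CInt (fwd (N:=N) T) x0 x) <= 2 * (H x0 - H x)).
    { apply (CInt_tail_bound _ h H x0); auto; try lra.
      - apply (ccont_fwd W), BT.
      - intros y Hy. apply (fwd_le W); auto; lra. }
    assert (A2 : Cmod (osc s (-2 * phi x) * CInt_infty (F s T) x) <= 2 * H x).
    { rewrite Cmod_mult, Cmod_osc.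
      apply Rle_trans with (exp (s * (-2 * phi x)) * (2 * exp (2 * s * phi x) * H x)).
      - apply Rmult_le_compat_l; [left; apply exp_pos|].
        apply (CInt_infty_bound _ h H x); auto.
        + eapply tail_of_le; eauto.
        + pose proof (exp_pos (2 * s * phi x)); lra.
        + apply (bwd_le W); auto.
      - right. replace (2 * s * phi x) with (- (s * (-2 * phi x))) by ring. rewrite exp_Ropp.
        field. apply Rgt_not_eq, exp_pos. }
    eapply Rle_trans; [apply Cmod_triangle|]. lra. }
  assert (BA : Cmod (CInt (fwd (N:=N) (fun y => T y - T0 y)%C) x0 x) <= D * (H x0 - H x)).
  { apply (CInt_tail_bound _ h H x0); auto; try lra.
    - apply (ccont_fwd W), (bounded_cont_minus T T0 BT BT0).
    - intros y Hy. apply (fwd_le W (fun y => T y - T0 y)%C); auto; lra. }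
  assert (PY : 0 <= phi Y).
  { pose proof (pr_phi_pos _ _ _ _ _ _ _ _ _ W Y HY). pose proof (pr_x0 _ _ _ _ _ _ _ _ _ W). lra. }
  assert (Px : 0 <= phi x).
  { pose proof (pr_phi_pos _ _ _ _ _ _ _ _ _ W x Hx). pose proof (pr_x0 _ _ _ _ _ _ _ _ _ W). lra. }
  pose proof (pr_small _ _ _ _ _ _ _ _ _ W) as HS.
  pose proof (H_nonneg W Y HY) as HY0. pose proof (H_nonneg W x Hx) as Hx0'.
  pose proof (H_decr W x0 x (Rle_refl _) Hx) as Hxle. pose proof (H_decr W x0 Y (Rle_refl _) HY) as HYle.
  assert (Bd : Cmod (CInt_infty d x) <= D * H x + (- s * (2 * phi Y) + 2 * H Y)).
  { assert (D1 : forall y, x <= y -> Cmod (d y) <= (D + 2) * h y).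
    { intros y Hy. apply bwd_dist; auto; [apply B2 | apply HDT]; lra. }
    (* Beyond Y the coarse bound suffices. Otherwise the fine bound is integrated over [x, Y], where
       phi <= phi(Y), and the coarse one over [Y, +oo). *)
    destruct (Rle_dec Y x) as [HYx|HYx].
    - assert (A : Cmod (CInt_infty d x) <= (D + 2) * H x).
      { apply (CInt_infty_bound _ h H x); auto; [|lra]. apply (tail_of_le _ _ x0 x); auto. }
      pose proof (H_decr W Y x HY HYx).
      assert (0 <= - s * (2 * phi Y)) by (apply Rmult_le_pos; lra). lra.
    - rewrite (CInt_infty_Chasles d h H x x Y (D + 2)); auto; try lra.
      2:{ apply (tail_of_le _ _ x0 x); auto. }
      eapply Rle_trans; [apply Cmod_triangle|].
      assert (A1 : Cmod (CInt d x Y) <= (D + - s * (4 * phi Y)) * (H x - H Y)).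
      { apply (CInt_tail_bound _ h H x0); auto; try lra.
        intros y Hy. eapply Rle_trans; [apply bwd_dist; auto; [lra | apply B2; lra | apply HDT; lra]|].
        apply Rmult_le_compat_r; [apply h_nonneg; lra|].
        pose proof (phi_incr W y Y ltac:(lra)).
        assert (- s * (4 * (phi y - phi x)) <= - s * (4 * phi Y)) by (apply Rmult_le_compat_l; lra).
        lra. }
      assert (A2 : Cmod (CInt_infty d Y) <= (D + 2) * H Y).
      { apply (CInt_infty_bound _ h H Y); auto; try lra.
        - apply (tail_of_le _ _ x0 Y); auto.
        - intros y Hy; apply D1; lra. }
      assert (0 <= - s * (4 * phi Y)) by (apply Rmult_le_pos; lra).
      assert (- s * (4 * phi Y) * (H x - H Y) <= - s * (4 * phi Y) * (1 / 2)) by (apply Rmult_le_compat_l; lra).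
      lra. }
  rewrite E. eapply Rle_trans; [apply Cmod_triangle|]. rewrite !Cmod_mult.
  pose proof (green_coef_dist s) as G1. rewrite Rabs_left1 in G1 by lra.
  pose proof (green_coef_le 0) as G2.
  assert (C1 : Cmod (green_coef s - green_coef 0) * Cmod X <= - s * 1)
    by (apply Rmult_le_compat; auto using Cmod_ge_0).
  assert (C2 : Cmod (green_coef 0) * Cmod (CInt (fwd (N:=N) (fun y => T y - T0 y)%C) x0 x + CInt_infty d x)
     <= / 2 * (D * (H x0 - H x) + (D * H x + (- s * (2 * phi Y) + 2 * H Y)))).
  { apply Rmult_le_compat; auto using Cmod_ge_0.
    eapply Rle_trans; [apply Cmod_triangle|]. lra. }
  assert (D * H x0 <= D * (1 / 2)) by (apply Rmult_le_compat_l; lra).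
  lra.
Qed.

(** First Y is fixed so that the tail is below eps/4, then delta so that |s| (1 + phi(Y)) is; the
    convergence is uniform on [x0, +oo). *)
Lemma volterra_sol_lim T0 : volterra_sol 0 T0 -> forall eps, 0 < eps ->
  exists delta, 0 < delta /\ forall s T, - delta < s <= 0 -> volterra_sol s T ->
  forall x, x0 <= x -> Cmod (T x - T0 x) <= eps.
Proof.
  intros HT0 eps He.
  destruct (tail_small h H x0 HT (eps / 4) ltac:(lra)) as (Y & HY & HHY).
  specialize (HHY Y (Rle_refl Y)).
  assert (PY : 0 < 1 + phi Y).
  { pose proof (pr_phi_pos _ _ _ _ _ _ _ _ _ W Y HY). pose proof (pr_x0 _ _ _ _ _ _ _ _ _ W). lra. }
  exists (eps / (4 * (1 + phi Y))). split; [apply Rdiv_lt_0_compat; lra|].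
  intros s T [Hs1 Hs2] HTs x Hx.
  assert (Hs3 : - s * (1 + phi Y) <= eps / 4).
  { apply Rle_trans with (eps / (4 * (1 + phi Y)) * (1 + phi Y)).
    - apply Rmult_le_compat_r; lra.
    - right; field; lra. }
  replace eps with (2 * (eps / 2)) by field.
  revert x Hx. apply (self_improving (fun x => Cmod (T x - T0 x))).
  - destruct (bounded_cont_minus T T0 (proj1 HTs) (proj1 HT0)) as [_ [B HB]]. exists B; auto.
  - intros D HD x Hx.
    assert (HD0 : 0 <= D) by (eapply Rle_trans; [apply Cmod_ge_0 | apply (HD x0); lra]).
    pose proof (volterra_sol_dist s T T0 D Y x Hs2 HTs HT0 HD0 HY HD Hx). lra.
Qed.

End Limit.

(** * The outgoing wave *)

Lemma continuous_bounded (f : R -> R) a b :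
  (forall x, continuous f x) -> exists K, forall x, a <= x <= b -> f x <= K.
Proof.
  intros Hf. destruct (Rle_dec a b) as [Hab|Hab].
  - destruct (continuity_ab_maj f a b Hab) as [t [Ht _]].
    { intros; apply continuity_pt_filterlim, Hf. }
    exists (f t). exact Ht.
  - exists 0. intros; lra.
Qed.

Lemma Cmod_le_0 (z : C) : Cmod z <= 0 -> z = RtoC 0.
Proof. intros Hz. apply Cmod_eq_0. apply Rle_antisym; [exact Hz | apply Cmod_ge_0]. Qed.

Lemma ode_unique (z z1 : R -> C) (q : R -> R) (kap : C) (a b x0 : R) :
  (forall x, continuous q x) -> (forall x, 0 <= q x) ->
  (forall x, a <= x <= b -> cderiv z x (z1 x)) ->
  (forall x, a <= x <= b -> cderiv z1 x (- (kap * RtoC (q x) * z x))%C) ->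
  z x0 = RtoC 0 -> z1 x0 = RtoC 0 -> a <= x0 <= b ->
  forall x, a <= x <= b -> z x = RtoC 0.
Proof.
  intros Cq Hq Hz Hz1 E E1 Hx0 x Hx.
  destruct (continuous_bounded q a b Cq) as [K HK].
  assert (G' : Cmod (z x) ^ 2 + Cmod (z1 x) ^ 2 + 0
    <= (Cmod (z x0) ^ 2 + Cmod (z1 x0) ^ 2 + 0) * exp ((2 + Cmod kap * K) * Rabs (x - x0))).
  { apply (ode_gronwall z z1 (fun _ => RtoC 0) q kap a b); auto.
    - intros t Ht. eapply cderiv_val; [|apply Hz1, Ht]. ring.
    - intros t Ht. rewrite Cmod_mult, Cmod_R, Rabs_pos_eq by auto.
      apply Rmult_le_compat_l; [apply Cmod_ge_0 | auto].
    - intros; rewrite Cmod_0; lra. }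
  rewrite E, E1, Cmod_0 in G'.
  replace (0 ^ 2 + 0 ^ 2 + 0) with 0 in G' by ring. rewrite Rmult_0_l in G'.
  pose proof (pow2_ge_0 (Cmod (z1 x))). pose proof (Cmod_ge_0 (z x)).
  apply Cmod_le_0. nra.
Qed.

(** The mean value theorem holds only for real functions; applying it to both components costs the
    factor 2. *)
Lemma Cmean_value (g g1 : R -> C) (a b K : R) :
  a <= b -> (forall x, a <= x <= b -> cderiv g x (g1 x)) ->
  (forall x, a <= x <= b -> Cmod (g1 x) <= K) -> Cmod (g b - g a) <= 2 * K * (b - a).
Proof.
  intros Hab Hg HK.
  assert (M : forall (p p1 : R -> R), (forall x, a <= x <= b -> is_derive p x (p1 x)) ->
     (forall x, a <= x <= b -> Rabs (p1 x) <= K) -> Rabs (p b - p a) <= K * (b - a)).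
  { intros p p1 Hp HpK.
    destruct (MVT_gen p a b p1) as [t [Ht E]].
    - intros x; rewrite Rmin_left, Rmax_right by lra; intros; apply Hp; lra.
    - intros x; rewrite Rmin_left, Rmax_right by lra; intros.
      apply (is_derive_continuity_pt p x (p1 x)), Hp; lra.
    - rewrite Rmin_left, Rmax_right in Ht by lra. rewrite E, Rabs_mult, (Rabs_pos_eq (b - a)) by lra.
      apply Rmult_le_compat_r; [lra | auto]. }
  eapply Rle_trans; [apply Cmod_le_sum|].
  pose proof (M (fun x => fst (g x)) (fun x => fst (g1 x))) as M1.
  pose proof (M (fun x => snd (g x)) (fun x => snd (g1 x))) as M2.
  assert (Rabs (fst (g b) - fst (g a)) <= K * (b - a)).
  { apply M1; intros x Hx.
    - apply (proj1 (proj1 (cderiv_pair g x (g1 x)) (Hg x Hx))).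
    - eapply Rle_trans; [apply Cmod_fst | auto]. }
  assert (Rabs (snd (g b) - snd (g a)) <= K * (b - a)).
  { apply M2; intros x Hx.
    - apply (proj2 (proj1 (cderiv_pair g x (g1 x)) (Hg x Hx))).
    - eapply Rle_trans; [apply Cmod_snd | auto]. }
  simpl. unfold Rminus in *. lra.
Qed.

(** * Limits of complex sequences along sigma tending to 0 *)

Definition Cseq_lim (u : nat -> C) (l : C) : Prop :=
  forall eps, 0 < eps -> exists n0, forall n, (n0 <= n)%nat -> Cmod (u n - l) < eps.

Lemma Cseq_lim_pair u l : Cseq_lim u l <->
  is_lim_seq (fun n => fst (u n)) (fst l) /\ is_lim_seq (fun n => snd (u n)) (snd l).
Proof.
  split.
  - intros Hu; split; apply is_lim_seq_spec; intros eps; destruct (Hu eps (cond_pos eps)) as [N HN];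
      exists N; intros n Hn; specialize (HN n Hn); eapply Rle_lt_trans; try exact HN.
    + apply (Cmod_fst (u n - l)%C).
    + apply (Cmod_snd (u n - l)%C).
  - intros [A B] eps He. apply is_lim_seq_spec in A. apply is_lim_seq_spec in B.
    assert (He2 : 0 < eps / 2) by lra.
    destruct (A (mkposreal _ He2)) as [N1 H1]. destruct (B (mkposreal _ He2)) as [N2 H2].
    simpl in H1, H2. exists (N1 + N2)%nat. intros n Hn.
    specialize (H1 n ltac:(lia)). specialize (H2 n ltac:(lia)).
    eapply Rle_lt_trans; [apply Cmod_le_sum|]. simpl. unfold Rminus in *. lra.
Qed.

Lemma Cseq_lim_const (a : C) : Cseq_lim (fun _ => a) a.
Proof. apply Cseq_lim_pair; split; apply is_lim_seq_const. Qed.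

Lemma Cseq_lim_plus u v l m : Cseq_lim u l -> Cseq_lim v m -> Cseq_lim (fun n => u n + v n)%C (l + m)%C.
Proof.
  rewrite !Cseq_lim_pair. intros [A B] [A' B']. split; simpl; apply is_lim_seq_plus'; auto.
Qed.

Lemma Cseq_lim_mult u v l m : Cseq_lim u l -> Cseq_lim v m -> Cseq_lim (fun n => u n * v n)%C (l * m)%C.
Proof.
  rewrite !Cseq_lim_pair. intros [A B] [A' B']. split; simpl.
  - apply is_lim_seq_minus'; apply is_lim_seq_mult'; auto.
  - apply is_lim_seq_plus'; apply is_lim_seq_mult'; auto.
Qed.

Lemma Cseq_lim_minus u v l m : Cseq_lim u l -> Cseq_lim v m -> Cseq_lim (fun n => u n - v n)%C (l - m)%C.
Proof.
  rewrite !Cseq_lim_pair. intros [A B] [A' B']. split; simpl; apply is_lim_seq_minus'; auto.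
Qed.

Lemma Cseq_lim_unique u l m : Cseq_lim u l -> Cseq_lim u m -> l = m.
Proof.
  rewrite !Cseq_lim_pair. intros [A B] [A' B'].
  apply is_lim_seq_unique in A, B, A', B'. apply C_ext; congruence.
Qed.

Lemma Cseq_lim_ext u v l m : (forall n, u n = v n) -> l = m -> Cseq_lim u l -> Cseq_lim v m.
Proof. intros E -> Hu eps He. destruct (Hu eps He) as [N HN]. exists N. intros; rewrite <- E; auto. Qed.

Lemma Cseq_lim_wavenum sigma : is_lim_seq sigma 0 -> Cseq_lim (fun n => wavenum (sigma n)) (wavenum 0).
Proof.
  intros Hs. apply Cseq_lim_plus; [apply Cseq_lim_const|].
  apply Cseq_lim_mult; [apply Cseq_lim_const|].
  apply Cseq_lim_pair; split; simpl; [exact Hs | apply is_lim_seq_const].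
Qed.

Lemma Cseq_lim_osc sigma t : is_lim_seq sigma 0 -> Cseq_lim (fun n => osc (sigma n) t) (osc 0 t).
Proof.
  intros Hs. unfold osc. apply Cseq_lim_mult; [|apply Cseq_lim_const].
  apply Cseq_lim_pair; split; simpl; [|apply is_lim_seq_const].
  apply (is_lim_seq_continuous (fun s => exp (s * t)) sigma 0); [|exact Hs].
  apply continuity_pt_filterlim.
  apply (is_derive_continuous (fun s => exp (s * t)) 0 (t * exp (0 * t))).
  auto_derive; auto. ring.
Qed.

(** * The wave U: its equation, its bounds, and its Wronskian with a decaying solution *)

Section Wave.

Context {x0 : R} {q b b1 b2 phi N h H : R -> R} (W : profile x0 q b b1 b2 phi N h H).

Let Hphi := pr_phi _ _ _ _ _ _ _ _ _ W.
Let Hx0 := pr_x0 _ _ _ _ _ _ _ _ _ W.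

Notation volterra_sol := (@volterra_sol x0 phi N).
Notation Afun := (@Afun x0 N).
Notation Bfun := (@Bfun x0 phi N).

(** U in variation of constants form: 1 + A and B are the coefficients of the two WKB functions. The
    product form b exp(-ik phi) T holds where T solves its equation, see [wave_eq]. *)
Definition wave (s : R) (T : R -> C) (x : R) : C :=
  (RtoC (b x) * (osc s (phi x) * (1 + Afun s T x) + osc s (- phi x) * Bfun s T x))%C.

(** The derivatives of A and B are absent because their contributions to U' cancel, as usual in
    variation of constants; here phi' = 1/b^2. *)
Definition dwave (s : R) (T : R -> C) (x : R) : C :=
  ((RtoC (b1 x) - Ci * wavenum s * RtoC (/ b x)) * (osc s (phi x) * (1 + Afun s T x))
   + (RtoC (b1 x) + Ci * wavenum s * RtoC (/ b x)) * (osc s (- phi x) * Bfun s T x))%C.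

Lemma cderiv_osc_phi s x :
  cderiv (fun x => osc s (phi x)) x (- (Ci * wavenum s * RtoC (sqrt (q x)) * osc s (phi x)))%C.
Proof.
  eapply cderiv_val; [|apply (cderiv_comp (osc s) phi x); [apply Hphi | apply cderiv_osc]].
  ring.
Qed.

Lemma cderiv_osc_mphi s x :
  cderiv (fun x => osc s (- phi x)) x (Ci * wavenum s * RtoC (sqrt (q x)) * osc s (- phi x))%C.
Proof.
  eapply cderiv_val; [|apply (cderiv_comp (osc s) (fun x => - phi x) x);
    [apply (is_derive_opp (V := R_NormedModule)), Hphi | apply cderiv_osc]].
  unfold opp; simpl. rewrite RtoC_opp. ring.
Qed.

(** This equality is the cancellation behind [dwave]: A' and B' enter U' with the same oscillating
    factor and opposite signs. *)
Lemma osc_mphi_bwd s T x : (osc s (- phi x) * bwd (phi:=phi) (N:=N) s T x)%C = (osc s (phi x) * fwd (N:=N) T x)%C.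
Proof.
  unfold bwd, fwd. replace (phi x) with (- phi x + 2 * phi x) at 3 by ring.
  rewrite osc_plus. ring.
Qed.

Lemma b_neq0 x : 0 < x -> RtoC (b x) <> RtoC 0.
Proof.
  intros Hx E. apply (f_equal fst) in E. simpl in E.
  pose proof (pr_b_pos _ _ _ _ _ _ _ _ _ W x Hx). lra.
Qed.

Lemma RtoC_sqrt_q x : 0 < x -> RtoC (sqrt (q x)) = (/ RtoC (b x) * / RtoC (b x))%C.
Proof.
  intros Hx. pose proof (pr_b_pos _ _ _ _ _ _ _ _ _ W x Hx).
  rewrite (pr_bq _ _ _ _ _ _ _ _ _ W x Hx), RtoC_inv by (apply Rgt_not_eq, pow_lt; auto).
  rewrite RtoC_pow. field. apply b_neq0, Hx.
Qed.

Lemma RtoC_q x : 0 < x ->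
  RtoC (q x) = (/ RtoC (b x) * / RtoC (b x) * / RtoC (b x) * / RtoC (b x))%C.
Proof.
  intros Hx. rewrite <- (sqrt_sqrt (q x)).
  - rewrite RtoC_mult, RtoC_sqrt_q by exact Hx. ring.
  - pose proof (pr_q_ge1 _ _ _ _ _ _ _ _ _ W x). lra.
Qed.

Lemma cderiv_outgoing_part s T x : (forall x, ccont T x) ->
  cderiv (fun x => osc s (phi x) * (1 + Afun s T x))%C x
    (- (Ci * wavenum s * RtoC (sqrt (q x)) * (osc s (phi x) * (1 + Afun s T x)))
     + green_coef s * (osc s (phi x) * fwd (N:=N) T x))%C.
Proof.
  intros CT.
  assert (D : cderiv (fun x => 1 + Afun s T x)%C x (0 + green_coef s * fwd (N:=N) T x)%C).
  { apply (cderiv_plus (fun _ => RtoC 1)); [apply cderiv_const | apply (cderiv_Afun W), CT]. }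
  eapply cderiv_val; [|exact (cderiv_mult _ _ x _ _ (cderiv_osc_phi s x) D)].
  cbv beta. ring.
Qed.

Lemma cderiv_incoming_part s T x : (forall x, ccont T x) ->
  cderiv (fun x => osc s (- phi x) * Bfun s T x)%C x
    (Ci * wavenum s * RtoC (sqrt (q x)) * (osc s (- phi x) * Bfun s T x)
     - green_coef s * (osc s (phi x) * fwd (N:=N) T x))%C.
Proof.
  intros CT.
  eapply cderiv_val; [|exact (cderiv_mult _ _ x _ _ (cderiv_osc_mphi s x) (cderiv_Bfun W s T x CT))].
  cbv beta. rewrite <- osc_mphi_bwd. ring.
Qed.

Lemma cderiv_wave s T x : (forall x, ccont T x) -> 0 < x -> cderiv (wave s T) x (dwave s T x).
Proof.
  intros CT Hx.
  pose proof (cderiv_plus _ _ x _ _ (cderiv_outgoing_part s T x CT) (cderiv_incoming_part s T x CT)) as D.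
  pose proof (cderiv_RtoC b x _ (pr_b _ _ _ _ _ _ _ _ _ W x Hx)) as Db.
  pose proof (cderiv_mult _ _ x _ _ Db D) as DW.
  eapply cderiv_val; [|exact DW]. cbv beta. unfold dwave.
  pose proof (pr_b_pos _ _ _ _ _ _ _ _ _ W x Hx).
  rewrite RtoC_sqrt_q, RtoC_inv by lra.
  generalize (osc s (phi x) * (1 + Afun s T x))%C. intros P.
  generalize (osc s (- phi x) * Bfun s T x)%C. intros Q.
  field. apply b_neq0, Hx.
Qed.

Lemma wave_eq s T x : s <= 0 -> volterra_sol s T -> x0 <= x ->
  wave s T x = (RtoC (b x) * osc s (phi x) * T x)%C.
Proof.
  intros Hs [BT ET] Hx. unfold wave. rewrite ET by exact Hx. unfold volterra.
  replace (- phi x) with (phi x + -2 * phi x) by ring. rewrite osc_plus. ring.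
Qed.

(** In U'' the derivatives of A and B leave -2ik g N exp(-ik phi) T / b with g = 1/(2ik), that is
    -b'' exp(-ik phi) T as N = b b''. It cancels the term b'' (P + Q) from differentiating b',
    because P + Q = exp(-ik phi) T; this is where the Volterra equation is used. *)
Lemma cderiv_dwave s T x : s <= 0 -> volterra_sol s T -> x0 <= x ->
  cderiv (dwave s T) x (- (wavenum s * wavenum s * RtoC (q x) * wave s T x))%C.
Proof.
  intros Hs HTs Hx. pose proof (wave_eq s T x Hs HTs Hx) as EW. pose proof (proj1 (proj1 HTs)) as CT.
  assert (Hx' : 0 < x) by lra.
  pose proof (pr_b_pos _ _ _ _ _ _ _ _ _ W x Hx') as Hb.
  assert (Dinv : is_derive (fun x => / b x) x (- b1 x / b x ^ 2)).
  { apply is_derive_inv; [apply W, Hx' | lra]. }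
  pose proof (b_neq0 x Hx') as Nb.
  pose proof (cderiv_RtoC b1 x _ (pr_b1 _ _ _ _ _ _ _ _ _ W x Hx')) as Db1.
  pose proof (cderiv_mult _ _ x _ _ (cderiv_const (Ci * wavenum s)%C x) (cderiv_RtoC _ x _ Dinv)) as Dk.
  pose proof (cderiv_mult _ _ x _ _ (cderiv_minus _ _ x _ _ Db1 Dk) (cderiv_outgoing_part s T x CT)) as D1.
  pose proof (cderiv_mult _ _ x _ _ (cderiv_plus _ _ x _ _ Db1 Dk) (cderiv_incoming_part s T x CT)) as D2.
  eapply cderiv_val; [|exact (cderiv_plus _ _ x _ _ D1 D2)].
  clear D1 D2 Dk Db1 Dinv. cbv beta.
  unfold fwd. rewrite (pr_N _ _ _ _ _ _ _ _ _ W x Hx), RtoC_mult.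
  assert (EW2 : (osc s (phi x) * T x
     = osc s (phi x) * (1 + Afun s T x) + osc s (- phi x) * Bfun s T x)%C).
  { unfold wave in EW.
    transitivity (/ RtoC (b x) * (RtoC (b x) * osc s (phi x) * T x))%C; [field; exact Nb|].
    rewrite <- EW. field. exact Nb. }
  replace (osc s (phi x) * (RtoC (b x) * RtoC (b2 x) * T x))%C
    with (RtoC (b x) * RtoC (b2 x) * (osc s (phi x) * T x))%C by ring.
  unfold wave.
  rewrite RtoC_q, RtoC_sqrt_q by exact Hx'.
  replace (- b1 x / b x ^ 2) with (- (b1 x * (/ b x * / b x))) by (field; lra).
  rewrite RtoC_opp, !RtoC_mult, !RtoC_inv by lra.
  replace (osc s (phi x) * (green_coef s * (RtoC (b x) * RtoC (b2 x) * T x)))%C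
    with (green_coef s * RtoC (b x) * RtoC (b2 x) * (osc s (phi x) * T x))%C by ring.
  rewrite EW2. unfold green_coef. pose proof (wavenum_neq0 s).
  generalize (osc s (phi x) * (1 + Afun s T x))%C. intros P.
  generalize (osc s (- phi x) * Bfun s T x)%C. intros Q.
  (* The field simplification treats i as an indeterminate; this relation supplies i^2 = -1. *)
  assert (HC : (Ci ^ 3 = - Ci)%C).
  { transitivity (Ci * Ci * Ci)%C; [ring|]. rewrite Ci2. ring. }
  field_simplify_eq; [rewrite HC; ring | repeat split; auto using Ci_nz, two_neq0].
Qed.

Lemma wave_neq0 s T x : s <= 0 -> volterra_sol s T -> x0 <= x -> wave s T x <> RtoC 0.
Proof.
  intros Hs HTs Hx. rewrite (wave_eq s T x Hs HTs Hx).
  apply Cmult_neq_0; [|apply (volterra_sol_neq0 W s T Hs HTs x Hx)].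
  apply Cmult_neq_0; [apply b_neq0; lra|].
  apply Cmod_gt_0. rewrite Cmod_osc. apply exp_pos.
Qed.

Lemma wave_le s T x : s <= 0 -> volterra_sol s T -> x0 <= x -> Cmod (wave s T x) <= 2 * exp (s * x).
Proof.
  intros Hs HTs Hx. rewrite (wave_eq s T x Hs HTs Hx).
  rewrite !Cmod_mult, Cmod_osc, Cmod_R.
  pose proof (volterra_sol_le2 W s T Hs HTs x Hx).
  assert (Hx' : 0 < x) by lra.
  pose proof (pr_b_pos _ _ _ _ _ _ _ _ _ W x Hx') as Hb.
  pose proof (profile_b_le1 _ _ _ _ _ _ _ _ _ W x Hx').
  rewrite Rabs_pos_eq by lra.
  assert (exp (s * phi x) <= exp (s * x)).
  { apply exp_le_mono. pose proof (pr_phi_pos _ _ _ _ _ _ _ _ _ W x Hx). nra. }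
  pose proof (exp_pos (s * phi x)). pose proof (Cmod_ge_0 (T x)).
  apply Rle_trans with ((1 * exp (s * x)) * 2); [|lra].
  apply Rmult_le_compat; auto; [apply Rmult_le_pos; lra | apply Rmult_le_compat; lra].
Qed.

(** The amplitude 1/b may be unbounded, but for s < 0 the factor exp(s phi) tames it through
    [pr_decay]. The incoming part carries the growing exp(-s phi), against which B contributes exp(2
    s phi), so both parts decay alike. *)
Lemma dwave_bounded s T : s < 0 -> volterra_sol s T ->
  exists K, forall x, x0 <= x -> Cmod (dwave s T x) <= K.
Proof.
  intros Hs HTs. assert (Hs' : s <= 0) by lra.
  pose proof (volterra_sol_le2 W s T Hs' HTs) as B2. destruct HTs as [BT _].
  destruct (pr_b1_bounded _ _ _ _ _ _ _ _ _ W) as [B1 HB1].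
  destruct (pr_decay _ _ _ _ _ _ _ _ _ W s Hs) as [D HD].
  set (k := Cmod (wavenum s)). assert (Hk : 0 <= k) by apply Cmod_ge_0.
  exists ((B1 + k * D) * 3).
  intros x Hx. assert (Hx' : 0 < x) by lra.
  pose proof (pr_b_pos _ _ _ _ _ _ _ _ _ W x Hx') as Hb.
  set (e := exp (s * phi x)). assert (He : 0 < e) by apply exp_pos.
  assert (He1 : e <= 1).
  { unfold e. rewrite <- exp_0. apply exp_le_mono.
    pose proof (pr_phi_pos _ _ _ _ _ _ _ _ _ W x Hx). nra. }
  pose proof (pr_small _ _ _ _ _ _ _ _ _ W) as HS.
  pose proof (H_nonneg W x Hx) as H0. pose proof (H_decr W x0 x (Rle_refl _) Hx) as H1.
  assert (A1 : Cmod (osc s (phi x) * (1 + Afun s T x)) <= e * (3 / 2)).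
  { rewrite Cmod_mult, Cmod_osc. apply Rmult_le_compat_l; [lra|].
    eapply Rle_trans; [apply Cmod_triangle|]. rewrite Cmod_1.
    pose proof (Afun_le W s T 2 x (proj1 BT) ltac:(lra) B2 Hx). lra. }
  assert (A2 : Cmod (osc s (- phi x) * Bfun s T x) <= e * (3 / 2)).
  { rewrite Cmod_mult, Cmod_osc.
    pose proof (Bfun_le W s T 2 x Hs' BT ltac:(lra) B2 Hx) as A.
    assert (E2 : exp (2 * s * phi x) = e * e) by (unfold e; rewrite <- exp_plus; f_equal; ring).
    assert (E1 : exp (s * - phi x) * e = 1).
    { unfold e. rewrite <- exp_plus. replace (s * - phi x + s * phi x) with 0 by ring. apply exp_0. }
    rewrite E2 in A. set (ei := exp (s * - phi x)) in *.
    assert (0 < ei) by apply exp_pos.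
    apply Rle_trans with (ei * (/ 2 * (2 * (e * e) * H x))); [apply Rmult_le_compat_l; lra|].
    replace (ei * (/ 2 * (2 * (e * e) * H x))) with ((ei * e) * (e * H x)) by field.
    rewrite E1. nra. }
  assert (C1 : forall z : C, Cmod z <= Rabs (b1 x) + k * / b x ->
     forall w : C, Cmod w <= e * (3 / 2) -> Cmod (z * w) <= (B1 + k * D) * (3 / 2)).
  { intros z Hz w Hw. rewrite Cmod_mult.
    apply Rle_trans with ((Rabs (b1 x) + k * / b x) * (e * (3 / 2))).
    - apply Rmult_le_compat; auto using Cmod_ge_0.
    - specialize (HB1 x Hx). specialize (HD x Hx). fold e in HD.
      replace ((Rabs (b1 x) + k * / b x) * (e * (3 / 2)))
        with ((Rabs (b1 x) * e + k * (/ b x * e)) * (3 / 2)) by ring.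
      apply Rmult_le_compat_r; [lra|]. pose proof (Rabs_pos (b1 x)).
      apply Rplus_le_compat; [nra | apply Rmult_le_compat_l; lra]. }
  assert (Ck : Cmod (Ci * wavenum s * RtoC (/ b x)) = k * / b x).
  { rewrite !Cmod_mult, Cmod_Ci, Cmod_R, Rabs_pos_eq; [unfold k; ring|].
    left; apply Rinv_0_lt_compat, Hb. }
  unfold dwave. eapply Rle_trans; [apply Cmod_triangle|].
  replace ((B1 + k * D) * 3) with ((B1 + k * D) * (3 / 2) + (B1 + k * D) * (3 / 2)) by field.
  apply Rplus_le_compat; apply C1; auto; (eapply Rle_trans; [apply Cmod_triangle|]);
    rewrite ?Cmod_opp, Ck, Cmod_R; lra.
Qed.

(** Limit point reasoning: the constant Wronskian c of w and U must vanish. As w' is not controlled,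
    c is read off from (w U)' = 2 w U' - c, in which w tends to 0 while U and U' stay bounded. *)
Lemma decaying_sol_prop s T (w w1 : R -> C) :
  s < 0 -> volterra_sol s T ->
  (forall x, cderiv w x (w1 x)) ->
  (forall x, cderiv w1 x (- (wavenum s * wavenum s * RtoC (q x) * w x))%C) ->
  filterlim w (Rbar_locally p_infty) (locally (T := C_UniformSpace) (RtoC 0)) ->
  forall x, x0 <= x -> (w x * wave s T x0 = w x0 * wave s T x)%C.
Proof.
  intros Hs HTs Hw Hw1 Hlim. assert (Hs' : s <= 0) by lra.
  pose proof (proj1 (proj1 HTs)) as CT.
  set (V := wave s T). set (V1 := dwave s T).
  assert (DV : forall x, x0 <= x -> cderiv V x (V1 x)) by (intros; apply cderiv_wave; auto; lra).
  assert (DV1 : forall x, x0 <= x -> cderiv V1 x (- (wavenum s * wavenum s * RtoC (q x) * V x))%C)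
    by (intros; apply cderiv_dwave; auto).
  set (c := (w x0 * V1 x0 - w1 x0 * V x0)%C).
  assert (HW : forall x, x0 <= x -> (w x * V1 x - w1 x * V x = c)%C).
  { intros x Hx.
    pose proof (Cmean_value (fun x => w x * V1 x - w1 x * V x)%C (fun _ => RtoC 0) x0 x 0 Hx) as A.
    apply Ceq_minus, Cmod_le_0. eapply Rle_trans; [apply A|lra].
    - intros t Ht.
      pose proof (cderiv_minus _ _ t _ _ (cderiv_mult _ _ t _ _ (Hw t) (DV1 t ltac:(lra)))
        (cderiv_mult _ _ t _ _ (Hw1 t) (DV t ltac:(lra)))) as D.
      eapply cderiv_val; [|exact D]. cbv beta. ring.
    - intros. rewrite Cmod_0. lra. }
  assert (Hc : c = RtoC 0).
  { destruct (dwave_bounded s T Hs HTs) as [K HK]. fold V1 in HK.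
    assert (HK0 : 0 <= K) by (eapply Rle_trans; [apply Cmod_ge_0 | apply (HK x0); lra]).
    apply Cmod_le_0, le_epsilon. intros eps He. rewrite Rplus_0_l.
    rewrite Clim_infty in Hlim.
    destruct (Hlim (eps / (4 + 4 * K))) as [Y HY]; [apply Rdiv_lt_0_compat; lra|].
    set (e := eps / (4 + 4 * K)) in *.
    assert (He' : e * (4 + 4 * K) = eps) by (unfold e; field; lra).
    set (X := Rmax x0 Y + 1).
    assert (x0 <= X /\ Y < X) as [HX1 HX2].
    { unfold X. pose proof (Rmax_l x0 Y). pose proof (Rmax_r x0 Y). lra. }
    assert (Hwe : forall t, X <= t -> Cmod (w t) <= e).
    { intros t Ht. replace (w t) with (w t - RtoC 0)%C by ring. left; apply HY; lra. }
    (* (w V)' = 2 w V' - c, integrated over a unit interval far out *)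
    pose proof (Cmean_value (fun x => w x * V x + c * RtoC x)%C (fun x => 2 * (w x * V1 x))%C
      X (X + 1) (2 * (e * K)) ltac:(lra)) as A.
    assert (A' : Cmod (w (X + 1) * V (X + 1) + c * RtoC (X + 1) - (w X * V X + c * RtoC X))
       <= 2 * (2 * (e * K)) * (X + 1 - X)).
    { apply A.
      - intros t Ht.
        pose proof (cderiv_plus _ _ t _ _ (cderiv_mult _ _ t _ _ (Hw t) (DV t ltac:(lra)))
           (cderiv_mult _ _ t _ _ (cderiv_const c t) (cderiv_RtoC _ t _ (is_derive_id t)))) as D.
        eapply cderiv_val; [|exact D]. cbv beta. rewrite <- (HW t) by lra.
        unfold one; simpl. ring.
      - intros t Ht. rewrite !Cmod_mult, Cmod_R, Rabs_pos_eq by lra.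
        apply Rmult_le_compat_l; [lra|]. apply Rmult_le_compat; auto using Cmod_ge_0.
        + apply Hwe; lra.
        + apply HK; lra. }
    assert (BV : forall t, X <= t -> Cmod (w t * V t) <= e * 2).
    { intros t Ht. rewrite Cmod_mult. apply Rmult_le_compat; auto using Cmod_ge_0.
      eapply Rle_trans; [apply (wave_le s T t Hs' HTs); lra|].
      assert (exp (s * t) <= exp 0) by (apply exp_le_mono; nra). rewrite exp_0 in *; lra. }
    pose proof (BV X (Rle_refl X)) as E1. pose proof (BV (X + 1) ltac:(lra)) as E2.
    rewrite RtoC_plus in A'.
    replace c with ((w (X + 1)%R * V (X + 1)%R + c * (RtoC X + RtoC 1) - (w X * V X + c * RtoC X))
       + (w X * V X + - (w (X + 1)%R * V (X + 1)%R)))%C by ring.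
    eapply Rle_trans; [apply Cmod_triangle|].
    pose proof (Cmod_triangle (w X * V X) (- (w (X + 1)%R * V (X + 1)%R))%C) as E3.
    rewrite Cmod_opp in E3. lra. }
  (* With a zero Wronskian, the solution w U(x0) - w(x0) U has zero Cauchy data at x0, and
     uniqueness applies. *)
  intros x Hx. apply Ceq_minus.
  apply (ode_unique (fun x => w x * V x0 - w x0 * V x)%C (fun x => w1 x * V x0 - w x0 * V1 x)%C
    q (wavenum s * wavenum s)%C x0 x x0); try lra.
  - apply W.
  - intros t. pose proof (pr_q_ge1 _ _ _ _ _ _ _ _ _ W t). lra.
  - intros t Ht.
    pose proof (cderiv_minus _ _ t _ _ (cderiv_mult _ _ t _ _ (Hw t) (cderiv_const (V x0) t))
      (cderiv_mult _ _ t _ _ (cderiv_const (w x0) t) (DV t ltac:(lra)))) as D.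
    eapply cderiv_val; [|exact D]. cbv beta. ring.
  - intros t Ht.
    pose proof (cderiv_minus _ _ t _ _ (cderiv_mult _ _ t _ _ (Hw1 t) (cderiv_const (V x0) t))
      (cderiv_mult _ _ t _ _ (cderiv_const (w x0) t) (DV1 t ltac:(lra)))) as D.
    eapply cderiv_val; [|exact D]. cbv beta. ring.
  - ring.
  - transitivity (- c)%C; [unfold c; ring | rewrite Hc; ring].
Qed.

Lemma volterra_seq_lim sigma T T0 :
  (forall n, sigma n <= 0) -> is_lim_seq sigma 0 -> (forall n, volterra_sol (sigma n) (T n)) ->
  volterra_sol 0 T0 -> forall x, x0 <= x -> Cseq_lim (fun n => T n x) (T0 x).
Proof.
  intros Hs Hl HTs HT0 x Hx eps He.
  destruct (volterra_sol_lim W T0 HT0 (eps / 2) ltac:(lra)) as (d & Hd & HD).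
  apply is_lim_seq_spec in Hl. destruct (Hl (mkposreal d Hd)) as [n0 Hn0]. simpl in Hn0.
  exists n0. intros n Hn. specialize (Hn0 n Hn). specialize (Hs n).
  apply Rle_lt_trans with (eps / 2); [|lra]. apply (HD (sigma n)); auto.
  apply Rabs_def2 in Hn0. lra.
Qed.

Lemma wave_seq_lim sigma T T0 :
  (forall n, sigma n <= 0) -> is_lim_seq sigma 0 -> (forall n, volterra_sol (sigma n) (T n)) ->
  volterra_sol 0 T0 -> forall x, x0 <= x -> Cseq_lim (fun n => wave (sigma n) (T n) x) (wave 0 T0 x).
Proof.
  intros Hs Hl HTs HT0 x Hx.
  apply (Cseq_lim_ext (fun n => RtoC (b x) * osc (sigma n) (phi x) * T n x)%C _
     (RtoC (b x) * osc 0 (phi x) * T0 x)%C).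
  - intros n. symmetry. apply wave_eq; auto.
  - symmetry. apply wave_eq; auto; lra.
  - apply Cseq_lim_mult; [|apply (volterra_seq_lim sigma); auto].
    apply Cseq_lim_mult; [apply Cseq_lim_const | apply Cseq_lim_osc, Hl].
Qed.

(** At x0 the forward part vanishes, so B is determined by T(x0) - 1. Hence convergence of T at the
    single point x0 also yields convergence of U'(x0). *)
Lemma dwave_at_x0 s T : s <= 0 -> volterra_sol s T ->
  dwave s T x0 = (osc s (phi x0) *
    ((RtoC (b1 x0) - Ci * wavenum s * RtoC (/ b x0))
     + (RtoC (b1 x0) + Ci * wavenum s * RtoC (/ b x0)) * (T x0 - 1)))%C.
Proof.
  intros Hs [BT ET].
  assert (EA : Afun s T x0 = RtoC 0) by (unfold Afun; rewrite CInt_point; ring).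
  unfold dwave. rewrite ET by lra. unfold volterra. rewrite EA.
  replace (- phi x0) with (phi x0 + -2 * phi x0) by ring. rewrite osc_plus. ring.
Qed.

Lemma dwave_seq_lim sigma T T0 :
  (forall n, sigma n <= 0) -> is_lim_seq sigma 0 -> (forall n, volterra_sol (sigma n) (T n)) ->
  volterra_sol 0 T0 -> Cseq_lim (fun n => dwave (sigma n) (T n) x0) (dwave 0 T0 x0).
Proof.
  intros Hs Hl HTs HT0.
  eapply Cseq_lim_ext; [intros n; symmetry; apply dwave_at_x0; auto |
    symmetry; apply dwave_at_x0; auto; lra |].
  pose proof (Cseq_lim_wavenum sigma Hl) as Lk.
  apply Cseq_lim_mult; [apply Cseq_lim_osc, Hl|].
  assert (Lb : Cseq_lim (fun n => Ci * wavenum (sigma n) * RtoC (/ b x0))%C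
                 (Ci * wavenum 0 * RtoC (/ b x0))%C).
  { apply Cseq_lim_mult; [|apply Cseq_lim_const]. apply Cseq_lim_mult; [apply Cseq_lim_const|exact Lk]. }
  apply Cseq_lim_plus.
  - apply Cseq_lim_minus; [apply Cseq_lim_const | exact Lb].
  - apply Cseq_lim_mult; [apply Cseq_lim_plus; [apply Cseq_lim_const | exact Lb]|].
    apply Cseq_lim_minus; [apply (volterra_seq_lim sigma); auto; lra | apply Cseq_lim_const].
Qed.

End Wave.

(** * The profile (1 + theta x^alpha)^(-1/4) *)

Lemma pos_pow_nonneg x a : 0 <= pos_pow x a.
Proof. unfold pos_pow. destruct (Rlt_dec 0 x); [left; apply exp_pos | lra]. Qed.

Lemma pos_pow_pos x a : 0 < x -> pos_pow x a = exp (a * ln x).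
Proof. intros Hx. unfold pos_pow. destruct (Rlt_dec 0 x); [reflexivity | lra]. Qed.

Lemma continuous_pos_pow a x : 0 < a -> continuous (fun t => pos_pow t a) x.
Proof.
  intros Ha. destruct (Rtotal_order x 0) as [Hx|[->|Hx]].
  - apply (continuous_ext_loc _ (fun _ => 0)); [|apply continuous_const].
    exists (mkposreal (- x) ltac:(lra)). intros y Hy.
    change (Rabs (y - x) < - x) in Hy. apply Rabs_def2 in Hy.
    unfold pos_pow. destruct (Rlt_dec 0 y); lra.
  - apply filterlim_locally. intros eps.
    (* The radius solves r^a = eps. *)
    exists (mkposreal (Rpower eps (/ a)) (exp_pos _)). intros y Hy.
    change (Rabs (y - 0) < Rpower eps (/ a)) in Hy. rewrite Rminus_0_r in Hy.
    change (Rabs (pos_pow y a - pos_pow 0 a) < eps).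
    replace (pos_pow 0 a) with 0 by (unfold pos_pow; destruct (Rlt_dec 0 0); lra).
    rewrite Rminus_0_r, Rabs_pos_eq by apply pos_pow_nonneg.
    unfold pos_pow. destruct (Rlt_dec 0 y) as [Hy0|Hy0]; [|apply cond_pos].
    rewrite Rabs_pos_eq in Hy by lra.
    apply Rlt_le_trans with (Rpower (Rpower eps (/ a)) a).
    + apply Rlt_Rpower_l; lra.
    + rewrite Rpower_mult, Rinv_l, Rpower_1 by (try lra; apply cond_pos). lra.
  - apply (continuous_ext_loc _ (fun t => exp (a * ln t))).
    + exists (mkposreal x Hx). intros y Hy. change (Rabs (y - x) < x) in Hy. apply Rabs_def2 in Hy.
      symmetry; apply pos_pow_pos; lra.
    + apply (is_derive_continuous (fun t => exp (a * ln t)) x (exp (a * ln x) * (a * / x))).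
      auto_derive; auto. ring.
Qed.

Definition slowness2 (theta alpha x : R) : R := 1 + theta * pos_pow x alpha.

Lemma continuous_slowness2 theta alpha x : 0 < alpha -> continuous (slowness2 theta alpha) x.
Proof.
  intros Ha. apply (continuous_plus (V := R_NormedModule)); [apply continuous_const|].
  apply (continuous_scal_r (V := R_NormedModule)), continuous_pos_pow, Ha.
Qed.

Lemma slowness2_ge1 theta alpha x : 0 <= theta -> 1 <= slowness2 theta alpha x.
Proof. intros Ht. unfold slowness2. pose proof (pos_pow_nonneg x alpha). nra. Qed.

Lemma is_derive_phi theta alpha x : 0 < alpha -> 0 <= theta ->
  is_derive (phi theta alpha) x (sqrt (slowness2 theta alpha x)).
Proof.
  intros Ha Ht.
  assert (E : forall y, / c theta alpha y = sqrt (slowness2 theta alpha y)).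
  { intros y. unfold c. rewrite Rinv_inv. reflexivity. }
  rewrite <- E. apply (is_derive_RInt_cont (fun y => / c theta alpha y)).
  intros y. apply (continuous_ext (fun y => sqrt (slowness2 theta alpha y))); [intros; symmetry; apply E|].
  apply (continuous_comp (slowness2 theta alpha) sqrt).
  - apply continuous_slowness2, Ha.
  - apply continuous_sqrt.
Qed.

Lemma phi_ge theta alpha x : 0 < alpha -> 0 <= theta -> 0 <= x -> x <= phi theta alpha x.
Proof.
  intros Ha Ht Hx.
  destruct (MVT_gen (phi theta alpha) 0 x (fun t => sqrt (slowness2 theta alpha t))) as [t [_ E]].
  - intros; apply is_derive_phi; auto.
  - intros; eapply is_derive_continuity_pt, is_derive_phi; auto.
  - replace (phi theta alpha 0) with 0 in E
      by (symmetry; apply (RInt_point (V := R_CompleteNormedModule))).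
    assert (1 <= sqrt (slowness2 theta alpha t)).
    { rewrite <- sqrt_1. apply sqrt_le_1_alt, slowness2_ge1, Ht. }
    nra.
Qed.

Lemma b_Rpower theta alpha x : 0 <= theta -> b theta alpha x = Rpower (slowness2 theta alpha x) (- / 4).
Proof.
  intros Ht. pose proof (slowness2_ge1 theta alpha x Ht) as Hq. unfold b, c.
  fold (slowness2 theta alpha x).
  rewrite <- (Rpower_sqrt (slowness2 theta alpha x)) by lra.
  rewrite <- Rpower_Ropp, <- Rpower_sqrt by apply exp_pos.
  rewrite Rpower_mult. f_equal. field.
Qed.

Lemma b_pos theta alpha x : 0 <= theta -> 0 < b theta alpha x.
Proof. intros Ht. rewrite b_Rpower by exact Ht. apply exp_pos. Qed.

Lemma b_sq theta alpha x : 0 <= theta -> sqrt (slowness2 theta alpha x) = / (b theta alpha x ^ 2).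
Proof.
  intros Ht. pose proof (slowness2_ge1 theta alpha x Ht) as Hq. unfold b, c.
  fold (slowness2 theta alpha x).
  assert (0 < sqrt (slowness2 theta alpha x)) by (apply sqrt_lt_R0; lra).
  rewrite pow2_sqrt, Rinv_inv; [reflexivity|]. left; apply Rinv_0_lt_compat; auto.
Qed.

Lemma b_le1 theta alpha x : 0 <= theta -> b theta alpha x <= 1.
Proof.
  intros Ht. pose proof (b_sq theta alpha x Ht) as E. pose proof (b_pos theta alpha x Ht).
  assert (1 <= sqrt (slowness2 theta alpha x)).
  { rewrite <- sqrt_1. apply sqrt_le_1_alt, slowness2_ge1, Ht. }
  rewrite E in H0. assert (H1 : 0 < b theta alpha x ^ 2) by (apply pow_lt; auto).
  apply (Rmult_le_compat_l (b theta alpha x ^ 2)) in H0; [|lra]. rewrite Rinv_r in H0 by lra. nra.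
Qed.

(* With z = theta x^alpha and s = z / (1 + z) one has b' = - (alpha/4) b s / x
   and s' = alpha s (1 - s) / x. *)
Definition sat (theta alpha x : R) : R :=
  theta * exp (alpha * ln x) / (1 + theta * exp (alpha * ln x)).

Definition db (theta alpha x : R) : R :=
  - (alpha / 4) * (b theta alpha x * (sat theta alpha x / x)).

Definition ddb (theta alpha x : R) : R :=
  - (alpha / 4) * (db theta alpha x * (sat theta alpha x / x)
    + b theta alpha x *
      ((alpha * sat theta alpha x * (1 - sat theta alpha x) - sat theta alpha x) / x ^ 2)).

Lemma sat_bounds theta alpha x : 0 < theta -> 0 < sat theta alpha x < 1.
Proof.
  intros Ht. unfold sat. assert (0 < theta * exp (alpha * ln x)) by (apply Rmult_lt_0_compat; auto using exp_pos).
  split; [apply Rdiv_lt_0_compat; lra|].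
  apply (Rmult_lt_reg_r (1 + theta * exp (alpha * ln x))); [lra|].
  unfold Rdiv. rewrite Rmult_assoc, Rinv_l by lra. lra.
Qed.

Lemma locally_pos x : 0 < x -> locally x (fun y => 0 < y).
Proof.
  intros Hx. exists (mkposreal x Hx). intros y Hy. change (Rabs (y - x) < x) in Hy.
  apply Rabs_def2 in Hy. lra.
Qed.

Lemma is_derive_b theta alpha x : 0 < theta -> 0 < x ->
  is_derive (b theta alpha) x (db theta alpha x).
Proof.
  intros Ht Hx.
  assert (E : forall y, 0 < y -> exp (- / 4 * ln (1 + theta * exp (alpha * ln y))) = b theta alpha y).
  { intros y Hy. rewrite b_Rpower by lra. unfold Rpower, slowness2. rewrite pos_pow_pos by exact Hy.
    reflexivity. }
  apply (is_derive_ext_loc (fun y => exp (- / 4 * ln (1 + theta * exp (alpha * ln y))))).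
  { generalize (locally_pos x Hx). apply filter_imp. exact E. }
  unfold db, sat. rewrite <- E by exact Hx.
  assert (0 < theta * exp (alpha * ln x)) by (apply Rmult_lt_0_compat; auto using exp_pos).
  auto_derive; [repeat split; lra|]. field. split; lra.
Qed.

Lemma is_derive_sat_div theta alpha x : 0 < theta -> 0 < x ->
  is_derive (fun y => sat theta alpha y / y) x
    ((alpha * sat theta alpha x * (1 - sat theta alpha x) - sat theta alpha x) / x ^ 2).
Proof.
  intros Ht Hx. unfold sat.
  assert (0 < theta * exp (alpha * ln x)) by (apply Rmult_lt_0_compat; auto using exp_pos).
  auto_derive; [repeat split; lra|]. field. split; lra.
Qed.

Lemma is_derive_db theta alpha x : 0 < theta -> 0 < x ->
  is_derive (db theta alpha) x (ddb theta alpha x).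
Proof.
  intros Ht Hx. unfold db at 1, ddb.
  apply (is_derive_scal (fun y => b theta alpha y * (sat theta alpha y / y)) x (- (alpha / 4))).
  apply (is_derive_Rmult (b theta alpha) (fun y => sat theta alpha y / y));
    [apply is_derive_b | apply is_derive_sat_div]; auto.
Qed.

Lemma M_eq theta alpha x : 0 < theta -> 0 < x ->
  M theta alpha x = b theta alpha x * ddb theta alpha x.
Proof.
  intros Ht Hx. unfold M. f_equal. simpl.
  rewrite (Derive_ext_loc _ (db theta alpha)).
  - apply is_derive_unique, is_derive_db; auto.
  - generalize (locally_pos x Hx). apply filter_imp. intros y Hy.
    apply is_derive_unique, is_derive_b; auto.
Qed.

Lemma continuous_sat theta alpha x : 0 < theta -> 0 < x -> continuous (sat theta alpha) x.
Proof.
  intros Ht Hx.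
  apply (is_derive_continuous _ x (alpha * sat theta alpha x * (1 - sat theta alpha x) / x)).
  unfold sat.
  assert (0 < theta * exp (alpha * ln x)) by (apply Rmult_lt_0_compat; auto using exp_pos).
  auto_derive; [repeat split; lra|]. field. split; lra.
Qed.

Lemma continuous_b_ddb theta alpha x : 0 < theta -> 0 < x ->
  continuous (fun y => b theta alpha y * ddb theta alpha y) x.
Proof.
  intros Ht Hx.
  assert (Cb : continuous (b theta alpha) x) by (eapply is_derive_continuous, is_derive_b; auto).
  assert (Cs : continuous (sat theta alpha) x) by (apply continuous_sat; auto).
  apply (continuous_mult (K := R_AbsRing) (b theta alpha) (ddb theta alpha)); [exact Cb|].
  unfold ddb.
  apply (continuous_scal_r (V := R_NormedModule) (- (alpha / 4))
    (fun y => db theta alpha y * (sat theta alpha y / y) + b theta alpha y *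
      ((alpha * sat theta alpha y * (1 - sat theta alpha y) - sat theta alpha y) / y ^ 2))).
  apply (continuous_plus (V := R_NormedModule)
    (fun y => db theta alpha y * (sat theta alpha y / y)) (fun y => b theta alpha y *
      ((alpha * sat theta alpha y * (1 - sat theta alpha y) - sat theta alpha y) / y ^ 2))).
  - apply (continuous_mult (K := R_AbsRing) (db theta alpha) (fun y => sat theta alpha y / y)).
    + eapply is_derive_continuous, is_derive_db; auto.
    + eapply is_derive_continuous, is_derive_sat_div; auto.
  - apply (continuous_mult (K := R_AbsRing) (b theta alpha)); [exact Cb|].
    apply (continuous_mult (K := R_AbsRing)
      (fun y => alpha * sat theta alpha y * (1 - sat theta alpha y) - sat theta alpha y) (fun y => / y ^ 2)).
    + apply (continuous_comp (sat theta alpha) (fun s => alpha * s * (1 - s) - s)); [exact Cs|].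
      apply (is_derive_continuous _ _ (alpha * (1 - sat theta alpha x) - alpha * sat theta alpha x - 1)).
      auto_derive; auto. ring.
    + apply (is_derive_continuous (fun y => / y ^ 2) x (- (2 * x) / (x ^ 2) ^ 2)).
      auto_derive; [nra|]. field. lra.
Qed.

Lemma b_ddb_le theta alpha x : 0 < theta -> 0 < alpha -> 0 < x ->
  Rabs (b theta alpha x * ddb theta alpha x)
    <= alpha / 4 * (1 + 2 * alpha) * (sat theta alpha x / x ^ 2).
Proof.
  intros Ht Ha Hx.
  pose proof (sat_bounds theta alpha x Ht) as Hs. pose proof (b_pos theta alpha x (Rlt_le _ _ Ht)) as Hb.
  pose proof (b_le1 theta alpha x (Rlt_le _ _ Ht)) as Hb1.
  unfold ddb, db. set (s := sat theta alpha x) in *. set (bb := b theta alpha x) in *.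
  (* The common factor s/x^2 is pulled out of b b''; what remains is b^2 <= 1 times a bracket affine
     in s, crudely bounded by 1 + 2 alpha for s in (0, 1). *)
  replace (bb * (- (alpha / 4) * (- (alpha / 4) * (bb * (s / x)) * (s / x)
     + bb * ((alpha * s * (1 - s) - s) / x ^ 2))))
    with ((alpha / 4 * (s / x ^ 2)) * (bb ^ 2 * (1 + alpha / 4 * s - alpha * (1 - s)))) by (field; lra).
  assert (Px : 0 < x ^ 2) by (apply pow_lt, Hx).
  assert (0 <= alpha / 4 * (s / x ^ 2)).
  { apply Rmult_le_pos; [lra|]. apply Rdiv_le_0_compat; lra. }
  rewrite Rabs_mult, Rabs_pos_eq by assumption.
  replace (alpha / 4 * (1 + 2 * alpha) * (s / x ^ 2))
    with (alpha / 4 * (s / x ^ 2) * (1 + 2 * alpha)) by ring.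
  apply Rmult_le_compat_l; [assumption|].
  rewrite Rabs_mult, Rabs_pos_eq by apply pow2_ge_0.
  assert (bb ^ 2 <= 1) by nra.
  assert (Rabs (1 + alpha / 4 * s - alpha * (1 - s)) <= 1 + 2 * alpha) by (apply Rabs_le; nra).
  pose proof (Rabs_pos (1 + alpha / 4 * s - alpha * (1 - s))). pose proof (pow2_ge_0 bb). nra.
Qed.

(** Interpolation: z/(1+z) <= min(1, z) <= z^delta. The bound by 1 makes s/x^2 integrable but not
    small; the bound by z is small in theta but too large at infinity when alpha >= 1. A power in
    between gives both. *)
Lemma sat_le_power theta alpha delta x : 0 < theta -> 0 < x -> 0 < delta <= 1 ->
  sat theta alpha x <= Rpower theta delta * Rpower x (alpha * delta).
Proof.
  intros Ht Hx Hd. pose proof (sat_bounds theta alpha x Ht) as Hs.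
  rewrite <- Rpower_mult, Rpower_mult_distr by (auto; apply exp_pos).
  fold (Rpower x alpha) in *. unfold sat in *. fold (Rpower x alpha) in *.
  set (z := theta * Rpower x alpha) in *.
  assert (Hz : 0 < z) by (apply Rmult_lt_0_compat; auto; apply exp_pos).
  destruct (Rle_dec 1 z) as [Hz1|Hz1].
  - apply Rle_trans with 1; [lra|]. rewrite <- (Rpower_O z Hz).
    apply Rle_Rpower; lra.
  - apply Rle_trans with z.
    + apply (Rmult_le_reg_r (1 + z)); [lra|]. unfold Rdiv. rewrite Rmult_assoc, Rinv_l by lra. nra.
    + rewrite <- (Rpower_1 z Hz) at 1. unfold Rpower. apply exp_le_mono.
      assert (ln z <= 0) by (rewrite <- ln_1; left; apply ln_increasing; lra). nra.
Qed.

Lemma is_derive_Rpower a x : 0 < x -> is_derive (fun t => Rpower t a) x (a * Rpower x (a - 1)).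
Proof. intros Hx. apply is_derive_Reals, derivable_pt_lim_power, Hx. Qed.

Lemma power_tail K delta x0 : 0 <= K -> 0 < delta -> 0 < x0 ->
  tail_of (fun x => K * Rpower x (- delta - 1)) (fun x => K / delta * Rpower x (- delta)) x0.
Proof.
  intros HK Hd Hx0.
  assert (HKd : 0 <= K / delta) by (apply Rdiv_le_0_compat; lra).
  refine (conj _ (conj _ (conj _ (conj _ _)))).
  - intros y Hy. eapply is_derive_val; [|apply is_derive_scal, is_derive_Rpower; lra].
    field. lra.
  - intros y Hy. apply (continuous_scal_r (V := R_NormedModule) K (fun x => Rpower x (- delta - 1))).
    eapply is_derive_continuous, is_derive_Rpower; lra.
  - intros y Hy. apply Rmult_le_pos; [exact HK | left; apply exp_pos].
  - intros y Hy. apply Rmult_le_pos; [exact HKd | left; apply exp_pos].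
  - apply is_lim_spec. intros eps.
    set (A := (K / delta + 1) / eps).
    assert (HA : 0 < A) by (apply Rdiv_lt_0_compat; [lra | apply cond_pos]).
    exists (Rpower A (/ delta)). intros x Hx.
    assert (Hx' : 0 < x) by (eapply Rlt_trans; [apply exp_pos | exact Hx]).
    assert (HAx : A < Rpower x delta).
    { apply Rle_lt_trans with (Rpower (Rpower A (/ delta)) delta).
      - rewrite Rpower_mult, Rinv_l, Rpower_1 by lra. lra.
      - apply Rlt_Rpower_l; auto. split; [apply exp_pos | exact Hx]. }
    rewrite Rminus_0_r, Rabs_pos_eq by (apply Rmult_le_pos; [exact HKd | left; apply exp_pos]).
    rewrite Rpower_Ropp. set (p := Rpower x delta) in *.
    apply (Rmult_lt_reg_r p); [lra|]. rewrite Rmult_assoc, Rinv_l by lra.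
    apply Rlt_le_trans with (eps * A).
    + unfold A. pose proof (cond_pos eps). replace (eps * ((K / delta + 1) / eps)) with (K / delta + 1) by (field; lra). lra.
    + apply Rmult_le_compat_l; [left; apply cond_pos | lra].
Qed.

(** The maximum is at a = alpha/(-s); the bound comes from ln(x/a) <= x/a, multiplied by alpha. *)
Lemma power_exp_bounded alpha s : 0 < alpha -> s < 0 ->
  exists B, forall x, 0 < x -> Rpower x alpha * exp (s * x) <= B.
Proof.
  intros Ha Hs. set (a := alpha / - s). assert (Pa : 0 < a) by (apply Rdiv_lt_0_compat; lra).
  exists (exp (alpha * ln a)). intros x Hx. unfold Rpower. rewrite <- exp_plus. apply exp_le_mono.
  assert (L : ln x - ln a <= x / a).
  { rewrite <- ln_div by auto. assert (Hxa : 0 < x / a) by (apply Rdiv_lt_0_compat; auto).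
    pose proof (exp_ineq1_le (ln (x / a))) as E. rewrite exp_ln in E by exact Hxa. lra. }
  apply (Rmult_le_compat_l alpha) in L; [|lra].
  replace (alpha * (x / a)) with (- s * x) in L by (unfold a; field; split; lra). lra.
Qed.

Lemma profile_exists alpha x0 : 0 < alpha -> 0 < x0 ->
  exists theta0, 0 < theta0 /\ forall theta, 0 < theta < theta0 ->
  exists N h H,
    profile x0 (slowness2 theta alpha) (b theta alpha) (db theta alpha) (ddb theta alpha)
      (phi theta alpha) N h H /\
    forall x, x0 <= x -> M theta alpha x = N x.
Proof.
  intros Ha Hx0.
  (* Chosen so that alpha delta - 2 = -1 - delta: the majorant of |M| is then K x^(-1-delta), with
     tail (K/delta) x^(-delta). *)
  set (delta := / (1 + alpha)).
  assert (Hd : 0 < delta <= 1).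
  { unfold delta. split; [apply Rinv_0_lt_compat; lra|].
    rewrite <- Rinv_1. apply Rinv_le_contravar; lra. }
  set (K0 := alpha / 4 * (1 + 2 * alpha)).
  assert (HK0 : 0 < K0) by (apply Rmult_lt_0_compat; lra).
  (* The value of theta^delta for which the tail of the majorant at x0 is exactly 1/2. *)
  set (kap := delta / (2 * K0) * Rpower x0 delta).
  assert (Hkap : 0 < kap).
  { apply Rmult_lt_0_compat; [apply Rdiv_lt_0_compat; lra | apply exp_pos]. }
  exists (Rpower kap (/ delta)). split; [apply exp_pos|].
  intros theta [Ht Ht0].
  assert (Htd : Rpower theta delta < kap).
  { apply Rlt_le_trans with (Rpower (Rpower kap (/ delta)) delta).
    - apply Rlt_Rpower_l; lra.
    - rewrite Rpower_mult, Rinv_l, Rpower_1 by lra. lra. }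
  set (K := K0 * Rpower theta delta).
  assert (HK : 0 <= K) by (apply Rmult_le_pos; [lra | left; apply exp_pos]).
  (* Freezing b b'' to the left of x0 keeps away from 0, where b may fail to be twice
     differentiable, and gives a function continuous on the whole line. *)
  exists (fun x => b theta alpha (Rmax x0 x) * ddb theta alpha (Rmax x0 x)),
    (fun x => K * Rpower x (- delta - 1)), (fun x => K / delta * Rpower x (- delta)).
  assert (Ht' : 0 <= theta) by lra.
  split; [constructor|].
  - exact Hx0.
  - intros; apply continuous_slowness2, Ha.
  - intros; apply slowness2_ge1, Ht'.
  - intros; apply is_derive_phi; auto.
  - intros; apply is_derive_b; auto.
  - intros; apply is_derive_db; auto.
  - intros; apply b_pos, Ht'.
  - intros; apply b_sq, Ht'.
  - exists (alpha / 4 * / x0). intros x Hx. unfold db.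
    pose proof (sat_bounds theta alpha x Ht). pose proof (b_pos theta alpha x Ht').
    pose proof (b_le1 theta alpha x Ht').
    rewrite Rabs_mult, Rabs_Ropp, (Rabs_pos_eq (alpha / 4)) by lra.
    apply Rmult_le_compat_l; [lra|]. unfold Rdiv.
    assert (0 < / x) by (apply Rinv_0_lt_compat; lra).
    assert (/ x <= / x0) by (apply Rinv_le_contravar; lra).
    rewrite Rabs_pos_eq by (apply Rmult_le_pos; [lra | apply Rmult_le_pos; lra]).
    rewrite <- Rmult_assoc.
    apply Rle_trans with (1 * / x); [|lra]. apply Rmult_le_compat_r; [lra|]. nra.
  - intros x. apply (continuous_comp (fun x => Rmax x0 x) (fun y => b theta alpha y * ddb theta alpha y)).
    + apply continuous_Rmax.
    + apply continuous_b_ddb; auto. pose proof (Rmax_l x0 x). lra.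
  - intros x Hx. rewrite Rmax_right by exact Hx. reflexivity.
  - intros x Hx. rewrite Rmax_right by exact Hx. assert (Hx' : 0 < x) by lra.
    eapply Rle_trans; [apply b_ddb_le; auto|]. fold K0. unfold K. rewrite Rmult_assoc.
    apply Rmult_le_compat_l; [lra|].
    replace (- delta - 1) with (alpha * delta + - (2)) by (unfold delta; field; lra).
    rewrite Rpower_plus, (Rpower_Ropp x 2).
    replace (Rpower x 2) with (x ^ 2) by (rewrite <- (Rpower_pow 2 x Hx'); f_equal; simpl; ring).
    rewrite <- Rmult_assoc. apply Rmult_le_compat_r.
    + left; apply Rinv_0_lt_compat, pow_lt, Hx'.
    + apply sat_le_power; auto.
  - apply power_tail; lra.
  - unfold K. rewrite Rpower_Ropp. set (p := Rpower x0 delta) in *.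
    assert (Pp : 0 < p) by apply exp_pos.
    replace (1 / 2) with (K0 * kap / delta * / p) by (unfold kap; field; lra).
    unfold Rdiv. apply Rmult_le_compat_r; [left; apply Rinv_0_lt_compat, Pp|].
    apply Rmult_le_compat_r; [left; apply Rinv_0_lt_compat; lra|].
    apply Rmult_le_compat_l; lra.
  - intros x Hx. apply phi_ge; lra.
  - intros s Hs. destruct (power_exp_bounded alpha s Ha Hs) as [B HB].
    exists (1 + theta * B). intros x Hx. assert (Hx' : 0 < x) by lra.
    pose proof (b_pos theta alpha x Ht') as Hb. pose proof (b_sq theta alpha x Ht') as E.
    pose proof (b_le1 theta alpha x Ht') as Hb1.
    pose proof (slowness2_ge1 theta alpha x Ht') as Hq.
    (* Indeed q = b^(-4) and b <= 1. This crude bound is enough, since q exp(s x) is bounded for s <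
       0. *)
    assert (I1 : / b theta alpha x <= slowness2 theta alpha x).
    { rewrite <- (sqrt_sqrt (slowness2 theta alpha x)), E by lra.
      set (bb := b theta alpha x) in *.
      replace (/ bb ^ 2 * / bb ^ 2) with (/ (bb ^ 4)) by (field; lra).
      apply Rinv_le_contravar; [apply pow_lt, Hb|].
      assert (bb ^ 3 <= 1) by (rewrite <- (pow1 3); apply pow_incr; lra).
      replace (bb ^ 4) with (bb * bb ^ 3) by ring. nra. }
    assert (I2 : exp (s * phi theta alpha x) <= exp (s * x)).
    { apply exp_le_mono. pose proof (phi_ge theta alpha x Ha Ht' (Rlt_le _ _ Hx')). nra. }
    apply Rle_trans with (slowness2 theta alpha x * exp (s * x)).
    { apply Rmult_le_compat; auto; [left; apply Rinv_0_lt_compat, Hb | left; apply exp_pos]. }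
    unfold slowness2. rewrite pos_pow_pos by exact Hx'. fold (Rpower x alpha).
    specialize (HB x Hx').
    assert (exp (s * x) <= 1) by (rewrite <- exp_0; apply exp_le_mono; nra).
    rewrite Rmult_plus_distr_r, Rmult_1_l, Rmult_assoc.
    apply Rplus_le_compat; [assumption | apply Rmult_le_compat_l; lra].
  - intros x Hx. rewrite Rmax_right by exact Hx. apply M_eq; lra.
Qed.

(** * Outgoing solutions *)

(** Continuity is asked of g only, so f may be an integrand built on [M], about which nothing is
    known to the left of p. *)
Lemma CInt_infty_ext (f g : R -> C) h H p c :
  (forall x, ccont g x) -> tail_of h H p -> 0 <= c ->
  (forall y, p <= y -> Cmod (g y) <= c * h y) ->
  (forall y, p < y -> f y = g y) -> CInt_infty f p = CInt_infty g p.
Proof.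
  intros Cg T Hc Hg E.
  assert (E' : forall X, p < X -> forall y, Rmin p X < y < Rmax p X -> g y = f y).
  { intros X HX y. rewrite Rmin_left by lra. intros Hy. symmetry; apply E; lra. }
  apply CInt_infty_unique.
  - intros X HX. apply (ex_RInt_ext (V := C_R_NormedModule) g); [exact (E' X HX)|].
    exists (CInt g p X). apply CInt_correct, Cg.
  - pose proof (CInt_infty_lim g h H p c Cg T Hc Hg) as L.
    rewrite Clim_infty in L |- *. intros eps He. destruct (L eps He) as [Y HY].
    exists (Rmax p Y). intros X HX. pose proof (Rmax_l p Y). pose proof (Rmax_r p Y).
    rewrite <- (CInt_ext g f p X) by (apply E'; lra). apply HY; lra.
Qed.

Lemma cis_plus s t : cis (s + t) = (cis s * cis t)%C.
Proof. unfold cis. rewrite cos_plus, sin_plus. apply C_ext; simpl; ring. Qed.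

Lemma cis_0 : cis 0 = RtoC 1.
Proof. unfold cis. rewrite cos_0, sin_0. reflexivity. Qed.

Lemma wavenum_0 : wavenum 0 = RtoC 1.
Proof. unfold wavenum. ring. Qed.

Lemma green_coef_0 : green_coef 0 = (/ (2 * Ci))%C.
Proof. unfold green_coef. rewrite wavenum_0. f_equal. ring. Qed.

Lemma Cseq_lim_wavenum_sq sigma : is_lim_seq sigma 0 ->
  Cseq_lim (fun n => wavenum (sigma n) * wavenum (sigma n))%C (RtoC 1).
Proof.
  intros Hs. apply (Cseq_lim_ext (fun n => wavenum (sigma n) * wavenum (sigma n))%C _ (wavenum 0 * wavenum 0)%C); auto.
  - rewrite wavenum_0. ring.
  - apply Cseq_lim_mult; apply Cseq_lim_wavenum, Hs.
Qed.

Lemma slowness2_eq theta alpha x : 0 <= theta -> / c theta alpha x ^ 2 = slowness2 theta alpha x.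
Proof.
  intros Ht. pose proof (slowness2_ge1 theta alpha x Ht). unfold c. fold (slowness2 theta alpha x).
  rewrite pow_inv, Rinv_inv, pow2_sqrt; lra.
Qed.

(** A first order system with an explicit derivative function, the form that the wave and Gronwall
    lemmas consume. *)
Lemma solution_iff theta alpha k u : 0 <= theta ->
  (solution theta alpha k u <->
   exists u1 : R -> C, forall x, cderiv u x (u1 x) /\
     cderiv u1 x (- (k * k * RtoC (slowness2 theta alpha x) * u x))%C).
Proof.
  intros Ht. split.
  - intros Hu. exists (CDerive u). intros x. destruct (Hu x) as (A & B & E).
    split; [apply cderiv_CDerive, A|]. eapply cderiv_val; [|apply cderiv_CDerive, B].
    rewrite <- slowness2_eq by exact Ht.
    transitivity (CDerive (CDerive u) x + k * k * RtoC (/ c theta alpha x ^ 2) * u x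
      - k * k * RtoC (/ c theta alpha x ^ 2) * u x)%C; [ring|]. rewrite E. ring.
  - intros [u1 Hu] x.
    assert (E1 : forall t, u1 t = CDerive u t) by (intros; symmetry; apply CDerive_unique, Hu).
    destruct (Hu x) as [A B]. apply (cderiv_ext _ (CDerive u) _ _ E1) in B.
    split; [eexists; exact A|]. split; [eexists; exact B|].
    rewrite (CDerive_unique _ _ _ B), slowness2_eq by exact Ht. ring.
Qed.

(** Proportionality of u and U is known only on [x0, +oo). Since the two-sided derivative at x0
    exists, quotients from the right determine it. *)
Lemma right_derivative_zero (z : R -> C) x0 l :
  (forall x, x0 <= x -> z x = RtoC 0) -> cderiv z x0 l -> l = RtoC 0.
Proof.
  intros Hz Hl. apply cderiv_pair in Hl as [H1 H2].
  assert (K : forall (p : R -> R) m, (forall x, x0 <= x -> p x = 0) -> is_derive p x0 m -> m = 0).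
  { intros p m Hp Hm. apply is_derive_Reals in Hm.
    destruct (Req_dec m 0) as [E|E]; [exact E|exfalso].
    destruct (Hm (Rabs m) (Rabs_pos_lt _ E)) as [d Hd].
    pose proof (cond_pos d) as Pd.
    specialize (Hd (d / 2) ltac:(lra) ltac:(rewrite Rabs_pos_eq; lra)).
    rewrite (Hp (x0 + d / 2)), (Hp x0) in Hd by lra.
    replace ((0 - 0) / (d / 2) - m) with (- m) in Hd by (field; lra).
    rewrite Rabs_Ropp in Hd. lra. }
  apply C_ext; simpl.
  - apply (K (fun t => fst (z t))); auto. intros x Hx. rewrite Hz by exact Hx. reflexivity.
  - apply (K (fun t => snd (z t))); auto. intros x Hx. rewrite Hz by exact Hx. reflexivity.
Qed.

(** * From S to the wave at sigma = 0, and the equivalence at x0 *)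

Section Scattering.

Context {theta alpha x0 : R} {N h H : R -> R}.
Context (Htheta : 0 <= theta).
Context (W : profile x0 (slowness2 theta alpha) (b theta alpha) (db theta alpha) (ddb theta alpha)
               (phi theta alpha) N h H).
Context (HM : forall x, x0 <= x -> M theta alpha x = N x).

Let q := slowness2 theta alpha.
Let Hx0 := pr_x0 _ _ _ _ _ _ _ _ _ W.
Let HT := pr_tail _ _ _ _ _ _ _ _ _ W.

Notation volterra_sol := (@volterra_sol x0 (phi theta alpha) N).
Notation Bfun := (@Bfun x0 (phi theta alpha) N).
Notation wave := (@wave x0 (b theta alpha) (phi theta alpha) N).
Notation dwave := (@dwave x0 (b theta alpha) (db theta alpha) (phi theta alpha) N).
Notation phi := (phi theta alpha).

Lemma q_cont x : continuous q x.
Proof. apply W. Qed.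

Lemma q_nonneg x : 0 <= q x.
Proof. pose proof (pr_q_ge1 _ _ _ _ _ _ _ _ _ W x). unfold q. lra. Qed.

(* The normalisation T = S exp(2 i phi) turns the equation for S into the Volterra equation
   at sigma = 0. *)
Lemma tail_integral_S (S T : R -> C) : bounded_cont T ->
  (forall x, x0 <= x -> T x = S x * cis (2 * phi x))%C -> forall x, x0 <= x ->
  CInt_infty (fun y => RtoC (M theta alpha y) * S y)%C x = CInt_infty (bwd (phi:=phi) (N:=N) 0 T) x.
Proof.
  intros BT ETS x Hx. pose proof (bounded_cont_pos T BT) as (CT & B & HB & HBT).
  apply (CInt_infty_ext _ _ h H x (B * exp (2 * 0 * phi x))).
  - apply (ccont_bwd W), CT.
  - apply (tail_of_le _ _ x0); auto.
  - apply Rmult_le_pos; auto. left; apply exp_pos.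
  - apply (bwd_le W); auto. lra.
  - intros y Hy. unfold bwd. rewrite HM, ETS, osc_sigma0 by lra.
    transitivity (RtoC (N y) * S y * cis (2 * phi y + - (2 * phi y)))%C.
    + rewrite Rplus_opp_r, cis_0. ring.
    + rewrite cis_plus. ring.
Qed.

(** Multiplication by exp(2i phi) moves the phase from the forward kernel to the backward one. Only
    the relation between S and T is assumed, not an equation for either, so the identity serves both
    to pass from S to T and to construct S. *)
Lemma S_rhs (S T : R -> C) : bounded_cont T ->
  (forall x, x0 <= x -> T x = S x * cis (2 * phi x))%C -> forall x, x0 <= x ->
  (cis (- 2 * phi x) + / (2 * Ci) *
     (CInt (fun y => RtoC (M theta alpha y) * S y * cis (- 2 * (phi x - phi y))) x0 x
      + CInt_infty (fun y => RtoC (M theta alpha y) * S y) x)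
   = cis (- 2 * phi x) * volterra (x0:=x0) (phi:=phi) (N:=N) 0 T x)%C.
Proof.
  intros BT ETS x Hx. rewrite (tail_integral_S S T BT ETS x Hx).
  assert (E : CInt (fun y => RtoC (M theta alpha y) * S y * cis (- 2 * (phi x - phi y)))%C x0 x
     = (cis (- 2 * phi x) * CInt (fwd (N:=N) T) x0 x)%C).
  { rewrite <- CInt_scal by apply (ccont_fwd W), BT.
    apply CInt_ext. intros y Hy. rewrite Rmin_left in Hy by lra.
    unfold fwd. rewrite HM, ETS by lra.
    replace (- 2 * (phi x - phi y)) with (- 2 * phi x + 2 * phi y) by ring.
    rewrite cis_plus. ring. }
  rewrite E. unfold volterra. rewrite (Bfun_infty W) by (auto; lra). unfold Afun.
  rewrite green_coef_0, osc_sigma0.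
  assert (E1 : (cis (- 2 * phi x) * cis (- (- 2 * phi x)))%C = RtoC 1).
  { rewrite <- cis_plus, Rplus_opp_r. apply cis_0. }
  transitivity (cis (- 2 * phi x) + / (2 * Ci) * (cis (- 2 * phi x) * CInt (fwd (N:=N) T) x0 x
     + (cis (- 2 * phi x) * cis (- (- 2 * phi x))) * CInt_infty (bwd (phi:=phi) (N:=N) 0 T) x))%C.
  - rewrite E1. ring.
  - ring.
Qed.

Lemma cis_shift_phi S x : (S * cis (2 * phi x) * cis (- 2 * phi x))%C = S.
Proof.
  transitivity (S * cis (2 * phi x + - 2 * phi x))%C; [rewrite cis_plus; ring|].
  replace (2 * phi x + - 2 * phi x) with 0 by ring. rewrite cis_0. ring.
Qed.

Lemma ccont_cis_phi k x : ccont (fun x => cis (k * phi x)) x.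
Proof.
  apply (ccont_ext (fun x => osc 0 (- k * phi x))).
  - intros t. rewrite osc_sigma0. f_equal. ring.
  - apply (ccont_osc_phi W).
Qed.

Lemma is_S_gt_volterra S : is_S_gt theta alpha x0 S ->
  exists T, volterra_sol 0 T /\ forall x, x0 <= x -> T x = (S x * cis (2 * phi x))%C.
Proof.
  intros ([B HB] & HC & ES).
  (* S is known to be continuous only within [x0, +oo); freezing it at x0 on the left makes T
     continuous on the whole line. *)
  set (T := fun x => (S (Rmax x0 x) * cis (2 * phi (Rmax x0 x)))%C).
  assert (ETS : forall x, x0 <= x -> T x = (S x * cis (2 * phi x))%C).
  { intros x Hx. unfold T. rewrite Rmax_right by exact Hx. reflexivity. }
  assert (BT : bounded_cont T).
  { split.
    - intros x. unfold T. apply ccont_mult.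
      + apply (filterlim_comp _ _ _ (fun x => Rmax x0 x) S _
          (within (fun y => x0 <= y) (locally (Rmax x0 x)))); [|apply HC, Rmax_l].
        intros P HP. unfold within in HP. apply (continuous_Rmax x0 x) in HP.
        unfold filtermap in *. revert HP. apply filter_imp. intros y Hy. apply Hy, Rmax_l.
      + apply (ccont_comp (fun x => cis (2 * phi x)) (fun x => Rmax x0 x));
          [apply continuous_Rmax | apply ccont_cis_phi].
    - exists B. intros x. unfold T. rewrite Cmod_mult, Cmod_cis, Rmult_1_r. apply HB, Rmax_l. }
  exists T. split; [|exact ETS]. split; [exact BT|].
  intros x Hx. rewrite ETS, ES by exact Hx. rewrite (S_rhs S T BT ETS x Hx).
  rewrite <- (cis_shift_phi (volterra 0 T x) x) at 2. ring.
Qed.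

Lemma is_S_gt_exists : exists S, is_S_gt theta alpha x0 S.
Proof.
  destruct (volterra_sol_exists W 0 (Rle_refl 0)) as [T [BT ET]].
  set (S := fun x => (T x * cis (- 2 * phi x))%C).
  assert (ETS : forall x, x0 <= x -> T x = (S x * cis (2 * phi x))%C).
  { intros x _. unfold S. rewrite <- (cis_shift_phi (T x) x) at 1. ring. }
  exists S. split; [|split].
  - destruct BT as [_ [B HB]]. exists B. intros x _. unfold S. rewrite Cmod_mult, Cmod_cis, Rmult_1_r. apply HB.
  - intros x Hx P HP.
    assert (A : ccont S x) by (apply ccont_mult; [apply BT | apply ccont_cis_phi]).
    apply A in HP. unfold filtermap, within in *. revert HP. apply filter_imp. auto.
  - intros x Hx. rewrite (S_rhs S T BT ETS x Hx). rewrite <- ET by exact Hx. unfold S. ring.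
Qed.

Lemma reflection_eq S T : bounded_cont T ->
  (forall x, x0 <= x -> T x = (S x * cis (2 * phi x))%C) ->
  reflection theta alpha x0 S = Bfun 0 T x0.
Proof.
  intros BT ETS. unfold reflection. rewrite (tail_integral_S S T BT ETS x0 (Rle_refl x0)).
  rewrite (Bfun_infty W) by (auto; lra). rewrite green_coef_0. reflexivity.
Qed.

Lemma Afun_x0 s T : Afun (x0:=x0) (N:=N) s T x0 = RtoC 0.
Proof. unfold Afun. rewrite CInt_point. ring. Qed.

Lemma v_gt_eq x : v_gt theta alpha x = (RtoC (b theta alpha x) * osc 0 (phi x))%C.
Proof. unfold v_gt. rewrite osc_sigma0. reflexivity. Qed.

Lemma v_lt_eq x : v_lt theta alpha x = (RtoC (b theta alpha x) * osc 0 (- phi x))%C.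
Proof. unfold v_lt. rewrite osc_sigma0, Ropp_involutive. reflexivity. Qed.

Lemma wave_x0 T :
  wave 0 T x0 = (v_gt theta alpha x0 + Bfun 0 T x0 * v_lt theta alpha x0)%C.
Proof. unfold wave. rewrite Afun_x0, v_gt_eq, v_lt_eq. ring. Qed.

Lemma dwave_x0 T :
  dwave 0 T x0 = (CDerive (v_gt theta alpha) x0 + Bfun 0 T x0 * CDerive (v_lt theta alpha) x0)%C.
Proof.
  pose proof (cderiv_RtoC _ x0 _ (pr_b _ _ _ _ _ _ _ _ _ W x0 Hx0)) as Db.
  pose proof (cderiv_mult _ _ x0 _ _ Db (cderiv_osc_phi W 0 x0)) as D1.
  pose proof (cderiv_mult _ _ x0 _ _ Db (cderiv_osc_mphi W 0 x0)) as D2.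
  apply (cderiv_ext _ (v_gt theta alpha)) in D1; [|intros; symmetry; apply v_gt_eq].
  apply (cderiv_ext _ (v_lt theta alpha)) in D2; [|intros; symmetry; apply v_lt_eq].
  rewrite (CDerive_unique _ _ _ D1), (CDerive_unique _ _ _ D2).
  unfold dwave. rewrite Afun_x0, wavenum_0, (RtoC_sqrt_q W x0 Hx0).
  pose proof (b_pos theta alpha x0 Htheta).
  rewrite RtoC_inv by lra. field. apply (b_neq0 W), Hx0.
Qed.

(** Proportionality is kept in product form through the limit, because u(x0) is not yet known to be
    nonzero. *)
Lemma outgoing_prop u T : volterra_sol 0 T -> outgoing theta alpha u ->
  forall x, x0 <= x -> (u x * wave 0 T x0 = u x0 * wave 0 T x)%C.
Proof.
  intros HT0 (sigma & w & Hneg & Hlim & Hsol & Hconv & Hdec) x Hx.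
  destruct (functional_choice (fun n Tn => volterra_sol (sigma n) Tn)) as [Tn HTn].
  { intros n. apply (volterra_sol_exists W). specialize (Hneg n). lra. }
  assert (Hneg' : forall n, sigma n <= 0) by (intros n; specialize (Hneg n); lra).
  assert (E : forall n, (w n x * wave (sigma n) (Tn n) x0 = w n x0 * wave (sigma n) (Tn n) x)%C).
  { intros n. destruct (proj1 (solution_iff theta alpha _ _ Htheta) (Hsol n)) as [w1 Hw1].
    exact (decaying_sol_prop W (sigma n) (Tn n) (w n) w1 (Hneg n) (HTn n)
      (fun t => proj1 (Hw1 t)) (fun t => proj2 (Hw1 t)) (Hdec n) x Hx). }
  assert (Lw : forall t, Cseq_lim (fun n => w n t) (u t)).
  { intros t eps He. destruct (Hconv (fun y => t <= y <= t) (compact_P3 t t) eps He) as [n0 Hn0].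
    exists n0. intros n Hn. apply Hn0; [exact Hn | lra]. }
  apply (Cseq_lim_unique (fun n => w n x * wave (sigma n) (Tn n) x0)%C).
  - apply Cseq_lim_mult; [apply Lw | apply (wave_seq_lim W); auto; lra].
  - apply (Cseq_lim_ext (fun n => w n x0 * wave (sigma n) (Tn n) x)%C _ (u x0 * wave 0 T x)%C); auto.
    apply Cseq_lim_mult; [apply Lw | apply (wave_seq_lim W); auto].
Qed.

Lemma scaled_wave_decays s T lam (w w1 : R -> C) : s < 0 -> volterra_sol s T ->
  (forall x, cderiv w x (w1 x)) ->
  (forall x, cderiv w1 x (- (wavenum s * wavenum s * RtoC (q x) * w x))%C) ->
  w x0 = (lam * wave s T x0)%C -> w1 x0 = (lam * dwave s T x0)%C ->
  filterlim w (Rbar_locally p_infty) (locally (T := C_UniformSpace) (RtoC 0)).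
Proof.
  intros Hs HTs Hw Hw1 E0 E1. assert (Hs' : s <= 0) by lra.
  assert (E : forall x, x0 <= x -> w x = (lam * wave s T x)%C).
  { intros x Hx. apply Ceq_minus.
    apply (ode_unique (fun x => w x - lam * wave s T x)%C (fun x => w1 x - lam * dwave s T x)%C
      q (wavenum s * wavenum s)%C x0 x x0); try lra; auto using q_cont, q_nonneg.
    - intros t Ht.
      pose proof (cderiv_minus _ _ t _ _ (Hw t) (cderiv_mult _ _ t _ _ (cderiv_const lam t)
        (cderiv_wave W s T t (proj1 (proj1 HTs)) ltac:(lra)))) as D.
      eapply cderiv_val; [|exact D]. cbv beta. ring.
    - intros t Ht.
      pose proof (cderiv_minus _ _ t _ _ (Hw1 t) (cderiv_mult _ _ t _ _ (cderiv_const lam t)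
        (cderiv_dwave W s T t Hs' HTs ltac:(lra)))) as D.
      eapply cderiv_val; [|exact D]. unfold q. cbv beta. ring.
    - rewrite E0. ring.
    - rewrite E1. ring. }
  apply Clim_infty. intros eps He.
  set (L := Cmod lam). assert (HL : 0 <= L) by apply Cmod_ge_0.
  (* From exp(-s x) >= 1 - s x: beyond this point eps exp(-s x) exceeds 2L, which beats the bound 2
     L exp(s x). *)
  exists (Rmax x0 (2 * L / (eps * - s))). intros x Hx.
  pose proof (Rmax_l x0 (2 * L / (eps * - s))). pose proof (Rmax_r x0 (2 * L / (eps * - s))).
  rewrite E by lra. replace (lam * wave s T x - RtoC 0)%C with (lam * wave s T x)%C by ring.
  rewrite Cmod_mult. fold L.
  apply Rle_lt_trans with (L * (2 * exp (s * x))).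
  { apply Rmult_le_compat_l; auto. apply (wave_le W); auto; lra. }
  assert (P : 0 < eps * - s) by (apply Rmult_lt_0_compat; lra).
  assert (A : 2 * L < eps * (- s * x)).
  { apply (Rmult_lt_reg_r (/ (eps * - s))); [apply Rinv_0_lt_compat, P|].
    replace (eps * (- s * x) * / (eps * - s)) with x by (field; lra).
    unfold Rdiv in *. lra. }
  pose proof (exp_ineq1_le (- (s * x))) as A2. rewrite exp_Ropp in A2.
  pose proof (exp_pos (s * x)) as A3.
  apply (Rmult_lt_reg_r (/ exp (s * x))); [apply Rinv_0_lt_compat, A3|].
  replace (L * (2 * exp (s * x)) * / exp (s * x)) with (2 * L) by (field; lra).
  apply Rlt_le_trans with (eps * (1 + - (s * x))); [nra|]. apply Rmult_le_compat_l; lra.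
Qed.

(** The difference w_n - u solves the equation of w_n with forcing -(k^2 - 1) q u, small on compact
    sets, and with small Cauchy data at x0; the energy estimate does the rest. *)
Lemma ode_continuous_dependence sigma (w w1 : nat -> R -> C) (u u1 : R -> C) :
  is_lim_seq sigma 0 ->
  (forall n x, cderiv (w n) x (w1 n x)) ->
  (forall n x, cderiv (w1 n) x
     (- (wavenum (sigma n) * wavenum (sigma n) * RtoC (q x) * w n x))%C) ->
  (forall x, cderiv u x (u1 x)) -> (forall x, cderiv u1 x (- (RtoC (q x) * u x))%C) ->
  Cseq_lim (fun n => w n x0) (u x0) -> Cseq_lim (fun n => w1 n x0) (u1 x0) ->
  forall K : R -> Prop, compact K -> forall eps, 0 < eps ->
  exists n0 : nat, forall n x, (n0 <= n)%nat -> K x -> Cmod (w n x - u x) < eps.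
Proof.
  intros Hs Hw Hw1 Hu Hu1 L0 L1 K HK eps He.
  destruct (compact_P1 K HK) as (m & m' & Hm).
  set (a := Rmin m x0). set (d := Rmax m' x0).
  assert (Ha : a <= m /\ a <= x0) by (split; [apply Rmin_l | apply Rmin_r]).
  assert (Hd : m' <= d /\ x0 <= d) by (split; [apply Rmax_l | apply Rmax_r]).
  destruct (continuous_bounded q a d q_cont) as [Kq HKq].
  assert (HKq0 : 0 <= Kq).
  { eapply Rle_trans; [apply (q_nonneg x0) | apply HKq; lra]. }
  destruct (continuous_bounded (fun x => Cmod (RtoC (q x) * u x)) a d) as [Ku HKu].
  { intros x. apply (continuous_ext (fun x => norm (V := C_R_NormedModule) (RtoC (q x) * u x)%C)).
    - intros t. apply norm_Cmod.
    - apply (continuous_comp (V := C_UniformSpace) (fun x => RtoC (q x) * u x)%C (norm (V := C_R_NormedModule))).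
      + apply ccont_mult; [apply ccont_RtoC, q_cont | eapply cderiv_ccont, Hu].
      + apply (filterlim_norm (V := C_R_NormedModule)). }
  assert (HKu0 : 0 <= Ku) by (eapply Rle_trans; [apply Cmod_ge_0 | apply (HKu x0); lra]).
  set (E := exp ((2 + 2 * Kq) * (d - a))).
  assert (HE : 1 <= E).
  { unfold E. rewrite <- exp_0. apply exp_le_mono. apply Rmult_le_pos; lra. }
  (* With data and forcing below eta, Gronwall gives |w_n - u|^2 <= 3 eta^2 E, which is below 4
     eta^2 E^2 = eps^2 as E >= 1. *)
  set (eta := eps / (2 * E)).
  assert (Heta : 0 < eta) by (apply Rdiv_lt_0_compat; lra).
  destruct (L0 eta Heta) as [n1 Hn1]. destruct (L1 eta Heta) as [n2 Hn2].
  pose proof (Cseq_lim_wavenum_sq sigma Hs) as Lk.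
  (* The bound 1 gives |k^2| <= 2, hence a Gronwall rate independent of n; the other makes the
     forcing at most eta. *)
  destruct (Lk (Rmin 1 (eta / (Ku + 1)))) as [n3 Hn3].
  { apply Rmin_glb_lt; [lra|]. apply Rdiv_lt_0_compat; lra. }
  exists (n1 + n2 + n3)%nat. intros n x Hn Kx.
  specialize (Hn1 n ltac:(lia)). specialize (Hn2 n ltac:(lia)). specialize (Hn3 n ltac:(lia)).
  assert (Hx : a <= x <= d) by (specialize (Hm x Kx); lra).
  set (k2 := (wavenum (sigma n) * wavenum (sigma n))%C) in *.
  assert (Hk1 : Cmod (k2 - RtoC 1) <= 1) by (left; eapply Rlt_le_trans; [exact Hn3 | apply Rmin_l]).
  assert (Hk2 : Cmod (k2 - RtoC 1) <= eta / (Ku + 1)) by (left; eapply Rlt_le_trans; [exact Hn3 | apply Rmin_r]).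
  assert (Hk3 : Cmod k2 <= 2).
  { replace k2 with (k2 - RtoC 1 + RtoC 1)%C by ring. eapply Rle_trans; [apply Cmod_triangle|].
    rewrite Cmod_1. lra. }
  assert (G : Cmod (w n x - u x) ^ 2 + Cmod (w1 n x - u1 x) ^ 2 + eta ^ 2
    <= (Cmod (w n x0 - u x0) ^ 2 + Cmod (w1 n x0 - u1 x0) ^ 2 + eta ^ 2)
       * exp ((2 + 2 * Kq) * Rabs (x - x0))).
  { apply (ode_gronwall (fun x => w n x - u x)%C (fun x => w1 n x - u1 x)%C
      (fun x => - (k2 - RtoC 1) * (RtoC (q x) * u x))%C q k2 a d); auto; try lra.
    - intros t Ht. exact (cderiv_minus _ _ t _ _ (Hw n t) (Hu t)).
    - intros t Ht. pose proof (cderiv_minus _ _ t _ _ (Hw1 n t) (Hu1 t)) as D.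
      eapply cderiv_val; [|exact D]. fold k2. ring.
    - intros t Ht. rewrite Cmod_mult, Cmod_R, Rabs_pos_eq by apply q_nonneg.
      apply Rmult_le_compat; auto using Cmod_ge_0, q_nonneg.
    - intros t Ht. apply pow_incr. split; [apply Cmod_ge_0|].
      rewrite Cmod_mult, Cmod_opp.
      apply Rle_trans with (eta / (Ku + 1) * Ku).
      + apply Rmult_le_compat; auto using Cmod_ge_0.
      + apply Rle_trans with (eta / (Ku + 1) * (Ku + 1)).
        * apply Rmult_le_compat_l; [|lra]. apply Rdiv_le_0_compat; lra.
        * right; field; lra. }
  assert (HE2 : exp ((2 + 2 * Kq) * Rabs (x - x0)) <= E).
  { apply exp_le_mono, Rmult_le_compat_l; [lra|]. apply Rabs_le; lra. }
  assert (S1 : Cmod (w n x0 - u x0) ^ 2 <= eta ^ 2) by (apply pow_incr; split; [apply Cmod_ge_0 | lra]).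
  assert (S2 : Cmod (w1 n x0 - u1 x0) ^ 2 <= eta ^ 2) by (apply pow_incr; split; [apply Cmod_ge_0 | lra]).
  assert (G2 : Cmod (w n x - u x) ^ 2 <= 3 * eta ^ 2 * E).
  { pose proof (pow2_ge_0 (Cmod (w1 n x - u1 x))). pose proof (pow2_ge_0 eta).
    eapply Rle_trans with (Cmod (w n x - u x) ^ 2 + Cmod (w1 n x - u1 x) ^ 2 + eta ^ 2); [lra|].
    eapply Rle_trans; [exact G|].
    apply Rmult_le_compat; try lra.
    - pose proof (pow2_ge_0 (Cmod (w n x0 - u x0))). pose proof (pow2_ge_0 (Cmod (w1 n x0 - u1 x0))). lra.
    - left; apply exp_pos. }
  assert (Eeta : eps = 2 * E * eta) by (unfold eta; field; lra).
  destruct (Rlt_le_dec (Cmod (w n x - u x)) eps) as [|Hge]; [assumption|exfalso].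
  assert (eps ^ 2 <= Cmod (w n x - u x) ^ 2) by (apply pow_incr; lra).
  assert (eps ^ 2 = 4 * E * (eta ^ 2 * E)) by (rewrite Eeta; ring).
  assert (0 < eta ^ 2 * E) by (apply Rmult_lt_0_compat; [apply pow_lt, Heta | lra]). nra.
Qed.

(** [outgoing] asks for solutions on the whole line, whereas the waves are available only on [x0,
    +oo); their Cauchy data at x0 are therefore continued by [linear_ode_exists]. *)
Lemma outgoing_of_data u T : volterra_sol 0 T -> solution theta alpha (RtoC 1) u ->
  (exists lam, u x0 = lam * wave 0 T x0 /\ CDerive u x0 = lam * dwave 0 T x0)%C ->
  outgoing theta alpha u.
Proof.
  intros HT0 Hu (lam & Eu & Eu1).
  destruct (proj1 (solution_iff _ _ _ _ Htheta) Hu) as [u1 Hu1].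
  assert (E1 : u1 x0 = CDerive u x0) by (symmetry; apply CDerive_unique, Hu1).
  set (sigma := fun n : nat => - / (INR n + 1)).
  assert (Pn : forall n, 0 < INR n + 1) by (intros n; pose proof (pos_INR n); lra).
  assert (Hneg : forall n, sigma n < 0).
  { intros n. unfold sigma. pose proof (Rinv_0_lt_compat _ (Pn n)). lra. }
  assert (Hneg' : forall n, sigma n <= 0) by (intros n; left; apply Hneg).
  assert (Hlim : is_lim_seq sigma 0).
  { unfold sigma. replace (Finite 0) with (Rbar_opp 0) by (simpl; f_equal; ring).
    apply (is_lim_seq_opp (fun n => / (INR n + 1))).
    apply (is_lim_seq_ext (fun n => / INR (S n))); [intros n; rewrite S_INR; reflexivity|].
    apply (is_lim_seq_incr_1 (fun n => / INR n)).
    apply (is_lim_seq_inv INR p_infty); [apply is_lim_seq_INR | discriminate]. }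
  destruct (functional_choice (fun n Tn => volterra_sol (sigma n) Tn)) as [Tn HTn].
  { intros n. apply (volterra_sol_exists W), Hneg'. }
  destruct (functional_choice (fun n (p : (R -> C) * (R -> C)) =>
    (forall x, cderiv (fst p) x (snd p x)) /\
    (forall x, cderiv (snd p) x (- (wavenum (sigma n) * wavenum (sigma n) * RtoC (q x) * fst p x))%C) /\
    fst p x0 = (lam * wave (sigma n) (Tn n) x0)%C /\
    snd p x0 = (lam * dwave (sigma n) (Tn n) x0)%C)) as [p Hp].
  { intros n.
    destruct (linear_ode_exists q (wavenum (sigma n) * wavenum (sigma n))%C x0
      (lam * wave (sigma n) (Tn n) x0)%C (lam * dwave (sigma n) (Tn n) x0)%C q_cont q_nonneg)
      as (w & w1 & A). exists (w, w1). exact A. }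
  exists sigma, (fun n => fst (p n)).
  split; [exact Hneg|]. split; [exact Hlim|]. split; [|split].
  - intros n. apply solution_iff; [exact Htheta|]. exists (snd (p n)). intros x.
    destruct (Hp n) as (A & B & _). split; [apply A | apply B].
  - apply (ode_continuous_dependence sigma (fun n => fst (p n)) (fun n => snd (p n)) u u1); auto.
    + intros n x; apply Hp.
    + intros n x; apply Hp.
    + intros x; apply Hu1.
    + intros x. eapply cderiv_val; [|apply Hu1]. unfold q. ring.
    + rewrite Eu. apply (Cseq_lim_ext (fun n => lam * wave (sigma n) (Tn n) x0)%C _ (lam * wave 0 T x0)%C);
        [intros n; symmetry; apply Hp | reflexivity |].
      apply Cseq_lim_mult; [apply Cseq_lim_const | apply (wave_seq_lim W); auto; lra].
    + rewrite E1, Eu1. apply (Cseq_lim_ext (fun n => lam * dwave (sigma n) (Tn n) x0)%C _ (lam * dwave 0 T x0)%C);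
        [intros n; symmetry; apply Hp | reflexivity |].
      apply Cseq_lim_mult; [apply Cseq_lim_const | apply (dwave_seq_lim W); auto].
  - intros n. destruct (Hp n) as (A & B & D & F).
    exact (scaled_wave_decays (sigma n) (Tn n) lam _ _ (Hneg n) (HTn n) A B D F).
Qed.

Lemma outgoing_iff u T : volterra_sol 0 T -> solution theta alpha (RtoC 1) u ->
  (exists x, u x <> RtoC 0) ->
  (outgoing theta alpha u <->
   u x0 <> RtoC 0 /\ (CDerive u x0 / u x0 = dwave 0 T x0 / wave 0 T x0)%C).
Proof.
  intros HT0 Hu [y Hy].
  pose proof (wave_neq0 W 0 T x0 (Rle_refl 0) HT0 (Rle_refl x0)) as Hden.
  destruct (proj1 (solution_iff _ _ _ _ Htheta) Hu) as [u1 Hu1].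
  assert (E1 : CDerive u x0 = u1 x0) by (apply CDerive_unique, Hu1).
  split.
  - intros Hout.
    assert (E : (u1 x0 * wave 0 T x0 = u x0 * dwave 0 T x0)%C).
    { apply Ceq_minus.
      apply (right_derivative_zero (fun x => u x * wave 0 T x0 - u x0 * wave 0 T x)%C x0).
      - intros x Hx. rewrite (outgoing_prop u T HT0 Hout x Hx). ring.
      - pose proof (cderiv_minus _ _ x0 _ _
          (cderiv_mult _ _ x0 _ _ (proj1 (Hu1 x0)) (cderiv_const (wave 0 T x0) x0))
          (cderiv_mult _ _ x0 _ _ (cderiv_const (u x0) x0)
             (cderiv_wave W 0 T x0 (proj1 (proj1 HT0)) Hx0))) as D.
        eapply cderiv_val; [|exact D]. cbv beta. ring. }
    (* If u(x0) = 0, the product relation and U(x0) <> 0 force u'(x0) = 0, so u vanishes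
       identically. *)
    assert (Hu0 : u x0 <> RtoC 0).
    { intros Z. rewrite Z in E.
      assert (Z1 : u1 x0 = RtoC 0).
      { transitivity (u1 x0 * wave 0 T x0 * / wave 0 T x0)%C; [field; exact Hden|].
        rewrite E. ring. }
      apply Hy.
      apply (ode_unique u u1 q (RtoC 1) (Rmin x0 y) (Rmax x0 y) x0); auto using q_cont, q_nonneg.
      - intros t _. apply Hu1.
      - intros t _. eapply cderiv_val; [|apply Hu1]. unfold q. ring.
      - split; [apply Rmin_l | apply Rmax_l].
      - split; [apply Rmin_r | apply Rmax_r]. }
    split; [exact Hu0|]. rewrite E1.
    transitivity (u1 x0 * wave 0 T x0 / (u x0 * wave 0 T x0))%C; [field; auto|].
    rewrite E. field. auto.
  - intros [Hu0 E]. apply (outgoing_of_data u T HT0 Hu).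
    (* Matching the values at x0 fixes the multiple; equality of the logarithmic derivatives then
       matches the derivatives. *)
    exists (u x0 / wave 0 T x0)%C. split; [field; exact Hden|].
    transitivity (CDerive u x0 / u x0 * u x0)%C; [field; exact Hu0|].
    rewrite E. field. exact Hden.
Qed.

End Scattering.

Theorem theorem2p4 :
  forall alpha x0 : R, 0 < alpha -> 0 < x0 ->
  exists theta0 : R, 0 < theta0 /\
  forall theta : R, 0 < theta < theta0 ->
  (exists S : R -> C, is_S_gt theta alpha x0 S) /\
  (forall S : R -> C, is_S_gt theta alpha x0 S ->
   let r := reflection theta alpha x0 S in
   let num := (CDerive (v_gt theta alpha) x0
               + r * CDerive (v_lt theta alpha) x0)%C in
   let den := (v_gt theta alpha x0 + r * v_lt theta alpha x0)%C in
   den <> RtoC 0 /\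
   forall u : R -> C,
     solution theta alpha (RtoC 1) u ->
     (exists x : R, u x <> RtoC 0) ->
     (outgoing theta alpha u <->
      u x0 <> RtoC 0 /\ (CDerive u x0 / u x0 = num / den)%C)).
Proof.
  intros alpha x0 Ha Hx0.
  destruct (profile_exists alpha x0 Ha Hx0) as (theta0 & Ht0 & Hprof).
  exists theta0. split; [exact Ht0|]. intros theta Ht.
  destruct (Hprof theta Ht) as (N & h & H & W & HM).
  assert (Ht' : 0 <= theta) by lra.
  split; [exact (is_S_gt_exists W HM)|].
  intros S HS r num den.
  destruct (is_S_gt_volterra W HM S HS) as (T & HT0 & ETS).
  assert (Er : r = Bfun (x0:=x0) (phi:=phi theta alpha) (N:=N) 0 T x0)
    by (apply (reflection_eq W HM S T (proj1 HT0) ETS)).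
  assert (Eden : den = wave (x0:=x0) (b:=b theta alpha) (phi:=phi theta alpha) (N:=N) 0 T x0).
  { unfold den. rewrite Er. symmetry. apply wave_x0. }
  assert (Enum : num = dwave (x0:=x0) (b:=b theta alpha) (b1:=db theta alpha) (phi:=phi theta alpha) (N:=N) 0 T x0).
  { unfold num. rewrite Er. symmetry. apply (dwave_x0 Ht' W). }
  split.
  - rewrite Eden. apply (wave_neq0 W); auto; lra.
  - intros u Hu Hne. rewrite Eden, Enum. apply (outgoing_iff Ht' W); auto.
Qed.
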